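(* Consider the trilinear operation $(x,y,z)=\beta(x\wedge y)\cdot z$ on the $\mathfrak{sl}(2,\mathbb{C})$-module $V(6)$. Let $I_7$ be the space of multilinear polynomial identities of degree 7 satisfied by this operation, and let $C_7\subseteq I_7$ be the subspace of those which are consequences of skew-symmetry $(a,b,c)+(b,a,c)\equiv0$ and the ternary derivation identity $$((a,b,c),d,e)-((a,b,d),c,e)-(a,b,(c,d,e))+(c,d,(a,b,e))\equiv 0.$$ Then the space $I_7/C_7$ of new identities (those not consequences of skew-symmetry and the ternary derivation identity) has dimension $357$. Moreover, writing $(xyz)$ for $(x,y,z)$, the following 141-term polynomial in $a,b,c,d,e,f,g$ belongs to $I_7$ but not to $C_7$, and the $S_7$-submodule of $I_7/C_7$ generated by its class has dimension $42$: $$\begin{aligned} &\big[(((bce)da)fg)+(((bdc)ea)fg)+(((bec)da)fg)\big]\\ -&\big[(((bcd)ea)fg)+(((bde)ca)fg)+(((bed)ca)fg)\big]\\ +2&\big[((ab(cde))fg)+((ab(dec))fg)+((ac(bed))fg)+((ad(bce))fg)\\ &+((ad(ceb))fg)+((ae(bdc))fg)+((bc(dea))fg)+((cd(bea))fg)\big]\\ -2&\big[((ab(ced))fg)+((ac(bde))fg)+((ac(deb))fg)+((ad(bec))fg)\\ &+((ae(bcd))fg)+((ae(cdb))fg)+((bd(cea))fg)\big]\\ +3&\big[(((abc)de)fg)+(((abd)ec)fg)+(((abe)cd)fg)+(((acb)ed)fg)\\ &+(((acd)be)fg)+(((ace)db)fg)+(((adb)ce)fg)+(((adc)eb)fg)\\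 &+(((ade)bc)fg)+(((aeb)dc)fg)+(((aec)bd)fg)+(((aed)cb)fg)\big]\\ -3&\big[(((abc)ed)fg)+(((abd)ce)fg)+(((abe)dc)fg)+(((acb)de)fg)\\ &+(((acd)eb)fg)+(((ace)bd)fg)+(((adb)ec)fg)+(((adc)be)fg)\\ &+(((ade)cb)fg)+(((aeb)cd)fg)+(((aec)db)fg)+(((aed)bc)fg)\big]\\ +4&\big[(((abc)ef)dg)+(((abd)cf)eg)+(((abe)df)cg)+(((acb)df)eg)\\ &+(((acd)ef)bg)+(((ace)bf)dg)+(((adb)ef)cg)+(((adc)bf)eg)\\ &+(((ade)cf)bg)+(((aeb)cf)dg)+(((aec)df)bg)+(((aed)bf)cg)\\ &+(((afb)cd)eg)+(((afb)de)cg)+(((afb)ec)dg)+(((afc)be)dg)\\ &+(((afc)db)eg)+(((afc)ed)bg)+(((afd)bc)eg)+(((afd)ce)bg)\\ &+(((afd)eb)cg)+(((afe)bd)cg)+(((afe)cb)dg)+(((afe)dc)bg)\big]\\ -4&\big[(((abc)df)eg)+(((abd)ef)cg)+(((abe)cf)dg)+(((acb)ef)dg)\\ &+(((acd)bf)eg)+(((ace)df)bg)+(((adb)cf)eg)+(((adc)ef)bg)\\ &+(((ade)bf)cg)+(((aeb)df)cg)+(((aec)bf)dg)+(((aed)cf)bg)\\ &+(((afb)ce)dg)+(((afb)dc)eg)+(((afb)ed)cg)+(((afc)bd)eg)\\ &+(((afc)de)bg)+(((afc)eb)dg)+(((afd)be)cg)+(((afd)cb)eg)\\ &+(((afd)ec)bg)+(((afe)bc)dg)+(((afe)cd)bg)+(((afe)db)cg)\big]\\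 +8&\big[(((abc)fe)dg)+(((abd)fc)eg)+(((abe)fd)cg)+(((abf)cd)eg)\\ &+(((abf)de)cg)+(((abf)ec)dg)+(((acb)fd)eg)+(((acd)fe)bg)\\ &+(((ace)fb)dg)+(((acf)be)dg)+(((acf)db)eg)+(((acf)ed)bg)\\ &+(((adb)fe)cg)+(((adc)fb)eg)+(((ade)fc)bg)+(((adf)bc)eg)\\ &+(((adf)ce)bg)+(((adf)eb)cg)+(((aeb)fc)dg)+(((aec)fd)bg)\\ &+(((aed)fb)cg)+(((aef)bd)cg)+(((aef)cb)dg)+(((aef)dc)bg)\big]\\ -8&\big[(((abc)fd)eg)+(((abd)fe)cg)+(((abe)fc)dg)+(((abf)ce)dg)\\ &+(((abf)dc)eg)+(((abf)ed)cg)+(((acb)fe)dg)+(((acd)fb)eg)\\ &+(((ace)fd)bg)+(((acf)bd)eg)+(((acf)de)bg)+(((acf)eb)dg)\\ &+(((adb)fc)eg)+(((adc)fe)bg)+(((ade)fb)cg)+(((adf)be)cg)\\ &+(((adf)cb)eg)+(((adf)ec)bg)+(((aeb)fd)cg)+(((aec)fb)dg)\\ &+(((aed)fc)bg)+(((aef)bc)dg)+(((aef)cd)bg)+(((aef)db)cg)\big]. \end{aligned}$$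
   Context: $V(6)$ is the 7-dimensional irreducible $\mathfrak{sl}(2,\mathbb{C})$-module with basis $v_6,v_4,v_2,v_0,v_{-2},v_{-4},v_{-6}$ of $H$-eigenvectors, where $H\cdot v_{6-2i}=(6-2i)v_{6-2i}$, $E\cdot v_{6-2i}=(7-i)v_{6-2(i-1)}$, $F\cdot v_{6-2i}=(i+1)v_{6-2(i+1)}$ (with $v_8=v_{-8}=0$). Here $H,E,F$ is the standard basis of $\mathfrak{sl}(2,\mathbb{C})$, with $[H,E]=2E$, $[H,F]=-2F$, $[E,F]=H$. The map $\beta\colon\Lambda^2V(6)\to V(2)\approx\mathfrak{sl}(2,\mathbb{C})$ is the (unique up to nonzero scalar) nonzero $\mathfrak{sl}(2,\mathbb{C})$-module morphism. With $u_2=-E$, $u_0=H$, $u_{-2}=F$ it is normalized by $\beta(v_6\wedge v_{-4})=2u_2$, $\beta(v_6\wedge v_{-6})=u_0$, $\beta(v_4\wedge v_{-2})=-10u_2$, $\beta(v_4\wedge v_{-4})=-4u_0$, $\beta(v_4\wedge v_{-6})=2u_{-2}$, $\beta(v_2\wedge v_0)=20u_2$, $\beta(v_2\wedge v_{-2})=5u_0$, $\beta(v_2\wedge v_{-4})=-10u_{-2}$, $\beta(v_0\wedge v_{-2})=20u_{-2}$, and $\beta(v_p\wedge v_q)=0$ for all other $p>q$. The dot in $\beta(x\wedge y)\cdot z$ is the action of $\mathfrak{sl}(2,\mathbb{C})$ on $V(6)$. Multilinear polynomials of degree 7 are the elements, multilinear in the seven variables, of the free algebra over $\mathbb{C}$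 with one trilinear operation $(x,y,z)$ that is skew-symmetric in its first two arguments; $S_7$ acts by permuting the variables. A polynomial is an identity for the operation if it vanishes for all substitutions of elements of $V(6)$. An identity is a consequence of a set of identities if it is satisfied by every vector space over $\mathbb{C}$ with a trilinear operation satisfying all identities in the set. *)

(* Defs.v *)
From HB Require Import structures.
From mathcomp Require Import all_boot all_order all_algebra all_fingroup.
From mathcomp Require Import finmap monalg.
From mathcomp Require Import complex.
From mathcomp Require Import reals.

Set Implicit Arguments.
Unset Strict Implicit.
Unset Printing Implicit Defensive.

Import GRing.Theory.
Local Open Scope ring_scope.

Section TernaryOperations.
Variables (K : numFieldType) (V : lmodType K).
Implicit Type o : V -> V -> V -> V.

Definition trilinear o : Prop :=
  [/\ forall y z, linear (fun x => o x y z),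
      forall x z, linear (fun y => o x y z) &
      forall x y, linear (fun z => o x y z)].

Definition skew_symmetric o : Prop :=
  forall a b c, o a b c + o b a c = 0.

Definition ternary_derivation o : Prop :=
  forall a b c d e,
    o (o a b c) d e - o (o a b d) c e - o a b (o c d e) + o c d (o a b e) = 0.

End TernaryOperations.

(* numFieldType makes the characteristic 0, so that skew-symmetry is the same as
   o a a b = 0.

   The free algebra on generators x_0, ..., x_{n-1} with one trilinear
   operation, skew-symmetric in its first two arguments: it has as a basis the
   ternary trees in which the first two children of each node are strictly
   increasing for a fixed total order [mon_lt].  [feval_gen], [feval_linear],
   [feval_fop] and [feval_unique] below are its universal property. *)

Inductive mon (n : nat) := Leaf of 'I_n | Node of mon n & mon n & mon n.
Arguments Leaf {n}.
Arguments Node {n}.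

Section MonCountable.
Variable n : nat.

Fixpoint mon_encode (t : mon n) : GenTree.tree 'I_n :=
  match t with
  | Leaf i => GenTree.Leaf i
  | Node a b c => GenTree.Node 0 [:: mon_encode a; mon_encode b; mon_encode c]
  end.

Fixpoint mon_decode (t : GenTree.tree 'I_n) : option (mon n) :=
  match t with
  | GenTree.Leaf i => Some (Leaf i)
  | GenTree.Node _ [:: a; b; c] =>
      match mon_decode a, mon_decode b, mon_decode c with
      | Some a', Some b', Some c' => Some (Node a' b' c')
      | _, _, _ => None
      end
  | _ => None
  end.

Lemma mon_encodeK : pcancel mon_encode mon_decode.
Proof. by elim=> //= a -> b -> c ->. Qed.

HB.instance Definition _ := Countable.copy (mon n) (pcan_type mon_encodeK).

End MonCountable.

Section NormalMonomials.
Variable n : nat.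

Fixpoint mon_lt (s t : mon n) : bool :=
  match s, t with
  | Leaf i, Leaf j => (i < j)%N
  | Leaf _, Node _ _ _ => true
  | Node _ _ _, Leaf _ => false
  | Node a b c, Node a' b' c' =>
      mon_lt a a' || (a == a') && (mon_lt b b' || (b == b') && mon_lt c c')
  end.

Lemma mon_lt_irr : irreflexive mon_lt.
Proof.
by elim=> [i|a IHa b IHb c IHc] /=; rewrite ?ltnn // IHa IHb IHc !andbF.
Qed.

Lemma mon_lt_asym s t : mon_lt s t -> mon_lt t s = false.
Proof.
elim: s t => [i|a IHa b IHb c IHc] [j|a' b' c'] //=.
  by move=> lt_ij; apply/negbTE; rewrite -leqNgt ltnW.
case/orP=> [lt_a|/andP[/eqP<-]].
  rewrite (IHa _ lt_a) /=; case: eqP => // eq_a.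
  by rewrite eq_a mon_lt_irr in lt_a.
rewrite mon_lt_irr eqxx /=.
case/orP=> [lt_b|/andP[/eqP<- /IHc->]].
  rewrite (IHb _ lt_b) /=; case: eqP => // eq_b.
  by rewrite eq_b mon_lt_irr in lt_b.
by rewrite mon_lt_irr eqxx.
Qed.

Lemma mon_lt_total s t : s != t -> mon_lt s t || mon_lt t s.
Proof.
elim: s t => [i|a IHa b IHb c IHc] [j|a' b' c'] //=.
  by move=> ne; rewrite -neq_ltn; apply: contraNneq ne => /val_inj ->.
have [<-|ne_a _] := eqVneq a a'; last first.
  by have /orP[->|->] := IHa _ ne_a; rewrite ?orbT.
have [<-|ne_b _] := eqVneq b b'; last first.
  by have /orP[->|->] := IHb _ ne_b; rewrite ?orbT.
have [<-|ne_c _] := eqVneq c c'; first by rewrite eqxx.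
by have /orP[->|->] := IHc _ ne_c; rewrite ?orbT.
Qed.

Fixpoint normal (t : mon n) : bool :=
  if t is Node a b c then [&& normal a, normal b, normal c & mon_lt a b]
  else true.

Record nmon := NMon { nmon_val :> mon n; _ : normal nmon_val }.
HB.instance Definition _ := [isSub for nmon_val].
HB.instance Definition _ := [Countable of nmon by <:].

Fixpoint leaves (t : mon n) : seq 'I_n :=
  match t with
  | Leaf i => [:: i]
  | Node a b c => leaves a ++ leaves b ++ leaves c
  end.

End NormalMonomials.

Notation freeskew K n := {malg K[nmon n]}.

(* The linear extension to {malg K[T]} of a map F defined on its basis T. *)
Definition lext (K : numFieldType) (T : choiceType) (V : lmodType K)
    (F : T -> V) (f : {malg K[T]}) : V :=
  \sum_(t <- msupp f) f@_t *: F t.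

Section FreeAlgebra.
Variables (K : numFieldType) (n : nat).
Local Notation A := (freeskew K n).

Definition gen (i : 'I_n) : A := << @NMon n (Leaf i) isT >>.

(* For normal x, y, z, [insub (Node x y z)] succeeds exactly when
   [mon_lt x y]. *)
Definition bop (x y z : nmon n) : A :=
  if insub (Node x y z : mon n) is Some t then << (t : nmon n) >>
  else if insub (Node y x z : mon n) is Some t then - << (t : nmon n) >>
  else 0.

Definition fop (f g h : A) : A :=
  lext (fun x => lext (fun y => lext (fun z => bop x y z) h) g) f.

(* The value of f in (V, o) at the substitution x_i := rho i. *)
Section Evaluation.
Variables (V : lmodType K) (o : V -> V -> V -> V) (rho : 'I_n -> V).

Fixpoint meval (t : mon n) : V :=
  match t with
  | Leaf i => rho i
  | Node a b c => o (meval a) (meval b) (meval c)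
  end.

Definition feval (f : A) : V := lext (fun t : nmon n => meval t) f.

End Evaluation.

Definition identity_of (V : lmodType K) (o : V -> V -> V -> V) (f : A) : Prop :=
  forall rho : 'I_n -> V, feval o rho f = 0.

Definition multilinear (f : A) : bool :=
  all (fun t : nmon n => perm_eq (leaves t) (enum 'I_n)) (msupp f).

Definition perm_vars (s : 'S_n) (f : A) : A := feval fop (fun i => gen (s i)) f.

End FreeAlgebra.

Section UniversalProperty.

Section LinearExtension.
Variables (K : numFieldType) (T : choiceType) (V : lmodType K).
Implicit Types (F G : T -> V) (f : {malg K[T]}).

Lemma lextEw F (d : {fset T}) f : (msupp f `<=` d)%fset ->
  lext F f = \sum_(t <- d) f@_t *: F t.
Proof.
move=> le_fd; rewrite /lext (big_fset_incl _ le_fd) // => t _.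
by move/mcoeff_outdom=> ->; rewrite scale0r.
Qed.

Lemma lext_linear F : linear (lext F).
Proof.
move=> a f g; pose d := (msupp f `|` msupp g)%fset.
rewrite (@lextEw F d f) ?fsubsetUl // (@lextEw F d g) ?fsubsetUr //.
rewrite (@lextEw F d); last first.
  by apply: (fsubset_trans (msuppD_le _ _)); rewrite fsetSU // msuppZ_le.
rewrite scaler_sumr -big_split /=; apply: eq_bigr => t _.
by rewrite mcoeffD mcoeffZ scalerDl scalerA.
Qed.
HB.instance Definition _ F :=
  GRing.isLinear.Build K {malg K[T]} V _ (lext F) (lext_linear F).

Lemma lextU F t : lext F << t >> = F t.
Proof.
rewrite /lext msuppU (negbTE (oner_neq0 K)) big_seq_fset1 mcoeffUU.
by rewrite scale1r.
Qed.

Lemma eq_lext F G : F =1 G -> lext F =1 lext G.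
Proof. by move=> eqFG f; apply: eq_bigr => t _; rewrite eqFG. Qed.

Lemma lextP a F G f : lext (fun t => a *: F t + G t) f = a *: lext F f + lext G f.
Proof.
rewrite scaler_sumr -big_split; apply: eq_bigr => t _ /=.
by rewrite scalerDr !scalerA mulrC.
Qed.

Lemma lextN F f : lext (fun t => - F t) f = - lext F f.
Proof. by rewrite -sumrN; apply: eq_bigr => t _; rewrite scalerN. Qed.

Lemma linear_lext (phi : {malg K[T]} -> V) :
  linear phi -> forall f, phi f = lext (fun t => phi << t >>) f.
Proof.
move=> lin f; pose phiL := GRing.isLinear.Build _ _ _ _ phi lin.
pose p : {linear {malg K[T]} -> V} := HB.pack phi phiL.
rewrite -[phi]/(p : _ -> _) {1}[f]monalgE linear_sum; apply: eq_bigr => t _.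
by rewrite -linearZ; congr (p _); apply/malgP=> u;
   rewrite mcoeffZ !mcoeffU mulrnAr mulr1.
Qed.

End LinearExtension.

Lemma lext_exchange (K : numFieldType) (S T : choiceType) (V : lmodType K)
    (F : S -> T -> V) f g :
  lext (fun x => lext (F x) g) f = lext (fun y => lext (F^~ y) f) g.
Proof.
rewrite /lext; under eq_bigr do rewrite scaler_sumr.
rewrite exchange_big; apply: eq_bigr => y _; rewrite scaler_sumr.
by apply: eq_bigr => x _; rewrite !scalerA mulrC.
Qed.

Lemma lext_comp (K : numFieldType) (T : choiceType) (U V : lmodType K)
    (phi : {linear U -> V}) (F : T -> U) f :
  phi (lext F f) = lext (fun t => phi (F t)) f.
Proof. by rewrite linear_sum; apply: eq_bigr => t _; rewrite linearZ. Qed.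

Variables (K : numFieldType) (n : nat).
Local Notation A := (freeskew K n).

Lemma normal_Node (x y z : nmon n) : normal (Node x y z : mon n) = mon_lt x y.
Proof. by rewrite /= (valP x) (valP y) (valP z). Qed.

Lemma bop_skew x y z : bop K x y z = - bop K y x z :> A.
Proof.
rewrite /bop; case: insubP => [t|]; rewrite normal_Node => lt_xy.
  move=> _; rewrite insubN ?opprK // normal_Node.
  by rewrite (mon_lt_asym lt_xy).
by case: insubP => //=; rewrite oppr0.
Qed.

Lemma fop_trilinear : trilinear (@fop K n).
Proof.
split=> [g h|f h|f g] a u v; rewrite /fop.
- exact: lext_linear.
- by apply: etrans (lextP _ _ _ _); apply: eq_lext => x; apply: lext_linear.
- apply: etrans (lextP _ _ _ _); apply: eq_lext => x.
  by apply: etrans (lextP _ _ _ _); apply: eq_lext => y; apply: lext_linear.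
Qed.

Lemma fop_skew : skew_symmetric (@fop K n).
Proof.
move=> f g h; apply/eqP; rewrite addr_eq0; apply/eqP.
apply: (etrans (lext_exchange _ _ _)); apply: etrans (lextN _ _).
apply: eq_lext => y; apply: etrans (lextN _ _); apply: eq_lext => x.
by apply: etrans (lextN _ _); apply: eq_lext => z; apply: bop_skew.
Qed.

Section Morphism.
Variables (V : lmodType K) (o : V -> V -> V -> V) (rho : 'I_n -> V).
Hypotheses (o_lin : trilinear o) (o_skew : skew_symmetric o).
Local Notation ev := (feval o rho).

Lemma feval_linear : linear ev.
Proof. exact: lext_linear. Qed.
HB.instance Definition _ :=
  GRing.isLinear.Build K {malg K[nmon n]} V _ ev feval_linear.

Lemma feval_gen i : ev (gen K i) = rho i.
Proof. exact: lextU. Qed.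

Lemma feval_bop x y z :
  ev (bop K x y z) = o (meval o rho x) (meval o rho y) (meval o rho z).
Proof.
rewrite /bop; case: insubP => [t _ def_t|]; first by rewrite /feval lextU def_t.
rewrite normal_Node => ge_xy; case: insubP => [t _ def_t|].
  rewrite linearN /= /feval lextU def_t /=.
  by apply/eqP; rewrite eq_sym -addr_eq0 o_skew.
rewrite normal_Node linear0 => ge_yx; case: (eqVneq (x : mon n) y) => [->|].
  have /eqP := o_skew (meval o rho y) (meval o rho y) (meval o rho z).
  by rewrite -mulr2n -scaler_nat scaler_eq0 Num.Theory.pnatr_eq0 /= => /eqP.
by move/mon_lt_total; rewrite (negbTE ge_xy) (negbTE ge_yx).
Qed.

Lemma feval_fop f g h : ev (fop f g h) = o (ev f) (ev g) (ev h).
Proof.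
case: o_lin => l1 l2 l3; rewrite /fop lext_comp /=.
pose L1 y z : {linear V -> V} := HB.pack (fun x => o x y z)
  (GRing.isLinear.Build _ _ _ _ (fun x => o x y z) (l1 y z)).
pose L2 x z : {linear V -> V} := HB.pack (fun y => o x y z)
  (GRing.isLinear.Build _ _ _ _ (fun y => o x y z) (l2 x z)).
pose L3 x y : {linear V -> V} := HB.pack (o x y)
  (GRing.isLinear.Build _ _ _ _ (o x y) (l3 x y)).
rewrite -[RHS]/(L1 (ev g) (ev h) (ev f)) lext_comp; apply: eq_lext => x.
rewrite lext_comp /= -[RHS]/(L2 _ (ev h) (ev g)) lext_comp.
apply: eq_lext => y; rewrite lext_comp /= -[RHS]/(L3 _ _ (ev h)) lext_comp.
by apply: eq_lext => z; rewrite feval_bop.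
Qed.

Lemma feval_unique (phi : A -> V) :
    linear phi -> (forall f g h, phi (fop f g h) = o (phi f) (phi g) (phi h)) ->
  (forall i, phi (gen K i) = rho i) -> phi =1 ev.
Proof.
move=> phi_lin phiM phi_gen f; rewrite (linear_lext phi_lin) /feval.
apply: eq_lext => -[t]; elim: t => [i|a IHa b IHb c IHc] nt.
  by rewrite /= -(phi_gen i) /gen; congr (phi << _ >>); apply: val_inj.
have /= /and4P[na nb nc lt_ab] := nt.
rewrite /= -(IHa na) -(IHb nb) -(IHc nc) -phiM /fop !lextU /bop /=.
by rewrite (insubT _ nt) /=; congr (phi << _ >>); apply: val_inj.
Qed.

End Morphism.
End UniversalProperty.

(* For subspaces C of I, the quotient I/C has dimension m: the classes of some
   b_0, ..., b_{m-1} in I form a basis of it. *)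
Definition quotient_dim (K : numFieldType) (n : nat)
    (I C : freeskew K n -> Prop) (m : nat) : Prop :=
  exists b : 'I_m -> freeskew K n,
    (forall i, I (b i)) /\
    (forall f, I f -> exists! c : 'rV[K]_m, C (f - \sum_i c 0 i *: b i)).

(* The preimage in the free algebra of the S_n-submodule generated by the class
   of p modulo C. *)
Definition generated_mod (K : numFieldType) (n : nat)
    (C : freeskew K n -> Prop) (p f : freeskew K n) : Prop :=
  exists c : 'S_n -> K, C (f - \sum_s c s *: perm_vars s p).

Section V6.
Variable K : numFieldType.

Definition sl2_E : 'M[K]_2 := delta_mx 0 1.
Definition sl2_F : 'M[K]_2 := delta_mx 1 0.
Definition sl2_H : 'M[K]_2 := delta_mx 0 0 - delta_mx 1 1.

(* V(6) is 'rV[K]_7, with v_{6-2i} the i-th standard basis row vector; the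
   i-th row of each matrix below is the image of v_{6-2i}. *)
Definition V6_H : 'M[K]_7 :=
  \matrix_(i, j) ((6%:R - (2 * i)%:R) *+ (i == j)).
Definition V6_E : 'M[K]_7 :=
  \matrix_(i, j) ((7 - i)%:R *+ (i == j.+1 :> nat)).
Definition V6_F : 'M[K]_7 :=
  \matrix_(i, j) (i.+1%:R *+ (j == i.+1 :> nat)).

(* sl(2) is realized as the traceless matrices M = M_00 H + M_01 E + M_10 F;
   only such M occur below. *)
Definition sl2_act (M : 'M[K]_2) (x : 'rV[K]_7) : 'rV[K]_7 :=
  M 0 0 *: (x *m V6_H) + M 0 1 *: (x *m V6_E) + M 1 0 *: (x *m V6_F).

(* beta_basis i j is the image of v_{6-2i} /\ v_{6-2j}, for i < j. *)
Definition beta_basis (i j : nat) : 'M[K]_2 :=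
  let u2 := - sl2_E in let u0 := sl2_H in let um2 := sl2_F in
  match i, j with
  | 0%N, 5%N => 2%:R *: u2
  | 0%N, 6%N => u0
  | 1%N, 4%N => (- 10%:R) *: u2
  | 1%N, 5%N => (- 4%:R) *: u0
  | 1%N, 6%N => 2%:R *: um2
  | 2%N, 3%N => 20%:R *: u2
  | 2%N, 4%N => 5%:R *: u0
  | 2%N, 5%N => (- 10%:R) *: um2
  | 3%N, 4%N => 20%:R *: um2
  | _, _ => 0
  end.

Definition beta (x y : 'rV[K]_7) : 'M[K]_2 :=
  \sum_(i < 7) \sum_(j < 7 | (i < j)%N)
    (x 0 i * y 0 j - x 0 j * y 0 i) *: beta_basis i j.

Definition V6_op (x y z : 'rV[K]_7) : 'rV[K]_7 := sl2_act (beta x y) z.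

Definition identities7 (f : freeskew K 7) : Prop :=
  multilinear f /\ identity_of V6_op f.

Definition consequences7 (f : freeskew K 7) : Prop :=
  multilinear f /\
  forall (W : lmodType K) (o : W -> W -> W -> W),
    trilinear o -> skew_symmetric o -> ternary_derivation o -> identity_of o f.

End V6.

Definition polynomial141 (V : zmodType) (o : V -> V -> V -> V)
    (a b c d e f g : V) : V :=
    (o (o (o b c e) d a) f g + o (o (o b d c) e a) f g + o (o (o b e c) d a) f g)
  - (o (o (o b c d) e a) f g + o (o (o b d e) c a) f g + o (o (o b e d) c a) f g)
  + (o (o a b (o c d e)) f g + o (o a b (o d e c)) f g + o (o a c (o b e d)) f g
     + o (o a d (o b c e)) f g + o (o a d (o c e b)) f g + o (o a e (o b d c)) f g
     + o (o b c (o d e a)) f g + o (o c d (o b e a)) f g) *+ 2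
  - (o (o a b (o c e d)) f g + o (o a c (o b d e)) f g + o (o a c (o d e b)) f g
     + o (o a d (o b e c)) f g + o (o a e (o b c d)) f g + o (o a e (o c d b)) f g
     + o (o b d (o c e a)) f g) *+ 2
  + (o (o (o a b c) d e) f g + o (o (o a b d) e c) f g + o (o (o a b e) c d) f g
     + o (o (o a c b) e d) f g + o (o (o a c d) b e) f g + o (o (o a c e) d b) f g
     + o (o (o a d b) c e) f g + o (o (o a d c) e b) f g + o (o (o a d e) b c) f g
     + o (o (o a e b) d c) f g + o (o (o a e c) b d) f g + o (o (o a e d) c b) f g) *+ 3
  - (o (o (o a b c) e d) f g + o (o (o a b d) c e) f g + o (o (o a b e) d c) f g
     + o (o (o a c b) d e) f g + o (o (o a c d) e b) f g + o (o (o a c e) b d) f g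
     + o (o (o a d b) e c) f g + o (o (o a d c) b e) f g + o (o (o a d e) c b) f g
     + o (o (o a e b) c d) f g + o (o (o a e c) d b) f g + o (o (o a e d) b c) f g) *+ 3
  + (o (o (o a b c) e f) d g + o (o (o a b d) c f) e g + o (o (o a b e) d f) c g
     + o (o (o a c b) d f) e g + o (o (o a c d) e f) b g + o (o (o a c e) b f) d g
     + o (o (o a d b) e f) c g + o (o (o a d c) b f) e g + o (o (o a d e) c f) b g
     + o (o (o a e b) c f) d g + o (o (o a e c) d f) b g + o (o (o a e d) b f) c g
     + o (o (o a f b) c d) e g + o (o (o a f b) d e) c g + o (o (o a f b) e c) d g
     + o (o (o a f c) b e) d g + o (o (o a f c) d b) e g + o (o (o a f c) e d) b g
     + o (o (o a f d) b c) e g + o (o (o a f d) c e) b g + o (o (o a f d) e b) c g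
     + o (o (o a f e) b d) c g + o (o (o a f e) c b) d g + o (o (o a f e) d c) b g) *+ 4
  - (o (o (o a b c) d f) e g + o (o (o a b d) e f) c g + o (o (o a b e) c f) d g
     + o (o (o a c b) e f) d g + o (o (o a c d) b f) e g + o (o (o a c e) d f) b g
     + o (o (o a d b) c f) e g + o (o (o a d c) e f) b g + o (o (o a d e) b f) c g
     + o (o (o a e b) d f) c g + o (o (o a e c) b f) d g + o (o (o a e d) c f) b g
     + o (o (o a f b) c e) d g + o (o (o a f b) d c) e g + o (o (o a f b) e d) c g
     + o (o (o a f c) b d) e g + o (o (o a f c) d e) b g + o (o (o a f c) e b) d g
     + o (o (o a f d) b e) c g + o (o (o a f d) c b) e g + o (o (o a f d) e c) b g
     + o (o (o a f e) b c) d g + o (o (o a f e) c d) b g + o (o (o a f e) d b) c g) *+ 4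
  + (o (o (o a b c) f e) d g + o (o (o a b d) f c) e g + o (o (o a b e) f d) c g
     + o (o (o a b f) c d) e g + o (o (o a b f) d e) c g + o (o (o a b f) e c) d g
     + o (o (o a c b) f d) e g + o (o (o a c d) f e) b g + o (o (o a c e) f b) d g
     + o (o (o a c f) b e) d g + o (o (o a c f) d b) e g + o (o (o a c f) e d) b g
     + o (o (o a d b) f e) c g + o (o (o a d c) f b) e g + o (o (o a d e) f c) b g
     + o (o (o a d f) b c) e g + o (o (o a d f) c e) b g + o (o (o a d f) e b) c g
     + o (o (o a e b) f c) d g + o (o (o a e c) f d) b g + o (o (o a e d) f b) c g
     + o (o (o a e f) b d) c g + o (o (o a e f) c b) d g + o (o (o a e f) d c) b g) *+ 8
  - (o (o (o a b c) f d) e g + o (o (o a b d) f e) c g + o (o (o a b e) f c) d g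
     + o (o (o a b f) c e) d g + o (o (o a b f) d c) e g + o (o (o a b f) e d) c g
     + o (o (o a c b) f e) d g + o (o (o a c d) f b) e g + o (o (o a c e) f d) b g
     + o (o (o a c f) b d) e g + o (o (o a c f) d e) b g + o (o (o a c f) e b) d g
     + o (o (o a d b) f c) e g + o (o (o a d c) f e) b g + o (o (o a d e) f b) c g
     + o (o (o a d f) b e) c g + o (o (o a d f) c b) e g + o (o (o a d f) e c) b g
     + o (o (o a e b) f d) c g + o (o (o a e c) f b) d g + o (o (o a e d) f c) b g
     + o (o (o a e f) b c) d g + o (o (o a e f) c d) b g + o (o (o a e f) d b) c g) *+ 8.

Definition new_identity (K : numFieldType) : freeskew K 7 :=
  let x (i : 'I_7) : freeskew K 7 := gen K i in
  polynomial141 (@fop K 7)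
    (x (@Ordinal 7 0 isT)) (x (@Ordinal 7 1 isT)) (x (@Ordinal 7 2 isT))
    (x (@Ordinal 7 3 isT)) (x (@Ordinal 7 4 isT)) (x (@Ordinal 7 5 isT))
    (x (@Ordinal 7 6 isT)).

(* Main.v *)
From Stdlib Require Import ZArith.
From HB Require Import structures.
Require Import Defs.
From mathcomp Require Import all_boot all_order all_algebra all_fingroup.
From mathcomp Require Import finmap monalg boolp.
From mathcomp Require Import complex reals.
From mathcomp Require Import zify ssrZ.

Set Implicit Arguments.
Unset Strict Implicit.
Unset Printing Implicit Defensive.

Import GRing.Theory Num.Theory.
Local Open Scope ring_scope.
Delimit Scope Z_scope with ZZ.

(** The theorem reduces to finite linear algebra with an action of S_7, and the
    work lies in making this linear algebra small enough.

    Up to skew-symmetry there are six ways to bracket seven factors, so the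
    multilinear polynomials are the image of a permutation module on six copies
    of S_7 (Phi, Phi_onto). Let DI and DC be the spaces of functionals on it that
    kill the identities of V(6) and the consequences of the derivation identity.
    Then DI lies in DC, and the dimension of the quotient of the identities by
    the consequences is the difference of their ranks.

    Both are stable under S_7. The symmetrizer of a Young subgroup with a choice
    of signs acts on a stable space as a multiple of a projector, so the rank of
    its image is an average of values of the character (trace_formula). Thirteen
    such averages combine to the value at the identity (rank_from_table), hence
    the ranks of DI and DC follow from those of their images under thirteen
    symmetrizers. For each of these the difference is found exactly (cert_rank).
    From above, functionals killing the consequences are determined by few
    coordinates, by their symmetry and the instances of the derivation identity
    in degree 7. From below, evaluations in V(6) are members of DI. The gap is
    filled by explicit new identities, which evaluations in V(10) show to be
    independent modulo consequences: the same construction on V(10) is again an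
    algebra satisfying the derivation identity, since in both cases x, y act by
    the element beta(x, y) of sl(2) and beta is equivariant.

    That an explicit symmetrized polynomial is an identity of V(6) needs few
    substitutions. Its value is equivariant under sl(2) and multilinear, so by
    lowering and raising operators it vanishes if it does when the first
    variable is the highest weight vector and the value has the highest weight
    (ident_of_points); by symmetry the other weights may be sorted in each block.

    The polynomial with 141 terms is congruent, modulo consequences, to an
    antisymmetrization in a, b, c, d, e of two monomials (p_cong). Therefore it is
    an identity, its translates are up to sign the 42 translates by cosets of the
    symmetric group of these five variables (coset_sort), and evaluations in
    V(10) show that the 42 classes are independent (images_independent). In
    particular it is not a consequence.

    All ranks of integer matrices are bounded by elimination modulo 101. *)


(** * Ranks by elimination modulo 101 *)

Definition modp (x : Z) : Z := Z.modulo x 101.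

Section LA.
(** A subspace of row vectors given by a predicate, such as the identities that
    hold in all algebras of a variety, is the row space of some matrix: a matrix
    of maximal rank inside the subspace exhausts it. *)
Lemma subspace_mx (K : fieldType) N (P : 'rV[K]_N -> Prop) :
  P 0 -> (forall a u v, P u -> P v -> P (a *: u + v)) ->
  exists A : 'M[K]_N, forall v, P v <-> (v <= A)%MS.
Proof.
move=> P0 Plin.
pose Q r := `[< exists2 A : 'M[K]_N, (forall v : 'rV_N, (v <= A)%MS -> P v) & \rank A = r >].
have exQ : exists r, Q r.
  exists 0%N; apply/asboolP; exists 0; last by rewrite mxrank0.
  by move=> v; rewrite submx0 => /eqP->.
have Qle r : Q r -> (r <= N)%N by move/asboolP=> [A _ <-]; apply: rank_leq_row.
case: (ex_maxnP exQ Qle) => r /asboolP[A PA rA] maxr.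
exists A => v; split=> [Pv|]; last exact: PA.
case: (boolP (v <= A)%MS) => // /negP nvA; exfalso.
pose B := (A + v)%MS.
have rB : (r < \rank B)%N.
  rewrite -rA ltnNge; apply/negP => rBA; apply: nvA.
  have /eqmxP/eqmx_sym e : (A == B)%MS by rewrite -(geq_leqif (mxrank_leqif_eq (addsmxSl A v))).
  by rewrite -e addsmxSr.
have /maxr : Q (\rank B).
  apply/asboolP; exists (B : 'M_N) => // u /sub_addsmxP[[x y] ->] /=.
  have /sub_rVP[a ->] : (y *m v <= v)%MS by apply: submxMl.
  by rewrite addrC; apply: Plin => //; apply: PA; apply: submxMl.
by move/leq_trans/(_ (leqnn _)); rewrite leqNgt rB.
Qed.

Lemma col_injective_rank (F : fieldType) m n (M : 'M[F]_(m, n)) :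
  (forall x : 'cV[F]_n, M *m x = 0 -> x = 0) -> \rank M = n.
Proof.
move=> injM; rewrite -mxrank_tr; apply/eqP; rewrite -[_ == _]/(row_free _) -kermx_eq0.
apply/eqP/row_matrixP => i; rewrite row0; apply: trmx_inj; rewrite trmx0.
apply: injM; apply: trmx_inj; rewrite trmx_mul trmxK trmx0.
by apply/sub_kermxP; apply: row_sub.
Qed.

(** A minor that is nonzero in the field F is the image of a nonzero integer, so
    full column rank in F implies full column rank in characteristic 0. *)
Lemma rank_mod (F : fieldType) (K : numFieldType) m n (M : 'M[Z]_(m, n))
   (f : {rmorphism Z -> F}) (g : {rmorphism Z -> K}) :
  injective g ->
  (forall x : 'cV[F]_n, map_mx f M *m x = 0 -> x = 0) ->
  \rank (map_mx g M) = n.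
Proof.
move=> injg /col_injective_rank rM.
have rf : row_full (map_mx f M) by rewrite /row_full rM.
pose h := fullrankfun rf.
have : rowsub h (map_mx f M) \in unitmx by rewrite -row_full_unit fullrowsub_full.
rewrite -map_mxsub unitmxE det_map_mx unitfE => nz.
have : rowsub h (map_mx g M) \in unitmx.
  rewrite -map_mxsub unitmxE det_map_mx unitfE; apply: contra nz => /eqP e.
  have -> : \det (rowsub h M) = 0 by apply: injg; rewrite e rmorph0.
  by rewrite rmorph0.
rewrite -row_full_unit => /eqP r1; apply/eqP; rewrite eqn_leq rank_leq_col /=.
by rewrite -{1}r1; apply/mxrankS/rowsub_sub.
Qed.
End LA.

(** Certificates are computed in the binary integers Z; this is the unique ring
    morphism to the field where they are used. *)
Definition zR (R : nzRingType) (z : Z) : R := (int_of_Z z)%:~R.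
Section ZR.
Variable R : nzRingType.
Lemma zR_is_additive : zmod_morphism (@zR R).
Proof. by move=> x y; rewrite /zR !rmorphB. Qed.
HB.instance Definition _ := GRing.isZmodMorphism.Build Z R (@zR R) zR_is_additive.
Lemma zR_is_multiplicative : monoid_morphism (@zR R).
Proof. by split=> [|x y]; rewrite /zR ?rmorphM ?rmorph1. Qed.
HB.instance Definition _ := GRing.isMonoidMorphism.Build Z R (@zR R) zR_is_multiplicative.
End ZR.

Lemma zR_inj (K : numFieldType) : injective (@zR K).
Proof. by move=> x y /eqP; rewrite /zR eqr_int => /eqP /(can_inj int_of_ZK). Qed.

Notation F101 := 'F_101.

Lemma zR_modp z : zR F101 (modp z) = zR F101 z.
Proof.
rewrite {2}(Z.div_mod z 101) // [LHS]/=.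
have e : zR F101 101%ZZ = 0 by apply/val_inj.
rewrite -[Z.add _ _]/((101%ZZ * Z.div z 101 : Z) + modp z) rmorphD rmorphM /= e.
by rewrite mul0r add0r.
Qed.

Fixpoint powz (x : Z) (n : nat) : Z :=
  if n is n'.+1 then modp (Z.mul x (powz x n')) else 1%ZZ.
(* Fermat: x ^ 99 is the inverse of x modulo 101. *)
Definition zinv (x : Z) : Z := powz x 99.

Fixpoint pick_row (rows pre : seq (seq Z)) : option (Z * seq Z * seq (seq Z)) :=
  if rows is r :: rows' then
    if r is h :: t then
      if Z.eqb h 0 then pick_row rows' (r :: pre) else Some (h, t, catrev pre rows')
    else None
  else None.

Definition reduce (pt : seq Z) (r : seq Z) : seq Z :=
  if r is h :: t then
    if Z.eqb h 0 then t
    else map (fun ab : Z * Z => let: (a, b) := ab in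
                if Z.eqb b 0 then a else modp (Z.sub a (Z.mul h b))) (zip t pt)
  else [::].

Fixpoint elim (n : nat) (rows : seq (seq Z)) : bool :=
  if n is n'.+1 then
    if pick_row rows [::] is Some (h, t, others) then
      let i := zinv h in
      if Z.eqb (modp (Z.mul i h)) 1 then
        let pt := map (fun b => if Z.eqb b 0 then 0%ZZ else modp (Z.mul i b)) t in
        elim n' (map (reduce pt) others)
      else false
    else false
  else true.

Section Elim.
Local Notation zF := (zR F101).
Fixpoint dot (r : seq Z) (x : seq F101) : F101 :=
  match r, x with a :: r', y :: x' => zF a * y + dot r' x' | _, _ => 0 end.

Lemma pick_rowP (P : seq Z -> Prop) rows pre h t others :
  pick_row rows pre = Some (h, t, others) ->
  {in rows, forall r, P r} -> {in pre, forall r, P r} ->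
  P (h :: t) /\ {in others, forall r, P r}.
Proof.
elim: rows pre => [|[|h' t'] rows IH] pre //=.
case: ifP => _ => [/IH{}IH Pr Ppre|[<- <- <-] Pr Ppre].
  apply: IH => r rin; first by apply: Pr; rewrite inE rin orbT.
  by move: rin; rewrite inE => /predU1P[->|/Ppre//]; apply: Pr; rewrite mem_head.
split; first by apply: Pr; rewrite mem_head.
move=> r; rewrite catrevE mem_cat mem_rev => /orP[/Ppre//|rin].
by apply: Pr; rewrite inE rin orbT.
Qed.

Lemma dot_scale i t x :
  dot (map (fun b => if Z.eqb b 0 then 0%ZZ else modp (Z.mul i b)) t) x = zF i * dot t x.
Proof.
elim: t x => [|b t IH] [|y x] /=; rewrite ?mulr0 // IH mulrDr mulrA; congr (_ + _).
case: Z.eqb_spec => [->|_]; first by rewrite rmorph0 mulr0 !mul0r.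
by rewrite zR_modp -[Z.mul i b]/(i * b) rmorphM.
Qed.

Lemma dot_comb h t pt x : size t = size pt ->
  dot (map (fun ab : Z * Z => let: (a, b) := ab in
     if Z.eqb b 0 then a else modp (Z.sub a (Z.mul h b))) (zip t pt)) x
  = dot t x - zF h * dot pt x.
Proof.
elim: t pt x => [|a t IH] [|b pt] [|y x] //=; rewrite ?mulr0 ?subr0 // => -[/IH{}IH].
rewrite IH mulrDr opprD addrACA; congr (_ + _).
case: Z.eqb_spec => [->|_]; first by rewrite rmorph0 mul0r mulr0 subr0.
rewrite zR_modp -[Z.sub _ _]/(a - h * b) rmorphB rmorphM.
by rewrite mulrBl mulrA.
Qed.

(** Gaussian elimination only replaces rows by linear combinations of rows. *)
Lemma elimP n rows x : elim n rows -> size x = n ->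
  {in rows, forall r, size r = n /\ dot r x = 0} -> x = nseq n 0.
Proof.
elim: n rows x => [|n IH] rows x /=; first by move=> _ /size0nil.
case e: (pick_row rows [::]) => [[[h t] others]|] //.
case: Z.eqb_spec => // ih1 el.
case: x => [|y x] // [sx] Hr.
have [|//|[[st] eqp Ho]] := @pick_rowP (fun r => size r = n.+1 /\ dot r (y :: x) = 0) _ _ _ _ _ e.
  exact: Hr.
have ey : y + zF (zinv h) * dot t x = 0.
  have := congr1 (fun z => zF (zinv h) * z) eqp; rewrite /= mulr0 mulrDr mulrA.
  suff -> : zF (zinv h) * zF h = 1 by rewrite mul1r.
  rewrite -(rmorph1 (zR F101)) -[1 in RHS]ih1 [in RHS]/= zR_modp.
  exact: (esym (rmorphM _ _ _)).
have x0 : x = nseq n 0.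
  apply: IH el sx _ => _ /mapP[[|a r] /Ho[//= [sr] er] ->] /=.
  case: Z.eqb_spec => [a0|_]; first by split=> //; move: er; rewrite a0 rmorph0 mul0r add0r.
  rewrite size_map size_zip size_map sr st minnn; split=> //.
  rewrite dot_comb ?size_map ?sr ?st // dot_scale.
  move/eqP: ey; rewrite addr_eq0 => /eqP ey.
  by rewrite -[zF (zinv h) * _]opprK -ey mulrN opprK addrC.
suff dot0 m : dot t (nseq m 0) = 0 by move: ey; rewrite x0 dot0 mulr0 addr0 => ->.
by elim: (t) m => [|a t' IHt] [|m] //=; rewrite mulr0 add0r IHt.
Qed.

Lemma dot_sum r (x : seq F101) n : size r = n -> size x = n ->
  dot r x = \sum_(i < n) zF (nth 0%ZZ r i) * nth 0 x i.
Proof.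
elim: r x n => [|a r IH] [|y x] [|n] //= => [_ _|[sr] [sx]]; first by rewrite big_ord0.
by rewrite big_ord_recl (IH _ n).
Qed.

(** The rank over K of the integer matrix whose rows are listed, as soon as
    the elimination modulo 101 finds a pivot in each of its n columns. *)
Lemma elim_rank (K : numFieldType) n (rows : seq (seq Z)) :
  elim n (map (map modp) rows) -> all (fun r => size r == n) rows ->
  \rank (\matrix_(i < size rows, j < n) zR K (nth 0%ZZ (nth [::] rows i) j)) = n.
Proof.
move=> el /allP sz.
pose M : 'M[Z]_(_, _) := \matrix_(i < size rows, j < n) (nth 0%ZZ (nth [::] rows i) j).
have -> : \matrix_(i < size rows, j < n) zR K (nth 0%ZZ (nth [::] rows i) j) = map_mx (zR K) M.
  by apply/matrixP => i j; rewrite !mxE.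
apply: (@rank_mod 'F_101 K _ _ M (zR F101)); first exact: zR_inj.
move=> x Mx0; pose xs := [seq x i 0 | i <- enum 'I_n].
have sxs : size xs = n by rewrite size_map size_enum_ord.
have xsE (i : 'I_n) : nth 0 xs i = x i 0.
  by rewrite (nth_map i) ?size_enum_ord // nth_ord_enum.
have : xs = nseq n 0.
  apply: (elimP el sxs) => _ /mapP[r rin ->]; have /eqP sr := sz _ rin.
  rewrite size_map sr; split=> //.
  have lt : (index r rows < size rows)%N by rewrite index_mem.
  have := congr1 (fun A : 'cV_ _ => A (Ordinal lt) 0) Mx0; rewrite !mxE => e0.
  have smr : size (map modp r) = n by rewrite size_map.
  rewrite (dot_sum smr sxs) -[RHS]e0; apply: eq_bigr => j _.
  by rewrite !mxE /= nth_index // xsE (nth_map 0%ZZ) ?sr // zR_modp.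
move=> e; apply/colP => i; rewrite mxE -xsE e nth_nseq; case: ifP => //.
Qed.
End Elim.

(** * Ternary derivation algebras on modules of sl(2) *)

(** The tables of an equivariant map beta from the exterior square of V(mn) to
    sl(2): tE, tH and tF list the coefficients of beta(v_i, v_j) on E, H and F
    as functions of i, the other index being forced by the weight. *)
Record model := Model { mn : nat; tE : seq Z; tH : seq Z; tF : seq Z }.

Definition bE (m : model) (i j : nat) : Z := if Nat.eqb (Nat.add i j).+1 (mn m) then nth 0%ZZ (tE m) i else 0%ZZ.
Definition bH (m : model) (i j : nat) : Z := if Nat.eqb (Nat.add i j) (mn m) then nth 0%ZZ (tH m) i else 0%ZZ.
Definition bF (m : model) (i j : nat) : Z := if Nat.eqb (Nat.add i j) (mn m).+1 then nth 0%ZZ (tF m) i else 0%ZZ.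

(* cE, cF and cH give the action on the basis: v_i is sent to a multiple of
   v_(i-1), v_(i+1) and v_i. *)
Definition cE (m : model) (i : nat) : Z := if i is i'.+1 then Z.sub (Z.of_nat (mn m)) (Z.of_nat i') else 0%ZZ.
Definition cF (m : model) (i : nat) : Z := if Nat.eqb i (mn m) then 0%ZZ else Z.of_nat i.+1.
Definition cH (m : model) (i : nat) : Z := Z.sub (Z.of_nat (mn m)) (Z.of_nat (Nat.add i i)).

Definition der (c : nat -> Z) (s : nat -> nat) (b : nat -> nat -> Z) (i j : nat) : Z :=
  Z.add (Z.mul (c i) (b (s i) j)) (Z.mul (c j) (b i (s j))).

(** Equivariance of beta under E, F and H, on pairs of basis vectors. *)
Definition model_ok (m : model) : bool :=
  all (fun i => all (fun j =>
    [&& Z.eqb (bE m i j) (Z.opp (bE m j i)), Z.eqb (bH m i j) (Z.opp (bH m j i)),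
        Z.eqb (bF m i j) (Z.opp (bF m j i)),
        Z.eqb (der (cE m) predn (bE m) i j) (Z.mul (-2) (bH m i j)),
        Z.eqb (der (cE m) predn (bH m) i j) (bF m i j),
        Z.eqb (der (cE m) predn (bF m) i j) 0,
        Z.eqb (der (cF m) S (bE m) i j) 0,
        Z.eqb (der (cF m) S (bH m) i j) (Z.opp (bE m i j)),
        Z.eqb (der (cF m) S (bF m) i j) (Z.mul 2 (bH m i j)),
        Z.eqb (der (cH m) id (bE m) i j) (Z.mul 2 (bE m i j)),
        Z.eqb (der (cH m) id (bH m) i j) 0 &
        Z.eqb (der (cH m) id (bF m) i j) (Z.mul (-2) (bF m i j))])
    (iota 0 (mn m).+1)) (iota 0 (mn m).+1).

(** The module V(6) of the statement. *)
Definition v6 := Model 6 [:: -2; 10; -20; 20; -10; 2; 0]%ZZ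
  [:: 1; -4; 5; 0; -5; 4; -1]%ZZ [:: 0; 2; -10; 20; -20; 10; -2]%ZZ.
(** The same construction on V(10). In degree 7 its evaluations separate enough
    polynomials to show that given identities of V(6) are not consequences of
    the ternary derivation identity. *)
Definition v10 := Model 10
  [:: -2; 18; -72; 168; -252; 252; -168; 72; -18; 2; 0]%ZZ
  [:: 1; -8; 27; -48; 42; 0; -42; 48; -27; 8; -1]%ZZ
  [:: 0; 2; -18; 72; -168; 252; -252; 168; -72; 18; -2]%ZZ.

Lemma v6_ok : model_ok v6. Proof. by vm_compute. Qed.
Lemma v10_ok : model_ok v10. Proof. by vm_compute. Qed.

Lemma zR_nat (R : nzRingType) k : zR R (Z.of_nat k) = k%:R.
Proof.
rewrite /zR; suff -> : int_of_Z (Z.of_nat k) = k%:Z by rewrite -pmulrn.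
by case: k => //= k; rewrite SuccNat2Pos.id_succ.
Qed.

Section Model.
Variables (K : numFieldType) (m : model).
Local Notation n := (mn m).
Local Notation z := (zR K).

Definition bv (i : nat) : 'rV[K]_n.+1 := \row_k ((k : nat) == i)%:R.
Definition mxB (b : nat -> nat -> Z) : 'M[K]_n.+1 := \matrix_(i, j) z (b i j).
Definition mxT (c : nat -> Z) (s : nat -> nat) : 'M[K]_n.+1 :=
  \matrix_(i, j) (z (c i) *+ ((j : nat) == s i)).
Definition mE := mxT (cE m) predn.
Definition mF := mxT (cF m) S.
Definition mH := mxT (cH m) id.

Definition form (B : 'M[K]_n.+1) (x y : 'rV[K]_n.+1) : K := (x *m B *m y^T) 0 0.
Definition Dmx (x y : 'rV[K]_n.+1) : 'M[K]_n.+1 :=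
  form (mxB (bH m)) x y *: mH + form (mxB (bE m)) x y *: mE + form (mxB (bF m)) x y *: mF.
Definition gop (x y w : 'rV[K]_n.+1) := w *m Dmx x y.

Lemma form_linl B y a u v : form B (a *: u + v) y = a * form B u y + form B v y.
Proof. by rewrite /form !mulmxDl -!scalemxAl !mxE. Qed.
Lemma form_linr B x a u v : form B x (a *: u + v) = a * form B x u + form B x v.
Proof. by rewrite /form linearP /= !mulmxDr -!scalemxAr !mxE. Qed.

Lemma Dmx_linl y a u v : Dmx (a *: u + v) y = a *: Dmx u y + Dmx v y.
Proof.
rewrite /Dmx !form_linl !scalerDl -!scalerA !scalerDr.
by rewrite [X in X + _ = _]addrACA [LHS]addrACA.
Qed.
Lemma Dmx_linr x a u v : Dmx x (a *: u + v) = a *: Dmx x u + Dmx x v.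
Proof.
rewrite /Dmx !form_linr !scalerDl -!scalerA !scalerDr.
by rewrite [X in X + _ = _]addrACA [LHS]addrACA.
Qed.

Lemma gop_trilinear : trilinear gop.
Proof.
split=> [y w|x w|x y] a u v; rewrite /gop.
- by rewrite Dmx_linl mulmxDr scalemxAr.
- by rewrite Dmx_linr mulmxDr scalemxAr.
- by rewrite mulmxDl -scalemxAl.
Qed.

Hypothesis mok : model_ok m.

Lemma okP i j : (i <= n)%N -> (j <= n)%N ->
  [/\ [/\ bE m i j = Z.opp (bE m j i), bH m i j = Z.opp (bH m j i) & bF m i j = Z.opp (bF m j i)],
   [/\ der (cE m) predn (bE m) i j = Z.mul (-2) (bH m i j), der (cE m) predn (bH m) i j = bF m i j
     & der (cE m) predn (bF m) i j = 0%ZZ],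
   [/\ der (cF m) S (bE m) i j = 0%ZZ, der (cF m) S (bH m) i j = Z.opp (bE m i j)
     & der (cF m) S (bF m) i j = Z.mul 2 (bH m i j)] &
   [/\ der (cH m) id (bE m) i j = Z.mul 2 (bE m i j), der (cH m) id (bH m) i j = 0%ZZ
     & der (cH m) id (bF m) i j = Z.mul (-2) (bF m i j)]].
Proof.
move=> lei lej; move/allP: mok => /(_ i); rewrite mem_iota ltnS => /(_ lei) /allP /(_ j).
rewrite mem_iota ltnS => /(_ lej) /and5P[/Z.eqb_spec h1 /Z.eqb_spec h2 /Z.eqb_spec h3 /Z.eqb_spec h4].
move=> /and5P[/Z.eqb_spec h5 /Z.eqb_spec h6 /Z.eqb_spec h7 /Z.eqb_spec h8].
by move=> /and4P[/Z.eqb_spec h9 /Z.eqb_spec h10 /Z.eqb_spec h11 /Z.eqb_spec h12].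
Qed.

Definition inrange (c : nat -> Z) (s : nat -> nat) :=
  forall i, (i <= n)%N -> (s i <= n)%N \/ c i = 0%ZZ.

Lemma sum_pick c s (G : nat -> K) (i : nat) : (s i <= n)%N \/ c i = 0%ZZ ->
  \sum_(k < n.+1) (z (c i) *+ ((k : nat) == s i)) * G k = z (c i) * G (s i).
Proof.
case: (leqP (s i) n) => [le _|lt [|->]]; last 1 first.
- by rewrite rmorph0 mul0r big1 // => k _; rewrite mul0rn mul0r.
- rewrite (bigD1 (Ordinal (le : (s i < n.+1)%N))) //= eqxx big1 ?addr0 // => k nk.
  by case: eqP => [e|]; rewrite ?mul0r //; case/eqP: nk; apply: val_inj.
by [].

Qed.

Lemma mxT_der c s b : inrange c s ->
  mxT c s *m mxB b + mxB b *m (mxT c s)^T = \matrix_(i, j) z (der c s b i j).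
Proof.
move=> cs; apply/matrixP => i j; rewrite !mxE.
rewrite -[X in z X]/(c i * b (s i) j + c j * b i (s j)) rmorphD !rmorphM; congr (_ + _).
  rewrite -(@sum_pick c s (fun k => z (b k j)) i); last by apply: cs; exact: leq_ord.
  by apply: eq_bigr => k _; rewrite !mxE.
rewrite -(@sum_pick c s (fun k => z (b i k)) j); last by apply: cs; exact: leq_ord.
by apply: eq_bigr => k _; rewrite !mxE mulrC.
Qed.

Lemma mxT_comp c s d t : inrange c s ->
  mxT c s *m mxT d t = \matrix_(i, j) (z (c i * d (s i)) *+ ((j : nat) == t (s i))).
Proof.
move=> cs; apply/matrixP => i j; rewrite !mxE rmorphM -mulrnAr.
rewrite -(@sum_pick c s (fun k => z (d k) *+ ((j : nat) == t k)) i); last by apply: cs; exact: leq_ord.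
by apply: eq_bigr => k _; rewrite !mxE.
Qed.

Lemma inE_ : inrange (cE m) predn.
Proof. by move=> i le; left; apply: leq_trans le; apply: leq_pred. Qed.
Lemma inF_ : inrange (cF m) S.
Proof.
move=> i; rewrite leq_eqVlt => /predU1P[->|]; last by left.
by right; rewrite /cF Nat.eqb_refl.
Qed.
Lemma inH_ : inrange (cH m) id. Proof. by left. Qed.

Lemma der_form c s b x y : inrange c s ->
  form (mxB b) (x *m mxT c s) y + form (mxB b) x (y *m mxT c s) =
  form (\matrix_(i, j) z (der c s b i j)) x y.
Proof.
move=> cs; rewrite -mxT_der // /form trmx_mul mulmxDr mulmxDl !mulmxA.
by rewrite [RHS]mxE.
Qed.

Lemma formZ a B x y : form (a *: B) x y = a * form B x y.
Proof. by rewrite /form -scalemxAr -scalemxAl mxE. Qed.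

Lemma tableZ (f : nat -> nat -> Z) (g : nat -> nat -> Z) (a : Z) :
  (forall i j, (i <= n)%N -> (j <= n)%N -> f i j = Z.mul a (g i j)) ->
  \matrix_(i < n.+1, j < n.+1) z (f i j) = z a *: mxB g.
Proof.
move=> fg; apply/matrixP => i j; rewrite !mxE fg ?leq_ord //.
by rewrite -[Z.mul _ _]/(a * g i j) rmorphM.
Qed.

Lemma table_form (f g : nat -> nat -> Z) (a : Z) x y :
  (forall i j, (i <= n)%N -> (j <= n)%N -> f i j = Z.mul a (g i j)) ->
  form (\matrix_(i < n.+1, j < n.+1) z (f i j)) x y = z a * form (mxB g) x y.
Proof. by move/tableZ->; rewrite formZ. Qed.

Lemma skew_form b x y :
  (forall i j, (i <= n)%N -> (j <= n)%N -> b i j = Z.opp (b j i)) ->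
  form (mxB b) x y = - form (mxB b) y x.
Proof.
move=> sk; have e : mxB b = - (mxB b)^T.
  by apply/matrixP => i j; rewrite !mxE sk ?leq_ord // -[Z.opp _]/(- b j i) rmorphN.
rewrite /form {1}e mulmxN mulNmx mxE; congr (- _).
have -> : x *m (mxB b)^T *m y^T = (y *m mxB b *m x^T)^T by rewrite !trmx_mul trmxK mulmxA.
by rewrite mxE.
Qed.

Lemma comm_mx (c d : nat -> Z) (s t : nat -> nat) (M : 'M[K]_n.+1) : inrange c s -> inrange d t ->
  (forall i j : 'I_n.+1, z (c i * d (s i)) *+ ((j : nat) == t (s i)) - z (d i * c (t i)) *+ ((j : nat) == s (t i)) = M i j) ->
  mxT c s *m mxT d t - mxT d t *m mxT c s = M.
Proof. by move=> cs dt e; rewrite !mxT_comp //; apply/matrixP => i j; rewrite !mxE e. Qed.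

Lemma cES k : cE m k.+1 = Z.sub (Z.of_nat n) (Z.of_nat k). Proof. by []. Qed.

Lemma FE_Z i : (i <= n)%N ->
  Z.sub (Z.mul (cF m i) (cE m i.+1)) (Z.mul (cE m i) (cF m i.-1)) = cH m i.
Proof.
case: i => [|k] le; rewrite ?cES ?succnK /cH /cF.
  by case: Nat.eqb_spec => e; rewrite [cE m 0]/= -?e; lia.
by case: Nat.eqb_spec => ?; case: Nat.eqb_spec => ?; lia.
Qed.
Lemma HE_Z i : Z.sub (Z.mul (cE m i) (cH m i.-1)) (Z.mul (cH m i) (cE m i)) = Z.mul 2 (cE m i).
Proof. by case: i => [|k]; rewrite ?cES ?succnK /cH; rewrite ?[cE m 0]/=; lia. Qed.
Lemma HF_Z i : Z.sub (Z.mul (cF m i) (cH m i.+1)) (Z.mul (cH m i) (cF m i)) = Z.mul (-2) (cF m i).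
Proof. by rewrite /cH /cF; case: Nat.eqb_spec => ?; lia. Qed.

Lemma FE : mF *m mE - mE *m mF = mH.
Proof.
apply: comm_mx; [exact: inF_|exact: inE_|move=> i j].
rewrite mxE /=.
have -> : z (cE m i * cF m i.-1) *+ (nat_of_ord j == i.-1.+1) = z (cE m i * cF m i.-1) *+ (nat_of_ord j == i).
  by case: (nat_of_ord i) => [|k] //; rewrite /cE !(mul0r, rmorph0) !mul0rn.
rewrite -mulrnBl -rmorphB; congr (z _ *+ _).
exact/FE_Z/leq_ord.
Qed.

Lemma HE : mE *m mH - mH *m mE = 2%:R *: mE.
Proof.
apply: comm_mx; [exact: inE_|exact: inH_|move=> i j].
rewrite [RHS]mxE [X in _ = _ * X]mxE mulrnAr -mulrnBl -rmorphB -(rmorph_nat z) -rmorphM.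
congr (z _ *+ _).
exact: HE_Z.
Qed.

Lemma HF : mF *m mH - mH *m mF = - 2%:R *: mF.
Proof.
apply: comm_mx; [exact: inF_|exact: inH_|move=> i j].
rewrite [RHS]mxE [X in _ = _ * X]mxE mulrnAr -mulrnBl -rmorphB -(rmorph_nat z) -rmorphN -rmorphM.
congr (z _ *+ _).
exact: HF_Z.
Qed.

Definition der_at (X : 'M[K]_n.+1) :=
  forall x y, Dmx (x *m X) y + Dmx x (y *m X) = Dmx x y *m X - X *m Dmx x y.

Lemma der_table c s b b' a x y : inrange c s ->
  (forall i j, (i <= n)%N -> (j <= n)%N -> der c s b i j = Z.mul a (b' i j)) ->
  form (mxB b) (x *m mxT c s) y + form (mxB b) x (y *m mxT c s) = z a * form (mxB b') x y.
Proof. by move=> cs e; rewrite der_form //; apply: table_form. Qed.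

Lemma Dmx_der c s x y : Dmx (x *m mxT c s) y + Dmx x (y *m mxT c s) =
  (form (mxB (bH m)) (x *m mxT c s) y + form (mxB (bH m)) x (y *m mxT c s)) *: mH
  + (form (mxB (bE m)) (x *m mxT c s) y + form (mxB (bE m)) x (y *m mxT c s)) *: mE
  + (form (mxB (bF m)) (x *m mxT c s) y + form (mxB (bF m)) x (y *m mxT c s)) *: mF.
Proof. by rewrite /Dmx !scalerDl [X in _ = X + _]addrACA [RHS]addrACA. Qed.

Lemma Dmx_comm X x y : Dmx x y *m X - X *m Dmx x y =
  form (mxB (bH m)) x y *: (mH *m X - X *m mH) + form (mxB (bE m)) x y *: (mE *m X - X *m mE)
  + form (mxB (bF m)) x y *: (mF *m X - X *m mF).
Proof.
rewrite /Dmx !mulmxDl !mulmxDr -!scalemxAl -!scalemxAr !scalerBr !opprD.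
by rewrite [X in X = _]addrACA [X in X + _ = _]addrACA.
Qed.

Lemma der_E : der_at mE.
Proof.
move=> x y; rewrite Dmx_der Dmx_comm subrr scaler0 addr0 FE.
rewrite (@der_table _ _ _ (bF m) 1%ZZ) //; last 2 first.
- exact: inE_.
- by move=> i j li lj; case: (okP li lj) => _ [_ -> _] _ _; lia.
rewrite (@der_table _ _ _ (bH m) (-2)%ZZ) //; last 2 first.
- exact: inE_.
- by move=> i j li lj; case: (okP li lj) => _ [-> _ _] _ _.
rewrite (@der_table _ _ _ (bF m) 0%ZZ) //; last 2 first.
- exact: inE_.
- by move=> i j li lj; case: (okP li lj) => _ [_ _ ->] _ _.
rewrite rmorph1 rmorph0 mul1r mul0r scale0r addr0 -(opprB (_ *m _)) HE scalerN scalerA.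
rewrite addrC; congr (_ + _); rewrite -scaleNr; congr (_ *: _).
by rewrite mulrC -mulrN mulrC.
Qed.

Lemma der_F : der_at mF.
Proof.
move=> x y; rewrite Dmx_der Dmx_comm subrr scaler0 addr0.
rewrite (@der_table _ _ _ (bE m) (-1)%ZZ) //; last 2 first.
- exact: inF_.
- by move=> i j li lj; case: (okP li lj) => _ _ [_ -> _] _; lia.
rewrite (@der_table _ _ _ (bE m) 0%ZZ) //; last 2 first.
- exact: inF_.
- by move=> i j li lj; case: (okP li lj) => _ _ [-> _ _] _.
rewrite (@der_table _ _ _ (bH m) 2%ZZ) //; last 2 first.
- exact: inF_.
- by move=> i j li lj; case: (okP li lj) => _ _ [_ _ ->] _.
rewrite rmorph0 mul0r scale0r addr0 -(opprB (_ *m mH)) HF -(opprB (_ *m mE)) FE.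
rewrite addrC; congr (_ + _); rewrite scalerN ?scalerA -?scaleNr; congr (_ *: _).
  by rewrite mulrN opprK mulrC.
by rewrite -[zR K _]/(-1 : K) mulN1r.
Qed.

Lemma der_H : der_at mH.
Proof.
move=> x y; rewrite Dmx_der Dmx_comm subrr scaler0 add0r HE HF.
rewrite (@der_table _ _ _ (bH m) 0%ZZ) //; last 2 first.
- exact: inH_.
- by move=> i j li lj; case: (okP li lj) => _ _ _ [_ -> _].
rewrite (@der_table _ _ _ (bE m) 2%ZZ) //; last 2 first.
- exact: inH_.
- by move=> i j li lj; case: (okP li lj) => _ _ _ [-> _ _].
rewrite (@der_table _ _ _ (bF m) (-2)%ZZ) //; last 2 first.
- exact: inH_.
- by move=> i j li lj; case: (okP li lj) => _ _ _ [_ _ ->].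
rewrite mul0r scale0r add0r !scalerA; congr (_ *: _ + _ *: _); by rewrite mulrC.
Qed.

Lemma der_lin a X Y : der_at X -> der_at Y -> der_at (a *: X + Y).
Proof.
move=> dX dY x y; move: (dX x y) (dY x y); set D := Dmx x y => eX eY.
rewrite (mulmxDr x) (mulmxDr y) -!scalemxAr Dmx_linl Dmx_linr addrACA eY -scalerDr eX.
by rewrite (mulmxDl (a *: X)) (mulmxDr D) -scalemxAl -scalemxAr scalerBr opprD addrACA.
Qed.

Lemma der_D x y : der_at (Dmx x y).
Proof.
rewrite /Dmx -addrA; apply: der_lin (der_H) _; apply: der_lin (der_E) _.
rewrite -[_ *: mF]addr0; apply: der_lin (der_F) _ => u v.
rewrite !mulmx0 mul0mx subr0 /Dmx /form !(mulmx0, mul0mx, trmx0) mxE !scale0r !addr0 //.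
Qed.

Lemma gop_skew : skew_symmetric gop.
Proof.
move=> x y w; rewrite /gop -mulmxDr /Dmx.
rewrite (@skew_form (bH m) x y) 1?(@skew_form (bE m) x y) 1?(@skew_form (bF m) x y); first last.
- by move=> i j li lj; case: (okP li lj) => [[_ ? _] _ _ _].
- by move=> i j li lj; case: (okP li lj) => [[? _ _] _ _ _].
- by move=> i j li lj; case: (okP li lj) => [[_ _ ?] _ _ _].
rewrite !scaleNr addrACA [X in X + _]addrACA !addNr !addr0; exact: mulmx0.
Qed.

(** Since beta is equivariant, every operator Dmx a b commutes with beta and
    with the action of sl(2), which is what the identity says. *)
Lemma gop_derivation : ternary_derivation gop.
Proof.
move=> a b c d e; have := der_D a b c d; rewrite /gop => h.
have sk x y : Dmx x y = - Dmx y x.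
  by apply/row_matrixP => i; rewrite !rowE mulmxN; apply/eqP; rewrite -addr_eq0; apply/eqP; exact: gop_skew.
rewrite (sk (d *m _) c) mulmxN opprK -mulmxDr h mulmxBr !mulmxA.
by rewrite [X in X + _]addrAC subrr sub0r addNr.
Qed.

Lemma gop_equiv X x y w : der_at X ->
  gop x y w *m X = gop (x *m X) y w + gop x (y *m X) w + gop x y (w *m X).
Proof.
by move=> dX; rewrite /gop -mulmxDr dX mulmxBr !mulmxA addrNK.
Qed.

Lemma bv_mxT c s i : (i <= n)%N -> (s i <= n)%N \/ c i = 0%ZZ -> bv i *m mxT c s = z (c i) *: bv (s i).
Proof.
move=> le si; apply/rowP => j; rewrite !mxE (bigD1 (Ordinal (le : (i < n.+1)%N))) //= big1 ?addr0.
  by rewrite !mxE eqxx mul1r mulr_natr.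
by move=> k nk; rewrite mxE; case: eqP => [e|]; rewrite ?mul0r //; case/eqP: nk; apply: val_inj.
Qed.

Lemma form_bv b i j : (i <= n)%N -> (j <= n)%N -> form (mxB b) (bv i) (bv j) = z (b i j).
Proof.
move=> li lj; have bvE k (lk : (k <= n)%N) : bv k = delta_mx 0 (Ordinal (lk : (k < n.+1)%N)).
  by apply/rowP => l; rewrite !mxE eqxx -val_eqE.
by rewrite /form !bvE trmx_delta -mulmxA -colE -rowE !mxE.
Qed.
End Model.

(** Products of multiples of basis vectors are multiples of basis vectors:
    Some (a, i) stands for a v_i and None for 0. *)
Definition zop (m : model) (x y z : option (Z * nat)) : option (Z * nat) :=
  if x is Some (a, i) then if y is Some (b, j) then if z is Some (c, k) then
    let s := Nat.add i j in
    let n := mn m in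
    if Nat.eqb s n then
      Some (Z.mul (Z.mul (Z.mul a b) c)
                  (Z.mul (nth 0%ZZ (tH m) i) (Z.sub (Z.of_nat n) (Z.of_nat (Nat.add k k)))), k)
    else if Nat.eqb s.+1 n then
      if k is k'.+1 then
        Some (Z.mul (Z.mul (Z.mul a b) c)
                    (Z.mul (nth 0%ZZ (tE m) i) (Z.sub (Z.of_nat n) (Z.of_nat k'))), k')
      else None
    else if Nat.eqb s n.+1 then
      if Nat.eqb k n then None else
        Some (Z.mul (Z.mul (Z.mul a b) c) (Z.mul (nth 0%ZZ (tF m) i) (Z.of_nat k.+1)), k.+1)
    else None
  else None else None else None.

Lemma zRM (R : nzRingType) a b : zR R (Z.mul a b) = zR R a * zR R b.
Proof. exact: rmorphM. Qed.

Section Value.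
Local Arguments Nat.eqb : simpl never.
Local Arguments Z.of_nat : simpl never.
Variables (K : numFieldType) (m : model).
Local Notation n := (mn m).

Definition zval (t : option (Z * nat)) : 'rV[K]_n.+1 :=
  if t is Some (a, i) then zR K a *: bv K m i else 0.
Definition zok (t : option (Z * nat)) : bool := if t is Some (_, i) then (i <= n)%N else true.

Lemma zopP x y w : zok x -> zok y -> zok w ->
  zval (zop m x y w) = gop (zval x) (zval y) (zval w) /\ zok (zop m x y w).
Proof.
have [l1 l2 l3] := gop_trilinear K m.
have o0l u v : gop 0 u v = 0 :> 'rV[K]_n.+1.
  by have := l1 u v (-1) 0 0; rewrite scaler0 addr0 scaleN1r addNr.
have o0m u v : gop u 0 v = 0 :> 'rV[K]_n.+1.
  by have := l2 u v (-1) 0 0; rewrite scaler0 addr0 scaleN1r addNr.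
have o0r u v : gop u v 0 = 0 :> 'rV[K]_n.+1 by rewrite /gop mul0mx.
case: x => [[a i]|] /= ok1; last by rewrite o0l.
case: y => [[b j]|] /= ok2; last by rewrite o0m.
case: w => [[c k]|] /= ok3; last by rewrite o0r.
have -> : gop (zR K a *: bv K m i) (zR K b *: bv K m j) (zR K c *: bv K m k) =
  (zR K a * zR K b * zR K c) *: gop (bv K m i) (bv K m j) (bv K m k).
  by rewrite -[zR K a *: _]addr0 l1 -[zR K b *: _]addr0 l2 -[zR K c *: _]addr0 l3
     !o0l !o0m !o0r !addr0 !scalerA.
rewrite /gop /Dmx !form_bv // /bE /bH /bF.
case: Nat.eqb_spec => e1.
  have -> : Nat.eqb (i + j)%coq_nat.+1 n = false by apply/Nat.eqb_neq; lia.
  have -> : Nat.eqb (i + j)%coq_nat n.+1 = false by apply/Nat.eqb_neq; lia.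
  split=> //=; rewrite rmorph0 !scale0r !addr0 -scalemxAr bv_mxT ?scalerA; [|exact: ok3|by left].
  by congr (_ *: _); rewrite /cH; rewrite !zRM !mulrA.
case: Nat.eqb_spec => e2.
  have -> : Nat.eqb (i + j)%coq_nat n.+1 = false by apply/Nat.eqb_neq; lia.
  rewrite rmorph0 !scale0r addr0 add0r -scalemxAr.
  case: k ok3 => [|k] ok3; (rewrite bv_mxT //=; last exact: (inE_ ok3)).
    by rewrite rmorph0 scale0r !scaler0.
  split; last exact: ltnW.
  by rewrite !scalerA; congr (_ *: _); rewrite !zRM !mulrA.
case: Nat.eqb_spec => e3; last by rewrite rmorph0 !scale0r !addr0 mulmx0 scaler0.
rewrite rmorph0 !scale0r !add0r -scalemxAr bv_mxT //=; last exact: inF_.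
rewrite /cF; case: Nat.eqb_spec => e4; first by rewrite rmorph0 scale0r !scaler0.
split; last by rewrite /=; lia.
by rewrite /= !scalerA; congr (_ *: _); rewrite !zRM !mulrA.
Qed.
End Value.

(** The operation of the statement is the instance v6; both sides are sums over
    pairs of coordinates with the same table of coefficients. *)
Lemma V6_gop (K : numFieldType) x y w : V6_op x y w = gop (m := v6) x y w :> 'rV[K]_7.
Proof.
have tri (c B : nat -> nat -> K) : (forall i j : 'I_7, B i j = if (i < j)%N then c i j else if (j < i)%N then - c j i else 0) ->
  \sum_(i < 7) \sum_(j < 7 | (i < j)%N) (x 0 i * y 0 j - x 0 j * y 0 i) * c i j
  = \sum_(i < 7) \sum_(j < 7) x 0 i * y 0 j * B i j.
  move=> BE; under eq_bigr do under eq_bigr do rewrite mulrBl.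
  under eq_bigr do rewrite sumrB; rewrite sumrB.
  rewrite [X in _ - X](exchange_big_dep predT) //= -sumrB; apply: eq_bigr => i _.
  rewrite [RHS](bigID (fun j : 'I_7 => (i < j)%N)) /=; congr (_ + _).
    by apply: eq_bigr => j lt; rewrite BE lt.
  rewrite [RHS](bigID (fun j : 'I_7 => (j < i)%N)) /= [X in _ = _ + X]big1 ?addr0.
    rewrite -sumrN; apply: eq_big => [j|j lt]; first by case: ltngtP.
    by rewrite BE lt ltnNge (ltnW lt) /= mulrN.
  by move=> j; rewrite BE; case: ltngtP; rewrite ?mulr0.
have bsum u v : beta x y u v = \sum_(i < 7) \sum_(j < 7 | (i < j)%N) (x 0 i * y 0 j - x 0 j * y 0 i) * beta_basis K i j u v.
  by rewrite /beta summxE; apply: eq_bigr => i _; rewrite summxE; apply: eq_bigr => j _; rewrite mxE.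
have fsum b : form (mxB K v6 b) x y = \sum_(i < 7) \sum_(j < 7) x 0 i * y 0 j * zR K (b i j).
  rewrite /form mxE; under eq_bigr do rewrite mxE mulr_suml.
  rewrite exchange_big; apply: eq_bigr => i _; apply: eq_bigr => j _.
  by rewrite !mxE mulrAC.
have eH : V6_H K = mH K v6.
  apply/matrixP => i j; rewrite !mxE /cH eq_sym val_eqE -[Z.sub _ _]/(Z.of_nat 6 - Z.of_nat (i + i)%N).
  by rewrite rmorphB /= !zR_nat mul2n addnn.
have eE : V6_E K = mE K v6.
  apply/matrixP => i j; rewrite !mxE; case: (nat_of_ord i) (ltn_ord i) => [|k] lk.
    by rewrite rmorph0 mul0rn.
  rewrite cES eqSS eq_sym; congr (_ *+ _).
  have -> : Z.sub (Z.of_nat (mn v6)) (Z.of_nat k) = Z.of_nat (7 - k.+1)%N by rewrite -[mn v6]/6%N; lia.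
  by rewrite zR_nat.
have eF : V6_F K = mF K v6.
  apply/matrixP => i j; rewrite !mxE /cF; case: Nat.eqb_spec => e.
    by rewrite e rmorph0 mul0rn (negbTE (_ : (j : nat) != 7%N)) // neq_ltn ltn_ord.
  by rewrite zR_nat.
rewrite /V6_op /sl2_act /gop /Dmx !mulmxDr -!scalemxAr !fsum !bsum eH eE eF.
congr (_ *: _ + _ *: _ + _ *: _); apply: (tri (fun i j => beta_basis K i j _ _) (fun i j => zR K (_ i j))) => i j.
- case: i => [[|[|[|[|[|[|[|//]]]]]]] ?]; case: j => [[|[|[|[|[|[|[|//]]]]]]] ?];
  rewrite /bH /= ?rmorph0 ?mxE /= ?(mulr0, mulr1, oppr0, subr0, addr0, mulrN, mulNr, mul1r, opprK) //.
- case: i => [[|[|[|[|[|[|[|//]]]]]]] ?]; case: j => [[|[|[|[|[|[|[|//]]]]]]] ?];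
  rewrite /bE /= ?rmorph0 ?mxE /= ?(mulr0, mulr1, oppr0, subr0, addr0, mulrN, mulNr, mul1r, opprK) //.
- case: i => [[|[|[|[|[|[|[|//]]]]]]] ?]; case: j => [[|[|[|[|[|[|[|//]]]]]]] ?];
  rewrite /bF /= ?rmorph0 ?mxE /= ?(mulr0, mulr1, oppr0, subr0, addr0, mulrN, mulNr, mul1r, opprK) //.
Qed.

(** * Words, permutations and block symmetrizers *)

(* swl exchanges two values of a word, swp two positions. *)
Definition swl (x y z : nat) : nat :=
  if Nat.eqb z x then y else if Nat.eqb z y then x else z.

Definition permw (pt w : seq nat) : seq nat := map (fun i => nth 0%N w i) pt.
Definition swp (x y : nat) (w : seq nat) : seq nat := permw (map (swl x y) (iota 0 7)) w.

(** A permutation of the seven variables is written as the word of its values;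
    pw and word translate between words and 'S_7. *)
Definition okw (w : seq nat) : bool := perm_eq w (iota 0 7).
Definition pw (w : seq nat) : 'S_7 := insubd (1%g : 'S_7) [ffun i : 'I_7 => inord (nth 0%N w i) : 'I_7].
Definition word (s : 'S_7) : seq nat := [seq (s i : nat) | i <- enum 'I_7].

Lemma okw_size w : okw w -> size w = 7.
Proof. by move/perm_size; rewrite size_iota. Qed.
Lemma okw_lt w i : okw w -> (i < 7)%N -> (nth 0%N w i < 7)%N.
Proof.
move=> ok lt; have := mem_nth 0%N (_ : i < size w)%N; rewrite (okw_size ok) => /(_ lt).
by rewrite (perm_mem ok) mem_iota.
Qed.
Lemma okw_uniq w : okw w -> uniq w.
Proof. by move/perm_uniq->; apply: iota_uniq. Qed.

Lemma okwP w : size w = 7 -> uniq w -> {in w, forall x, (x < 7)%N} -> okw w.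
Proof.
move=> sw uw lt; apply: uniq_perm; rewrite ?iota_uniq //.
have [||_ //] := uniq_min_size uw (_ : {subset w <= iota 0 7}).
  by move=> x /lt; rewrite mem_iota.
by rewrite size_iota sw.
Qed.

Lemma pwE w i : okw w -> pw w i = nth 0%N w i :> nat.
Proof.
move=> ok; have inj : injectiveb [ffun i : 'I_7 => inord (nth 0%N w i) : 'I_7].
  apply/injectiveP => a b; rewrite !ffunE => /(congr1 val) /=.
  rewrite !inordK ?okw_lt // => /eqP; rewrite nth_uniq ?(okw_size ok) ?(okw_uniq ok) //.
  by move/eqP/val_inj.
by rewrite /pw -pvalE val_insubd inj ffunE inordK // okw_lt.
Qed.

Lemma okw_word s : okw (word s).
Proof.
apply: okwP.
- by rewrite size_map size_enum_ord.
- by rewrite map_inj_uniq ?enum_uniq // => a b /val_inj/perm_inj.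
- by move=> _ /mapP[i _ ->]; apply: ltn_ord.
Qed.
Lemma nth_word s (i : 'I_7) : nth 0%N (word s) i = s i.
Proof. by rewrite (nth_map i) ?size_enum_ord // nth_ord_enum. Qed.
Lemma pw_word s : pw (word s) = s.
Proof. by apply/permP => i; apply: val_inj; rewrite /= pwE ?okw_word // nth_word. Qed.
Lemma word_pw w : okw w -> word (pw w) = w.
Proof.
move=> ok; apply: (@eq_from_nth _ 0%N); rewrite (okw_size (okw_word _)) ?(okw_size ok) //.
by move=> i lt; rewrite (nth_word _ (Ordinal lt)) pwE.
Qed.

Notation od x := (inord x : 'I_7).

Lemma swlE x y (z : 'I_7) : (x < 7)%N -> (y < 7)%N ->
  swl x y z = tperm (od x) (od y) z.
Proof.
move=> lx ly; rewrite /swl; case: Nat.eqb_spec => [e|n1].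
  by have -> : z = od x by [apply: val_inj; rewrite /= inordK]; rewrite tpermL inordK.
case: Nat.eqb_spec => [e|n2].
  by have -> : z = od y by [apply: val_inj; rewrite /= inordK]; rewrite tpermR inordK.
by rewrite tpermD //; apply/eqP => e; [apply: n1|apply: n2]; rewrite -e inordK.
Qed.

Lemma swl_lt x y z : (x < 7)%N -> (y < 7)%N -> (z < 7)%N -> (swl x y z < 7)%N.
Proof. by rewrite /swl => *; case: ifP => // _; case: ifP. Qed.
Lemma swlK x y : involutive (swl x y).
Proof.
move=> z; rewrite {2}/swl; case: (Nat.eqb_spec z x) => [->|n1].
  by rewrite /swl Nat.eqb_refl; case: Nat.eqb_spec.
case: (Nat.eqb_spec z y) => [->|n2]; first by rewrite /swl Nat.eqb_refl.
by rewrite /swl; do 2!case: Nat.eqb_spec => // _.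
Qed.

Lemma okw_swl x y w : (x < 7)%N -> (y < 7)%N -> okw w -> okw (map (swl x y) w).
Proof.
move=> lx ly ok; apply: okwP; rewrite ?size_map ?okw_size //.
  by rewrite map_inj_uniq ?okw_uniq //; apply: can_inj (swlK x y).
by move=> _ /mapP[z zw ->]; apply: swl_lt => //; move: zw; rewrite (perm_mem ok) mem_iota.
Qed.
Lemma pw_swl x y w : (x < 7)%N -> (y < 7)%N -> okw w ->
  pw (map (swl x y) w) = (pw w * tperm (od x) (od y))%g.
Proof.
move=> lx ly ok; apply/permP => i; apply: val_inj; rewrite /= pwE ?okw_swl // permM.
by rewrite (nth_map 0%N) ?okw_size // -swlE // pwE.
Qed.

Lemma okw_permw pt w : okw pt -> okw w -> okw (permw pt w).
Proof.
move=> okp ok; apply: okwP; rewrite ?size_map ?okw_size //.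
  rewrite map_inj_in_uniq ?okw_uniq // => a b; rewrite !(perm_mem okp) !mem_iota /= => la lb.
  by move/eqP; rewrite nth_uniq ?okw_size ?okw_uniq // => /eqP.
by move=> _ /mapP[z zw ->]; apply: okw_lt => //; move: zw; rewrite (perm_mem okp) mem_iota.
Qed.
Lemma pw_permw pt w : okw pt -> okw w -> pw (permw pt w) = (pw pt * pw w)%g.
Proof.
move=> okp ok; apply/permP => i; apply: val_inj; rewrite /= pwE ?okw_permw // permM.
by rewrite (nth_map 0%N) ?okw_size // pwE // pwE.
Qed.

Definition sign_of (K : nzRingType) (eps : bool) : K := (-1) ^+ eps.

Section GroupAlgebra.
Variable K : numFieldType.
(** Coordinates: a shape of ternary tree, and the permutation of the variables
    at its seven leaves. *)
Definition X := ('I_6 * 'S_7)%type.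
Notation N := #|{: X}|.

Definition at_ (phi : 'rV[K]_N) (x : X) : K := phi 0 (enum_rank x).
Definition fn (f : X -> K) : 'rV[K]_N := \row_i f (enum_val i).
Lemma at_fn f x : at_ (fn f) x = f x.
Proof. by rewrite /at_ mxE enum_rankK. Qed.
Lemma at_ext phi psi : (forall x, at_ phi x = at_ psi x) -> phi = psi.
Proof. by move=> e; apply/rowP => i; rewrite -(enum_valK i); apply: e. Qed.

(** Right translation by g; on trees it is the renaming of variables by g. *)
Definition R (g : 'S_7) : 'M[K]_N :=
  \matrix_(i, k) (enum_val i == ((enum_val k).1, ((enum_val k).2 * g^-1)%g) :> X)%:R.

Lemma at_R m (A : 'M_(m, N)) g i x :
  (A *m R g) i (enum_rank x) = A i (enum_rank (x.1, (x.2 * g^-1)%g)).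
Proof.
rewrite mxE (bigD1 (enum_rank (x.1, (x.2 * g^-1)%g))) //= big1 ?addr0.
  by rewrite !mxE !enum_rankK eqxx mulr1.
move=> k nk; rewrite mxE enum_rankK; case: eqP => [e|]; last by rewrite mulr0.
by rewrite -e enum_valK eqxx in nk.
Qed.

Lemma mx_ext m (A B : 'M[K]_(m, N)) : (forall i x, A i (enum_rank x) = B i (enum_rank x)) -> A = B.
Proof. by move=> e; apply/matrixP => i j; rewrite -(enum_valK j); apply: e. Qed.

Lemma R1 : R 1%g = 1%:M.
Proof. by rewrite -[LHS]mul1mx; apply: mx_ext => i [j s]; rewrite at_R invg1 mulg1. Qed.
Lemma RM g h : R (g * h)%g = R g *m R h.
Proof.
rewrite -[LHS]mul1mx -[in RHS](mul1mx (R g)); apply: mx_ext => i [j s].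
by rewrite !at_R /= invMg mulgA.
Qed.
Lemma RT g : (R g)^T = R g^-1%g.
Proof.
apply/matrixP => i k; rewrite !mxE invgK; congr (_%:R); congr (nat_of_bool _).
case: (enum_val i) (enum_val k) => a s [b t]; rewrite !xpair_eqE eq_sym; congr (_ && _).
by apply/eqP/eqP => ->; rewrite ?mulgK ?mulgKV.
Qed.

Definition tp (x y : nat) := R (tperm (od x) (od y)).
Lemma tpC x y : tp x y = tp y x. Proof. by rewrite /tp tpermC. Qed.
Lemma tpT x y : (tp x y)^T = tp x y. Proof. by rewrite /tp RT tpermV. Qed.


Local Notation sg := (sign_of K).
Lemma sgK eps : sg eps * sg eps = 1. Proof. by rewrite -signr_addb addbb. Qed.

(** The factorization of the sum of all (signed) permutations of a set of labels
    into sums over transpositions that move the first label. *)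
Fixpoint block_sym (eps : bool) (lab : seq nat) : 'M[K]_N :=
  if lab is x :: rest then
    block_sym eps rest *m (1%:M + sg eps *: \sum_(y <- rest) tp x y)
  else 1%:M.

Lemma od_neq x y : (x < 7)%N -> (y < 7)%N -> x != y -> od x != od y.
Proof. by move=> lx ly; apply: contraNneq => /(congr1 val) /=; rewrite !inordK // => ->. Qed.

Lemma tpM x y u v : tp x y *m tp u v = R (tperm (od x) (od y) * tperm (od u) (od v))%g.
Proof. by rewrite RM. Qed.

Lemma tpK x y : tp x y *m tp x y = 1%:M. Proof. by rewrite tpM tperm2 R1. Qed.

Lemma tp_conj x u y z : (x < 7)%N -> (u < 7)%N -> (y < 7)%N -> (z < 7)%N -> x != y -> x != z ->
  tp x u *m tp y z = tp y z *m tp x (swl y z u).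
Proof.
move=> lx lu ly lz xy xz; rewrite tpM tpM conjgC tpermJ.
rewrite tpermD 1?od_neq // 1?eq_sym //.
suff <- : od (swl y z u) = tperm (od y) (od z) (od u) by [].
by apply: val_inj; rewrite /= -swlE ?inordK ?swl_lt // inordK.
Qed.

(* The two conjugation rules for transpositions that drive the induction below. *)
Lemma tp_rot x u z : (x < 7)%N -> (u < 7)%N -> (z < 7)%N -> x != z -> u != z ->
  tp x u *m tp x z = tp u z *m tp x u.
Proof.
move=> lx lu lz xz uz; rewrite tpM tpM [in LHS]conjgCV tpermV tpermJ.
by rewrite tpermL tpermD 1?od_neq.
Qed.

(** The row symmetrizer (eps = false) or antisymmetrizer (eps = true) of a set
    of labels absorbs, up to sign, the transpositions of that set. *)
Lemma eS_tp eps lab y z : uniq lab -> {in lab, forall x, (x < 7)%N} ->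
  y \in lab -> z \in lab -> y != z -> block_sym eps lab *m tp y z = sg eps *: block_sym eps lab.
Proof.
elim: lab y z => // x rest IH y z /= /andP[xr ur] lt7.
have ltr : {in rest, forall x, (x < 7)%N} by move=> u ur'; apply: lt7; rewrite inE ur' orbT.
have lx : (x < 7)%N by apply: lt7; rewrite mem_head.
have nx u : u \in rest -> x != u by apply: contraTneq => <-.
have first z' : z' \in rest ->
    block_sym eps (x :: rest) *m tp x z' = sg eps *: block_sym eps (x :: rest).
  move=> zr; pose S' := \sum_(i <- rest | i != z') tp x i.
  have third : block_sym eps rest *m (\sum_(i <- rest | i != z') tp x i *m tp x z')
             = sg eps *: (block_sym eps rest *m S').
    rewrite /S' !mulmx_sumr scaler_sumr big_seq_cond [RHS]big_seq_cond.
    apply: eq_bigr => u /andP[ur' uz].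
    rewrite (tp_rot lx (ltr _ ur') (ltr _ zr) (nx _ zr) uz).
    by rewrite mulmxA IH // scalemxAl.
  have eqS : \sum_(y <- rest) tp x y = tp x z' + S' by rewrite (bigD1_seq z').
  have eqSt : (\sum_(y <- rest) tp x y) *m tp x z' =
      1%:M + \sum_(i <- rest | i != z') tp x i *m tp x z'.
    by rewrite eqS mulmxDl tpK mulmx_suml.
  rewrite /= -mulmxA mulmxDl mul1mx -scalemxAl eqSt eqS.
  rewrite mulmxDr -scalemxAr mulmxDr third mulmx1.
  rewrite mulmxDr -scalemxAr mulmxDr mulmx1 !scalerDr !scalerA sgK !scale1r.
  by rewrite addrCA.
rewrite !inE => /orP[/eqP->|yr] /orP[/eqP->|zr] yz.
- by rewrite eqxx in yz.
- exact: first.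
- by rewrite tpC; apply: first.
rewrite -mulmxA; have -> : (1%:M + sg eps *: \sum_(u <- rest) tp x u) *m tp y z =
  tp y z *m (1%:M + sg eps *: \sum_(u <- rest) tp x u).
  rewrite mulmxDl mulmxDr mul1mx mulmx1 -scalemxAl -scalemxAr mulmx_suml mulmx_sumr.
  congr (_ + _ *: _).
  have pe : perm_eq (map (swl y z) rest) rest.
    apply: uniq_perm; rewrite ?map_inj_uniq //; first exact: can_inj (swlK y z).
    have sub : {subset map (swl y z) rest <= rest}.
      by move=> _ /mapP[u ur' ->]; rewrite /swl; case: ifP => // _; case: ifP.
    apply: (uniq_min_size _ sub _).2; rewrite ?size_map //.
    by rewrite map_inj_uniq //; apply: can_inj (swlK y z).
  rewrite -[in RHS](perm_big _ pe) big_map !big_seq; apply: eq_bigr => u ur'.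
  by apply: tp_conj => //; [exact: ltr|exact: ltr|exact: ltr|exact: nx|exact: nx].
by rewrite mulmxA IH // -scalemxAl.
Qed.

Lemma tp_disj x u y z : (x < 7)%N -> (u < 7)%N -> (y < 7)%N -> (z < 7)%N ->
  x != y -> x != z -> u != y -> u != z -> tp x u *m tp y z = tp y z *m tp x u.
Proof.
move=> lx lu ly lz xy xz uy uz; rewrite tp_conj //; congr (_ *m tp x _).
by rewrite /swl; case: Nat.eqb_spec => [e|_]; [rewrite e eqxx in uy|case: Nat.eqb_spec => [e|//]; rewrite e eqxx in uz].
Qed.

Lemma eS_comm eps lab y z : {in lab, forall x, (x < 7)%N} -> (y < 7)%N -> (z < 7)%N ->
  y \notin lab -> z \notin lab -> block_sym eps lab *m tp y z = tp y z *m block_sym eps lab.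
Proof.
move=> lt7 ly lz; elim: lab lt7 => [|x rest IH] lt7; first by rewrite mul1mx mulmx1.
rewrite !inE !negb_or => /andP[yx yr] /andP[zx zr] /=.
have ltr : {in rest, forall x, (x < 7)%N} by move=> u ur'; apply: lt7; rewrite inE ur' orbT.
have lx : (x < 7)%N by apply: lt7; rewrite mem_head.
have cM : (1%:M + sg eps *: \sum_(u <- rest) tp x u) *m tp y z =
          tp y z *m (1%:M + sg eps *: \sum_(u <- rest) tp x u).
  rewrite mulmxDl mulmxDr mul1mx mulmx1 -scalemxAl -scalemxAr mulmx_suml mulmx_sumr.
  congr (_ + _ *: _); rewrite !big_seq; apply: eq_bigr => u ur'.
  apply: tp_disj; rewrite 1?eq_sym //; first exact: ltr.
    by apply: contraNneq yr => ->.
  by apply: contraNneq zr => ->.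
by rewrite -mulmxA cM mulmxA IH // mulmxA.
Qed.

Definition bseq := seq (seq nat * bool).
(** The (anti)symmetrizer of a Young subgroup; true marks the antisymmetrized
    blocks. *)
Fixpoint blocks_sym (bl : bseq) : 'M[K]_N :=
  if bl is (lab, eps) :: bl' then block_sym eps lab *m blocks_sym bl' else 1%:M.

Definition okbl (bl : bseq) : bool :=
  let all_labels := flatten (map fst bl) in
  uniq all_labels && all (fun x => x < 7)%N all_labels.

Lemma eB_comm bl y z : okbl bl -> (y < 7)%N -> (z < 7)%N ->
  y \notin flatten (map fst bl) -> z \notin flatten (map fst bl) ->
  blocks_sym bl *m tp y z = tp y z *m blocks_sym bl.
Proof.
move=> ok ly lz; elim: bl ok => [|[lab eps] bl IH] /=; first by rewrite mul1mx mulmx1.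
rewrite /okbl /= cat_uniq all_cat => /andP[/and3P[_ _ u2] /andP[a1 a2]].
rewrite !mem_cat !negb_or => /andP[y1 y2] /andP[z1 z2].
rewrite -mulmxA IH ?/okbl ?u2 // mulmxA eS_comm ?mulmxA //.
exact/allP.
Qed.

Lemma eB_tp bl lab eps y z : okbl bl -> (lab, eps) \in bl ->
  y \in lab -> z \in lab -> y != z -> blocks_sym bl *m tp y z = sg eps *: blocks_sym bl.
Proof.
elim: bl => // [[lab' eps'] bl IH].
rewrite /okbl /= cat_uniq all_cat => /andP[/and3P[u1 dis u2] /andP[a1 a2]].
have okl : okbl bl by rewrite /okbl u2.
rewrite inE => /orP[/eqP[-> ->] yl zl yz|bin yl zl yz].
  rewrite -mulmxA eB_comm //.
  - by rewrite mulmxA eS_tp // ?scalemxAl //; apply/allP.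
  - by move/allP: a1; apply.
  - by move/allP: a1; apply.
  - by apply: contra dis => yin; apply/hasP; exists y.
  - by apply: contra dis => yin; apply/hasP; exists z.
by rewrite -mulmxA IH // scalemxAr.
Qed.
End GroupAlgebra.

(** Expansion of w times the factors of block_sym. Words may have repeated letters:
    equal summands are merged, with coefficient eq, and those that cancel are
    dropped, which keeps the lists short for words with few distinct letters. *)
Fixpoint expand_block (eps : bool) (lab : seq nat) (w : seq nat) : seq (Z * seq nat) :=
  if lab is x :: rest then
    flatten (map (fun cw : Z * seq nat => let: (c, w') := cw in
      let a := nth 0%N w' x in
      let eq := foldr (fun y acc => if Nat.eqb (nth 0%N w' y) a
                  then Z.add acc (if eps then (-1)%ZZ else 1%ZZ) else acc) 1%ZZ rest in
      let tl := pmap (fun y => if Nat.eqb (nth 0%N w' y) a then None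
                  else Some (if eps then Z.opp c else c, swp x y w')) rest in
      if Z.eqb eq 0 then tl else (Z.mul c eq, w') :: tl) (expand_block eps rest w))
  else [:: (1%ZZ, w)].

Fixpoint expand (bl : bseq) (w : seq nat) : seq (Z * seq nat) :=
  if bl is (lab, eps) :: bl' then
    flatten (map (fun cw : Z * seq nat =>
      map (fun dv : Z * seq nat => (Z.mul cw.1 dv.1, dv.2)) (expand bl' cw.2)) (expand_block eps lab w))
  else [:: (1%ZZ, w)].

Lemma size_swp x y w : size (swp x y w) = 7.
Proof. by rewrite /swp /permw !size_map. Qed.

Lemma swp_id x y w : size w = 7 -> (x < 7)%N -> (y < 7)%N -> nth 0%N w x = nth 0%N w y -> swp x y w = w.
Proof.
move=> sw lx ly e; apply: (@eq_from_nth _ 0%N); rewrite size_swp // => i lt.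
rewrite /swp /permw -map_comp (nth_map 0%N) ?size_iota // nth_iota //= add0n /swl.
by case: Nat.eqb_spec => [->//|_]; case: Nat.eqb_spec => [->|].
Qed.

Section Expand.
Variables (K : numFieldType) (N' : nat).
Local Notation N := #|{: X}|.
Variable Fam : seq nat -> 'M[K]_(N', N).
Hypothesis FamP : forall x y w, size w = 7 -> (x < 7)%N -> (y < 7)%N ->
  Fam (swp x y w) = Fam w *m tp K x y.

Lemma size_expand_block eps lab w : size w = 7 -> {in expand_block eps lab w, forall cw, size cw.2 = 7}.
Proof.
move=> sw; elim: lab => [|x rest IH] /=; first by move=> cw; rewrite inE => /eqP->.
move=> cw /flattenP[s /mapP[[c w'] cin ->]] /=.
have main : cw \in pmap (fun y => if Nat.eqb (nth 0%N w' y) (nth 0%N w' x) then None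
                  else Some (if eps then Z.opp c else c, swp x y w')) rest -> size cw.2 = 7.
  rewrite mem_pmap => /mapP[y _]; case: ifP => // _ [->]; exact: size_swp.
case: ifP => _ //; rewrite inE => /orP[/eqP-> /=|//].
exact: (IH _ cin).
Qed.

(** Any family on which exchanging two positions acts as a transposition of
    labels turns the formal expansion into a product with the symmetrizer. *)
Lemma expand_block_sum eps lab w : size w = 7 -> {in lab, forall x, (x < 7)%N} ->
  \sum_(cw <- expand_block eps lab w) zR K cw.1 *: Fam cw.2 = Fam w *m block_sym K eps lab.
Proof.
move=> sw; elim: lab => [|x rest IH] lt7 /=.
  by rewrite big_seq1 /= rmorph1 scale1r mulmx1.
have ltr : {in rest, forall x, (x < 7)%N} by move=> u ur'; apply: lt7; rewrite inE ur' orbT.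
have lx : (x < 7)%N by apply: lt7; rewrite mem_head.
rewrite mulmxA -IH // mulmx_suml big_flatten big_map big_seq [RHS]big_seq.
apply: eq_bigr => [[c w'] cin] /=; have sw' : size w' = 7 by apply: (size_expand_block sw cin).
rewrite -scalemxAl mulmxDr mulmx1 -scalemxAr mulmx_sumr.
set eq := foldr _ _ _; set tl := pmap _ _.
have -> : \sum_(cw <- (if Z.eqb eq 0 then tl else (Z.mul c eq, w') :: tl)) zR K cw.1 *: Fam cw.2
   = zR K (Z.mul c eq) *: Fam w' + \sum_(cw <- tl) zR K cw.1 *: Fam cw.2.
  case: Z.eqb_spec => [->|_]; last by rewrite big_cons.
  by rewrite zRM rmorph0 mulr0 scale0r add0r.
suff main r : {in r, forall y, (y < 7)%N} ->
  let q := foldr (fun y acc => if Nat.eqb (nth 0%N w' y) (nth 0%N w' x)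
     then Z.add acc (if eps then (-1)%ZZ else 1%ZZ) else acc) 1%ZZ r in
  zR K (Z.mul c q) *: Fam w' + \sum_(cw <- pmap (fun y =>
     if Nat.eqb (nth 0%N w' y) (nth 0%N w' x) then None
     else Some (if eps then Z.opp c else c, swp x y w')) r) zR K cw.1 *: Fam cw.2
  = zR K c *: (Fam w' + sign_of K eps *: \sum_(i <- r) Fam w' *m tp K x i) by apply: main.
have dist (k e : K) (u v s : 'M[K]_(N', N)) : k *: (u + e *: (v + s)) = (k * e) *: v + k *: (u + e *: s).
  by rewrite !scalerDr !scalerA addrCA.
elim: r => [|y r IHr] ltr' /=.
  by rewrite !big_nil scaler0 !addr0 zRM rmorph1 mulr1.
have ly : (y < 7)%N by apply: ltr'; rewrite mem_head.
have {IHr} := IHr (fun u ur => ltr' u (@mem_behead _ (y :: r) u ur)); set q := foldr _ _ r => /= IHr.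
case: Nat.eqb_spec => [e|ne] /=; rewrite big_cons.
  rewrite -FamP // swp_id // dist -IHr [RHS]addrA; congr (_ + _).
  rewrite -[Z.mul _ _]/(c * (q + (if eps then (-1)%ZZ else 1%ZZ))) mulrDr rmorphD scalerDl addrC.
  by congr (_ + _ *: _); rewrite rmorphM; congr (_ * _); rewrite /sign_of; case: (eps).
rewrite /= addrCA IHr big_cons dist -FamP //; congr (_ + _); by case: (eps); rewrite /sign_of /= ?expr1 ?mulrN1 ?rmorphN ?mulr1.
Qed.

Lemma expand_sum bl w : size w = 7 -> okbl bl ->
  \sum_(cw <- expand bl w) zR K cw.1 *: Fam cw.2 = Fam w *m blocks_sym K bl.
Proof.
elim: bl w => [|[lab eps] bl IH] w sw /=.
  by rewrite big_seq1 /= rmorph1 scale1r mulmx1.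
rewrite /okbl /= cat_uniq all_cat => /andP[/and3P[u1 dis u2] /andP[a1 a2]].
rewrite mulmxA -expand_block_sum //; last exact/allP.
rewrite mulmx_suml big_flatten big_map big_seq [RHS]big_seq; apply: eq_bigr => [[c w'] cin] /=.
rewrite big_map -scalemxAl -IH ?/okbl ?u2 //; last exact: (size_expand_block sw cin).
by rewrite scaler_sumr; apply: eq_bigr => dv _; rewrite zRM scalerA.
Qed.
End Expand.

(** * Normal forms under block symmetry and skew-symmetry *)

Fixpoint meml (x : nat) (s : seq nat) : bool :=
  if s is y :: s' then if Nat.eqb x y then true else meml x s' else false.
Fixpoint firstin (lab w : seq nat) : nat :=
  if w is z :: w' then if meml z lab then z else firstin lab w' else 0%N.
(* Sort the labels of one block by the order in which they occur in the word. *)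
Fixpoint blk1 (eps : bool) (lab : seq nat) (s : bool) (w : seq nat) : bool * seq nat :=
  if lab is x :: rest then
    let y := firstin lab w in
    if Nat.eqb y x then blk1 eps rest s w
    else blk1 eps rest (s (+) eps) (map (swl x y) w)
  else (s, w).
Fixpoint blkcanon (bl : bseq) (s : bool) (w : seq nat) : bool * seq nat :=
  if bl is (lab, eps) :: bl' then
    let: (s', w') := blk1 eps lab s w in blkcanon bl' s' w'
  else (s, w).
Fixpoint eqw (s t : seq nat) : bool :=
  match s, t with
  | [::], [::] => true
  | x :: s', y :: t' => if Nat.eqb x y then eqw s' t' else false
  | _, _ => false
  end.
Fixpoint ltw (s t : seq nat) : bool :=
  match s, t with
  | x :: s', y :: t' => if Nat.eqb x y then ltw s' t' else Nat.ltb x y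
  | _, _ => false
  end.
(** Greedy search, along the moves ms, for a smaller representative up to sign;
    None means that the word is equal to its own opposite. *)
Fixpoint skew (bl : bseq) (ms : seq (seq nat)) (s : bool) (w : seq nat)
  : option (bool * seq nat) :=
  if ms is m :: ms' then
    let: (t, w') := blkcanon bl true (permw m w) in
    if eqw w' w then (if t then None else skew bl ms' s w)
    else if ltw w' w then skew bl ms' (s (+) t) w' else skew bl ms' s w
  else Some (s, w).
Definition canonw (bl : bseq) (ms : seq (seq nat)) (w : seq nat) : option (bool * seq nat) :=
  let: (s, w') := blkcanon bl false w in skew bl ms s w'.

Fixpoint firsts (F : seq (seq nat) -> seq (seq nat)) (pre post : seq (seq nat)) : seq (seq nat) :=
  if post is l :: post' then
    (if l is x :: l' then map (cons x) (F (catrev pre (l' :: post'))) else [::])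
      ++ firsts F (l :: pre) post'
  else [::].
(** The words in which the labels of each block occur in the given order. *)
Fixpoint genw (n : nat) (av : seq (seq nat)) : seq (seq nat) :=
  if n is n'.+1 then firsts (genw n') [::] av else [:: [::]].

Lemma memlE x s : meml x s = (x \in s).
Proof. by elim: s => //= y s IH; rewrite inE IH; case: Nat.eqb_spec => [->|/eqP/negbTE->]; rewrite ?eqxx. Qed.
Lemma eqwE s t : eqw s t = (s == t).
Proof.
elim: s t => [|x s IH] [|y t] //=; rewrite eqseq_cons IH.
by case: Nat.eqb_spec => [->|/eqP/negbTE->]; rewrite ?eqxx.
Qed.
Lemma firstinP x lab w : x \in w -> x \in lab -> firstin lab w \in lab.
Proof.
elim: w => //= z w IH; rewrite memlE inE; case: ifP => // zl /orP[/eqP e|] //.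
by rewrite e zl.
Qed.
Lemma okw_mem x w : okw w -> (x < 7)%N -> x \in w.
Proof. by move=> ok lt; rewrite (perm_mem ok) mem_iota. Qed.

Section Canon.
Variables (K : numFieldType) (f : seq nat -> K) (bl : bseq).
Local Notation sg := (sign_of K).
Hypothesis okl : okbl bl.
Hypothesis fswl : forall lab eps x y w, (lab, eps) \in bl -> x \in lab -> y \in lab ->
  x != y -> okw w -> f (map (swl x y) w) = sg eps * f w.

Lemma okbl_lt lab eps x : (lab, eps) \in bl -> x \in lab -> (x < 7)%N.
Proof.
move=> bin xl; case/andP: okl => _ /allP; apply; apply/flattenP; exists lab => //.
by apply/mapP; exists (lab, eps).
Qed.

Lemma blk1P lab lab' eps s w : (lab, eps) \in bl -> {subset lab' <= lab} -> okw w ->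
  okw (blk1 eps lab' s w).2 /\ sg (blk1 eps lab' s w).1 * f (blk1 eps lab' s w).2 = sg s * f w.
Proof.
move=> bin; elim: lab' s w => [|x rest IH] s w // sub ok; rewrite [blk1 _ _ _ _]/=.
have xl : x \in lab by apply: sub; rewrite mem_head.
have subr : {subset rest <= lab} by move=> u ur; apply: sub; rewrite inE ur orbT.
have yl : firstin (x :: rest) w \in lab.
  by apply/sub/(@firstinP x); rewrite ?mem_head // okw_mem // (okbl_lt bin).
case: Nat.eqb_spec => [_|/eqP ne]; first exact: IH.
have okw' : okw (map (swl x (firstin (x :: rest) w)) w).
  by apply: okw_swl => //; apply: (okbl_lt bin).
have [o1 ->] := IH (s (+) eps) _ subr okw'; split=> //.
rewrite (fswl bin xl yl) //; last by rewrite eq_sym.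
by rewrite /sign_of mulrA -signr_addb -addbA addbb addbF.
Qed.

Lemma blkcanonP bl' s w : {subset bl' <= bl} -> okw w ->
  okw (blkcanon bl' s w).2 /\ sg (blkcanon bl' s w).1 * f (blkcanon bl' s w).2 = sg s * f w.
Proof.
elim: bl' s w => [|[lab eps] bl' IH] s w //= sub ok.
have bin : (lab, eps) \in bl by apply: sub; rewrite mem_head.
have := @blk1P lab lab eps s w bin (fun _ h => h) ok.
case: (blk1 _ _ _ _) => s' w' /= [ok' <-]; apply: IH => // z zin.
by apply: sub; rewrite inE zin orbT.
Qed.

(** The normal form is reached by steps each of which multiplies the value of a
    symmetric and skew functional f by a known sign. *)
Lemma canonP ms s w : {in ms, forall m, okw m /\ forall w, okw w -> f (permw m w) = - f w} ->
  okw w -> if skew bl ms s w is Some (s', w') then okw w' /\ sg s' * f w' = sg s * f w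
           else f w = 0.
Proof.
elim: ms s w => [|m ms IH] s w //= Pms ok.
have Pms' : {in ms, forall m, okw m /\ forall w, okw w -> f (permw m w) = - f w}.
  by move=> m' min; apply: Pms; rewrite inE min orbT.
have [okm Pm] := Pms m (mem_head _ _).
have := @blkcanonP bl true (permw m w) (fun _ h => h) (okw_permw okm ok).
case: (blkcanon _ _ _) => t w' /= [ok']; rewrite Pm // /sign_of expr1 mulN1r opprK => e.
rewrite eqwE; case: eqP => [ew|_].
  case: t e => [|_]; last exact: IH.
  rewrite ew mulN1r => /eqP; rewrite eq_sym -addr_eq0 -mulr2n -mulr_natl mulf_eq0 pnatr_eq0 /=.
  by move/eqP.
case: ltw; last exact: IH.
have := IH (s (+) t) w' Pms' ok'; case: (skew _ _ _ _) => [[s' w'']|].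
  by case=> ok'' ->; split=> //; rewrite /sign_of signr_addb -mulrA e.
by rewrite -e => ->; rewrite mulr0.
Qed.

Lemma canonwP ms w : {in ms, forall m, okw m /\ forall w, okw w -> f (permw m w) = - f w} ->
  okw w -> if canonw bl ms w is Some (s', w') then okw w' /\ f w = sg s' * f w'
           else f w = 0.
Proof.
move=> Pms ok; rewrite /canonw; have := @blkcanonP bl false w (fun _ h => h) ok.
case: (blkcanon _ _ _) => s1 w1 /= [ok1]; rewrite /sign_of expr0 mul1r => <-.
have := canonP s1 Pms ok1; case: (skew _ _ _ _) => [[s' w'']|-> //].
  by case=> ? ->.
by rewrite mulr0.
Qed.

(** Exchanging labels of the same block, a word can be brought to one in which
    the labels of each block occur in increasing order. *)
Lemma genwP n (av : seq (seq nat)) pre v :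
  (forall l, l \in av -> exists lab eps, (lab, eps) \in bl /\ {subset l <= lab}) ->
  okw (pre ++ v) -> perm_eq v (flatten av) -> size v = n ->
  {in genw n av, forall w, f (pre ++ w) = 0} -> f (pre ++ v) = 0.
Proof.
elim: n av pre v => [|n IH] av pre v sav ok pv sv fz.
  by move/size0nil: sv => ->; apply: fz; rewrite mem_head.
case: v ok pv sv => // y v ok pv [sv].
have : y \in flatten av by rewrite -(perm_mem pv) mem_head.
case/flattenP=> l lav yl.
have [x [l' el]] : exists x l', l = x :: l' by case: (l) yl => // x l' _; exists x, l'.
have [a1 [a2 eav]] : exists a1 a2, av = a1 ++ l :: a2.
  by case/splitPr: lav => a1 a2; exists a1, a2.
have gen a pre' w : w \in genw n (catrev (catrev a pre') (l' :: a2)) ->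
    x :: w \in firsts (genw n) pre' (a ++ l :: a2).
  elim: a pre' => [|b a IHa] pre' win /=.
    by rewrite el mem_cat map_f.
  by rewrite mem_cat (IHa (b :: pre')) ?orbT.
have {}gen w : w \in genw n (a1 ++ l' :: a2) -> x :: w \in genw n.+1 av.
  by move=> win; rewrite /= eav; apply: gen; rewrite -[catrev a1 _]/(rev a1) catrevE revK.
have [lab [eps [bin subl]]] := sav l lav.
have xl : x \in lab by apply: subl; rewrite el mem_head.
have yl' : y \in lab by apply: subl.
have xy : swl x y y = x by rewrite /swl; case: Nat.eqb_spec => [->|_] //; rewrite Nat.eqb_refl.
have ux : x \in y :: v by rewrite (perm_mem pv); apply/flattenP; exists l; rewrite // el mem_head.
have upre z : z \in y :: v -> z \notin pre.
  by move=> zv; have := okw_uniq ok; rewrite cat_uniq => /and3P[_ /hasPn h _]; apply: h.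
have swpre : map (swl x y) pre = pre.
  rewrite -[RHS]map_id; apply/eq_in_map => z zp; rewrite /swl.
  case: Nat.eqb_spec => [e|_]; first by move: (upre _ ux); rewrite -e zp.
  by case: Nat.eqb_spec => [e|_] //; move: (upre _ (mem_head _ _)); rewrite -e zp.
set w := map (swl x y) v.
have okx : okw (map (swl x y) (pre ++ y :: v)) by apply: okw_swl; rewrite ?(okbl_lt bin).
have ew : map (swl x y) (pre ++ y :: v) = (pre ++ [:: x]) ++ w.
  by rewrite map_cat swpre /= xy -catA.
have fw : f ((pre ++ [:: x]) ++ w) = 0.
  apply: (IH (a1 ++ l' :: a2)) => [l2|||| w' w'in].
  - rewrite mem_cat inE => /orP[lin|/orP[/eqP->|lin]].
    + by apply: sav; rewrite eav mem_cat lin.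
    + by exists lab, eps; split=> // z zl; apply: subl; rewrite el inE zl orbT.
    + by apply: sav; rewrite eav mem_cat inE lin !orbT.
  - by rewrite -ew.
  - have pxy : perm_eq (x :: w) (y :: v).
      have : perm_eq (pre ++ x :: w) (pre ++ y :: v).
        apply: (@perm_trans _ (iota 0 7)); last by rewrite perm_sym.
        by rewrite -[x :: w]cat1s catA -ew.
      by rewrite perm_cat2l.
    rewrite -(perm_cons x) (perm_trans pxy) // (perm_trans pv) // eav !flatten_cat el /=.
    by rewrite -[x :: l' ++ _]cat1s -[x :: flatten _ ++ _]cat1s perm_catCA.
  - by rewrite size_map.
  - by rewrite -catA; apply: fz; apply: gen.
case: (eqVneq x y) => [e|ne].
  rewrite -fw -ew e; congr (f _); rewrite -[LHS]map_id; apply: eq_map => z.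
  by rewrite /swl; case: Nat.eqb_spec => [->|].
have := fswl bin xl yl' ne ok; rewrite ew fw => /eqP; rewrite eq_sym mulf_eq0 signr_eq0 => /eqP.
exact.
Qed.
End Canon.

(** * Multilinear polynomials of degree 7 *)

(** The six ways to form a product of seven factors, up to skew-symmetry; the
    factors are listed from left to right. *)
Definition shape (V : Type) (o : V -> V -> V -> V) (d : V) (j : nat) (a : seq V) : V :=
  if a is [:: x0; x1; x2; x3; x4; x5; x6] then
    match j with
    | 0 => o x0 x1 (o x2 x3 (o x4 x5 x6))
    | 1 => o x0 x1 (o x2 (o x3 x4 x5) x6)
    | 2 => o x0 (o x1 x2 (o x3 x4 x5)) x6
    | 3 => o x0 (o x1 (o x2 x3 x4) x5) x6
    | 4 => o x0 (o x1 x2 x3) (o x4 x5 x6)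
    | _ => o (o x0 x1 x2) (o x3 x4 x5) x6
    end
  else d.

Lemma shape_morph (V W : Type) (phi : V -> W) o o' d j a :
  (forall x y z, phi (o x y z) = o' (phi x) (phi y) (phi z)) ->
  phi (shape o d j a) = shape o' (phi d) j (map phi a).
Proof.
move=> h; case: a => [|? [|? [|? [|? [|? [|? [|? [|? ?]]]]]]]] //=.
by case: j => [|[|[|[|[|j]]]]]; rewrite !h.
Qed.

Definition wordI (s : 'S_7) : seq 'I_7 := [seq s i | i <- enum 'I_7].
Lemma word_wordI s : word s = map val (wordI s).
Proof. by rewrite -map_comp. Qed.
Lemma perm_wordI s : perm_eq (wordI s) (enum 'I_7).
Proof.
apply: uniq_perm; [|exact: enum_uniq|].
  by rewrite map_inj_uniq ?enum_uniq //; apply: perm_inj.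
move=> i; rewrite mem_enum inE; apply/mapP; exists (s^-1%g i); rewrite ?mem_enum //.
by rewrite permKV.
Qed.
Lemma wordIM s g : wordI (s * g)%g = map g (wordI s).
Proof. by rewrite /wordI -map_comp; apply: eq_map => i; rewrite permM. Qed.

Section Leaves.
Variables (K : numFieldType) (n : nat).
Local Notation A := (freeskew K n).
Implicit Types (f g h : A) (L : seq 'I_n).

(** Homogeneity with respect to the multiset of variables. *)
Definition lv L f : bool := all (fun t : nmon n => perm_eq (leaves t) L) (msupp f).

Lemma lvP L f : reflect (forall t, f@_t != 0 -> perm_eq (leaves t) L) (lv L f).
Proof.
apply: (iffP allP) => H t; first by move=> ?; apply: H; rewrite -mcoeff_neq0.
by move=> ?; apply: H; rewrite mcoeff_neq0.
Qed.

Lemma lv0 L : lv L 0. Proof. by apply/lvP => t; rewrite mcoeff0 eqxx. Qed.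
Lemma lv_lin L a f g : lv L f -> lv L g -> lv L (a *: f + g).
Proof.
move=> /lvP hf /lvP hg; apply/lvP => t; rewrite mcoeffD mcoeffZ => nz.
have [/eqP z|/hf //] := boolP (f@_t == 0); apply: hg; move: nz.
by rewrite z mulr0 add0r.
Qed.
Lemma lvZ L a f : lv L f -> lv L (a *: f).
Proof. by move=> h; rewrite -[_ *: _]addr0 lv_lin ?lv0. Qed.
Lemma lvD L f g : lv L f -> lv L g -> lv L (f + g).
Proof. by move=> h1 h2; rewrite -[f]scale1r lv_lin. Qed.
Lemma lv_sum L (I : eqType) (r : seq I) (F : I -> A) :
  {in r, forall i, lv L (F i)} -> lv L (\sum_(i <- r) F i).
Proof.
move=> h; rewrite big_seq; elim/big_ind: _ => //; [exact: lv0|exact: lvD].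
Qed.
Lemma lv_perm L L' f : perm_eq L L' -> lv L f -> lv L' f.
Proof. by move=> p /lvP h; apply/lvP => t /h/perm_trans; apply. Qed.
Lemma lvU L (t : nmon n) : perm_eq (leaves t) L -> lv L << t >>.
Proof. by move=> p; apply/lvP => u; rewrite mcoeffU; have [<- //|_] := eqVneq t u; rewrite mulr0n eqxx. Qed.
Lemma lv_gen i : lv [:: i] (gen K i). Proof. exact: lvU. Qed.

Lemma lv_bop L (x y z : nmon n) : perm_eq (leaves x ++ leaves y ++ leaves z) L -> lv L (bop K x y z).
Proof.
move=> p; rewrite /bop; case: insubP => [t _ et|_]; first by apply: lvU; rewrite et.
case: insubP => [t _ et|_]; last exact: lv0.
by rewrite -scaleN1r; apply/lvZ/lvU; rewrite et /= perm_catCA.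
Qed.

Lemma lv_fop L1 L2 L3 f g h : lv L1 f -> lv L2 g -> lv L3 h -> lv (L1 ++ L2 ++ L3) (fop f g h).
Proof.
move=> /allP h1 /allP h2 /allP h3.
apply: lv_sum => x /h1 p1; apply/lvZ/lv_sum => y /h2 p2; apply/lvZ/lv_sum => z /h3 p3.
by apply/lvZ/lv_bop; rewrite !perm_cat.
Qed.

Lemma lv_shape j (l : seq 'I_n) : lv l (shape (@fop K n) 0 j (map (@gen K n) l)).
Proof.
case: l => [|x0 [|x1 [|x2 [|x3 [|x4 [|x5 [|x6 [|? ?]]]]]]]]; try exact: lv0.
have g := lv_gen; rewrite /=; case: j => [|[|[|[|[|j]]]]].
- exact: (lv_fop (g x0) (g x1) (lv_fop (g x2) (g x3) (lv_fop (g x4) (g x5) (g x6)))).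
- exact: (lv_fop (g x0) (g x1) (lv_fop (g x2) (lv_fop (g x3) (g x4) (g x5)) (g x6))).
- exact: (lv_fop (g x0) (lv_fop (g x1) (g x2) (lv_fop (g x3) (g x4) (g x5))) (g x6)).
- exact: (lv_fop (g x0) (lv_fop (g x1) (lv_fop (g x2) (g x3) (g x4)) (g x5)) (g x6)).
- exact: (lv_fop (g x0) (lv_fop (g x1) (g x2) (g x3)) (lv_fop (g x4) (g x5) (g x6))).
- exact: (lv_fop (lv_fop (g x0) (g x1) (g x2)) (lv_fop (g x3) (g x4) (g x5)) (g x6)).
Qed.
End Leaves.

Section Shapes.
Variable n : nat.
Implicit Type t : mon n.
Local Notation sz t := (size (leaves t)).
Local Notation L := (@Leaf n).

Lemma odd_sz t : odd (sz t).
Proof. by elim: t => //= a ha b hb c hc; rewrite !size_cat !oddD ha hb hc. Qed.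
Lemma sz1 t : sz t = 1%N -> exists i, t = L i.
Proof.
case: t => [i|a b c]; first by exists i.
rewrite /= !size_cat; move: (odd_sz a) (odd_sz b); case: (sz a) => // x; case: (sz b) => // y _ _.
by rewrite addnS.
Qed.
Lemma szN (a b c : mon n) k : sz (Node a b c) = k.*2.+1 -> exists x y z : nat,
  [/\ sz a = x.*2.+1, sz b = y.*2.+1, sz c = z.*2.+1 & (x + y + z).+1 = k].
Proof.
rewrite /= !size_cat; move: (odd_sz a) (odd_sz b) (odd_sz c).
rewrite -[sz a]odd_double_half -[sz b]odd_double_half -[sz c]odd_double_half !oddD !odd_double !oddb.
move: (sz a)./2 (sz b)./2 (sz c)./2 => x y z; rewrite !addbF => -> -> -> e.
by exists x, y, z; split=> //; lia.
Qed.
(* A leaf cannot follow a node in the first two arguments. *)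
Lemma normal_first (a b c : mon n) : Defs.normal (Node a b c) -> sz b = 1%N -> sz a = 1%N.
Proof. by case/and4P=> _ _ _ lt /sz1[i e]; move: lt; rewrite e; case: a. Qed.

Lemma sz3 t : Defs.normal t -> sz t = 3 -> exists i j k, t = Node (L i) (L j) (L k).
Proof.
case: t => // a b c nt /(@szN _ _ _ 1)[[|x] [[|y] [[|z] [ea eb ec e]]]] //.
by have [[i ->] [[j ->] [k ->]]] := (sz1 ea, (sz1 eb, sz1 ec)); exists i, j, k.
Qed.
Lemma sz5 t : Defs.normal t -> sz t = 5 -> exists i j k l m,
  t = Node (L i) (L j) (Node (L k) (L l) (L m)) \/ t = Node (L i) (Node (L j) (L k) (L l)) (L m).
Proof.
case: t => // a b c nt /(@szN _ _ _ 2)[x [y [z [ea eb ec e]]]].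
have /and4P[na nb nc _] := nt; have nf := normal_first nt.
have [[ex [ey ez]]|[ex [ey ez]]] : (x = 0%N /\ y = 0%N /\ z = 1%N) \/ (x = 0%N /\ y = 1%N /\ z = 0%N).
  by case: y eb e => [|[|y]] eb e; [have := nf eb; rewrite ea|..]; lia.
- rewrite ex ey ez in ea eb ec; have [[i ->] [j ->]] := (sz1 ea, sz1 eb).
  by have [k [l [m ->]]] := sz3 nc ec; exists i, j, k, l, m; left.
rewrite ex ey ez in ea eb ec; have [[i ->] [m ->]] := (sz1 ea, sz1 ec).
by have [j [k [l ->]]] := sz3 nb eb; exists i, j, k, l, m; right.
Qed.
End Shapes.

Section Multilinear.
Variable K : numFieldType.
Local Notation A := (freeskew K 7).
Local Notation N := #|{: X}|.
Implicit Type f : A.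

Lemma multilinearE f : multilinear f = lv (enum 'I_7) f. Proof. by []. Qed.

Definition tree (x : X) : A := shape (@fop K 7) 0 x.1 (map (@gen K 7) (wordI x.2)).
(** The presentation of the space of multilinear polynomials by the span of all
    shapes in all orders. It is not injective, but it is equivariant and the
    group acts on its source by permuting coordinates. *)
Definition Phi (v : 'rV[K]_N) : A := \sum_(x : X) at_ v x *: tree x.

Lemma Phi_linear : linear Phi.
Proof.
move=> a u v; rewrite /Phi scaler_sumr -big_split; apply: eq_bigr => x _ /=.
by rewrite scalerA -scalerDl /at_ !mxE.
Qed.
HB.instance Definition _ := GRing.isLinear.Build K 'rV[K]_N A _ Phi Phi_linear.

Lemma tree_multilinear x : multilinear (tree x).
Proof. by rewrite multilinearE; apply: (lv_perm (perm_wordI x.2)); apply: lv_shape. Qed.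

Lemma Phi_multilinear v : multilinear (Phi v).
Proof.
rewrite multilinearE /Phi; apply: lv_sum => x _; apply: lvZ; exact: tree_multilinear.
Qed.

Section Eval.
Variables (V : lmodType K) (o : V -> V -> V -> V).
Hypotheses (o_lin : trilinear o) (o_skew : skew_symmetric o).

Lemma feval_shape rho j l :
  feval o rho (shape (@fop K 7) 0 j (map (@gen K 7) l)) = shape o 0 j (map rho l).
Proof.
rewrite (shape_morph _ _ _ (feval_fop rho o_lin o_skew)) linear0 -map_comp.
by congr shape; apply: eq_map => i; apply: feval_gen.
Qed.

Lemma feval_tree rho x : feval o rho (tree x) = shape o 0 x.1 (map rho (wordI x.2)).
Proof. exact: feval_shape. Qed.

Lemma feval_Phi rho v : feval o rho (Phi v) = \sum_x at_ v x *: shape o 0 x.1 (map rho (wordI x.2)).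
Proof. by rewrite linear_sum; apply: eq_bigr => x _; rewrite linearZ /= feval_tree. Qed.

Lemma feval_perm rho g f : feval o rho (perm_vars g f) = feval o (fun i => rho (g i)) f.
Proof.
pose phi h := feval o rho (perm_vars g h); rewrite -[LHS]/(phi f).
apply: feval_unique => [a u v|u v w|i].
- by rewrite /phi /perm_vars !feval_linear.
- rewrite /phi /perm_vars (feval_fop _ (@fop_trilinear K 7) (@fop_skew K 7)).
  exact: feval_fop.
- by rewrite /phi /perm_vars !feval_gen.
Qed.
End Eval.

Lemma Phi_R v g : Phi (v *m R K g) = perm_vars g (Phi v).
Proof.
rewrite /perm_vars (feval_Phi (@fop_trilinear K 7) (@fop_skew K 7)).
pose h (x : X) : X := (x.1, (x.2 * g)%g).
have hinj : injective h by move=> [j s] [j' s'] [-> /mulIg ->].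
rewrite /Phi [LHS](reindex_inj hinj) /=; apply: eq_bigr => x _.
have -> : at_ (v *m R K g) (h x) = at_ v x.
  rewrite /at_.
  rewrite at_R.
  congr (v 0 (enum_rank _)).
  by case: x => j s; rewrite /h [_.2]/= mulgK.
have el : map (@gen K 7) (wordI (h x).2) = [seq gen K (g i) | i <- wordI x.2].
  rewrite (wordIM x.2 g).
  exact: esym (map_comp (@gen K 7) g (wordI x.2)).
have e1 : (h x).1 = x.1 by [].
have et := congr1 (fun l => shape (@fop K 7) 0 (h x).1 l) el.
exact: (congr1 (fun t => at_ v x *: t) et).
Qed.

Lemma feval_id f : feval (@fop K 7) (@gen K 7) f = f.
Proof.
apply: esym; rewrite -[LHS]/(id f).
by apply: feval_unique.
Qed.

(** The leaves of a normal tree come before its nodes in the order, which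
    leaves only six shapes with seven leaves. *)
Lemma normal_shape (t : mon 7) : Defs.normal t -> size (leaves t) = 7 ->
  exists j : 'I_6, meval (@fop K 7) (@gen K 7) t = shape (@fop K 7) 0 j (map (@gen K 7) (leaves t)).
Proof.
case: t => // a b c nt /(@szN _ _ _ _ 3)[x [y [z [ea eb ec e]]]].
have /and4P[na nb nc _] := nt; have nf := normal_first nt.
pose o j (lt : (j < 6)%N) := Ordinal lt.
have [[[ex [ey ez]]|[ex [ey ez]]]|[[ex [ey ez]]|[ex [ey ez]]]] :
  ((x = 0%N /\ y = 0%N /\ z = 2%N) \/ (x = 0%N /\ y = 1%N /\ z = 1%N)) \/
  ((x = 0%N /\ y = 2%N /\ z = 0%N) \/ (x = 1%N /\ y = 1%N /\ z = 0%N)).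
- by case: y eb e => [|y] eb e; [have := nf eb; rewrite ea|]; lia.
all: rewrite ex ey ez in ea eb ec.
- have [[i0 ->] [i1 ->]] := (sz1 ea, sz1 eb).
  have [i2 [i3 [i4 [i5 [i6 [->|->]]]]]] := sz5 nc ec.
    by exists (o 0%N isT).
  by exists (o 1%N isT).
- have [i0 ->] := sz1 ea; have [i1 [i2 [i3 ->]]] := sz3 nb eb.
  by have [i4 [i5 [i6 ->]]] := sz3 nc ec; exists (o 4%N isT).
- have [[i0 ->] [i6 ->]] := (sz1 ea, sz1 ec).
  have [i1 [i2 [i3 [i4 [i5 [->|->]]]]]] := sz5 nb eb.
    by exists (o 2%N isT).
  by exists (o 3%N isT).
have [i6 ->] := sz1 ec; have [i0 [i1 [i2 ->]]] := sz3 na ea.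
by have [i3 [i4 [i5 ->]]] := sz3 nb eb; exists (o 5%N isT).
Qed.

Lemma Phi_delta x : Phi (delta_mx 0 (enum_rank x)) = tree x.
Proof.
rewrite /Phi (bigD1 x) //= big1 ?addr0; first by rewrite /at_ mxE !eqxx scale1r.
move=> y ny; rewrite /at_ mxE (inj_eq enum_rank_inj) eq_sym.
by rewrite eq_sym (negbTE ny) andbF scale0r.
Qed.

Lemma Phi_onto f : multilinear f -> exists v, f = Phi v.
Proof.
move=> ml; suff main (s : seq (nmon 7)) : {subset s <= msupp f} ->
    exists v, \sum_(t <- s) f@_t *: feval (@fop K 7) (@gen K 7) << t >> = Phi v.
  have [v e] := main _ (fun _ h => h); exists v; rewrite -e -[LHS]feval_id.
  by apply: eq_bigr => t _; rewrite /feval lextU.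
elim: s => [|t s IH] sub; first by exists 0; rewrite big_nil linear0.
have [v ev] := IH (fun u us => sub u (@mem_behead _ (t :: s) u us)).
have /(allP ml) pt : t \in msupp f by apply: sub; rewrite mem_head.
have st : size (leaves t) = 7 by rewrite (perm_size pt) size_enum_ord.
have [j ej] := normal_shape (valP t) st.
pose w := map val (leaves t); have okw : okw w.
  apply: okwP; rewrite ?size_map // ?(map_inj_uniq val_inj) ?(perm_uniq pt) ?enum_uniq //.
  by move=> _ /mapP[i _ ->]; apply: ltn_ord.
have el : leaves t = wordI (pw w).
  by apply: (inj_map val_inj); rewrite -word_wordI word_pw.
have ed : feval (@fop K 7) (@gen K 7) << t >> = Phi (delta_mx 0 (enum_rank (j, pw w))).
  rewrite Phi_delta; apply: etrans (lextU _ _) _; apply: etrans ej _.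
  exact: (congr1 (fun l => shape (@fop K 7) 0 j (map (@gen K 7) l)) el).
exists (f@_t *: delta_mx 0 (enum_rank (j, pw w)) + v).
rewrite big_cons ev ed; exact: esym (Phi_linear _ _ _).
Qed.

Lemma identities_lin a f g : identities7 f -> identities7 g -> identities7 (a *: f + g).
Proof.
case=> m1 i1 [m2 i2]; split; first exact: lv_lin.
by move=> rho; rewrite feval_linear i1 i2 scaler0 addr0.
Qed.
Lemma consequences_lin a f g : consequences7 f -> consequences7 g -> consequences7 (a *: f + g).
Proof.
case=> m1 i1 [m2 i2]; split; first exact: lv_lin.
by move=> W o l s d rho; rewrite feval_linear i1 // i2 // scaler0 addr0.
Qed.

Lemma multilinear_perm g f : multilinear f -> multilinear (perm_vars g f).
Proof. by case/Phi_onto=> v ->; rewrite -Phi_R; apply: Phi_multilinear. Qed.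

Lemma feval_ext (V : lmodType K) (o o' : V -> V -> V -> V) rho (f : A) :
  (forall x y z, o x y z = o' x y z) -> feval o rho f = feval o' rho f.
Proof. by move=> e; apply: eq_lext => -[t _] /=; elim: t => //= a -> b -> c ->. Qed.

Lemma V6_trilinear : trilinear (@V6_op K).
Proof.
have [l1 l2 l3] := gop_trilinear K v6.
by split=> [y z|x z|x y] a u v; rewrite !V6_gop; [apply: l1|apply: l2|apply: l3].
Qed.
Lemma V6_skew : skew_symmetric (@V6_op K).
Proof. by move=> x y z; rewrite !V6_gop; apply: gop_skew v6_ok _ _ _. Qed.
Lemma V6_derivation : ternary_derivation (@V6_op K).
Proof. by move=> x y z u v; rewrite !V6_gop; apply: gop_derivation v6_ok _ _ _ _ _. Qed.

Lemma consequences_identities f : consequences7 f -> identities7 f.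
Proof.
case=> ml h; split=> //; apply: h; [exact: V6_trilinear|exact: V6_skew|exact: V6_derivation].
Qed.

Lemma identities_perm g f : identities7 f -> identities7 (perm_vars g f).
Proof.
case=> m i; split; first exact: multilinear_perm.
by move=> rho; rewrite (feval_perm V6_trilinear V6_skew) i.
Qed.
Lemma consequences_perm g f : consequences7 f -> consequences7 (perm_vars g f).
Proof.
case=> m i; split; first exact: multilinear_perm.
by move=> W o l s d rho; rewrite (feval_perm l s) i.
Qed.
End Multilinear.
Section LinearForms.
Variable K : numFieldType.
Local Notation A := (freeskew K 7).
Local Notation N := #|{: X}|.
Lemma Phi_comb (I : eqType) (r : seq I) (c : I -> K) (F : I -> 'rV[K]_N) :
  Phi (\sum_(i <- r) c i *: F i) = \sum_(i <- r) c i *: Phi (F i).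
Proof.
elim: r => [|i r IH]; first by rewrite !big_nil; exact: (linear0 (@Phi K)).
by rewrite !big_cons -IH; exact: Phi_linear.
Qed.
Lemma PhiD (u v : 'rV[K]_N) : Phi (u + v) = Phi u + Phi v.
Proof. exact: (linearD (@Phi K)). Qed.
Lemma feval_comb (V : lmodType K) (o : V -> V -> V -> V) (rho : 'I_7 -> V)
  (I : eqType) (r : seq I) (c : I -> K) (F : I -> A) :
  feval o rho (\sum_(i <- r) c i *: F i) = \sum_(i <- r) c i *: feval o rho (F i).
Proof.
elim: r => [|i r IH]; first by rewrite !big_nil; exact: (linear0 (feval o rho)).
by rewrite !big_cons -IH; exact: feval_linear.
Qed.
Lemma fevalD (V : lmodType K) (o : V -> V -> V -> V) (rho : 'I_7 -> V) (f g : A) :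
  feval o rho (f + g) = feval o rho f + feval o rho g.
Proof. exact: (linearD (feval o rho)). Qed.
End LinearForms.
Opaque Phi.

(** * The instances of the identities in degree 7 *)

(** Rearrangements of the leaves of a shape that change the sign by
    skew-symmetry. The list for the last shape is repeated because one pass of
    the greedy search may not reach the smallest word. *)
Definition moves (j : nat) : seq (seq nat) :=
  match j with
  | 0 => [:: [:: 1;0;2;3;4;5;6]; [:: 0;1;3;2;4;5;6]; [:: 0;1;2;3;5;4;6]]
  | 1 => [:: [:: 1;0;2;3;4;5;6]; [:: 0;1;2;4;3;5;6]]
  | 2 => [:: [:: 0;2;1;3;4;5;6]; [:: 0;1;2;4;3;5;6]]
  | 3 => [:: [:: 0;1;3;2;4;5;6]]
  | 4 => [:: [:: 0;2;1;3;4;5;6]; [:: 0;1;2;3;5;4;6]]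
  | 5 => [:: [:: 1;0;2;3;4;5;6]; [:: 0;1;2;4;3;5;6]; [:: 3;4;5;0;1;2;6];
             [:: 1;0;2;3;4;5;6]; [:: 0;1;2;4;3;5;6]; [:: 3;4;5;0;1;2;6]]
  | _ => [::]
  end%N.

(** The consequences in degree 7 of r(a,b,c,d,e), the ternary derivation
    identity: r((abc),d,e,f,g), r(a,b,(cde),f,g), r(a,b,c,d,(efg)),
    (r(a,b,c,d,e) f g) and (f g r(a,b,c,d,e)), as signed sums of shapes with
    the positions of the variables. *)
Definition rels (k : nat) : seq (bool * (nat * seq nat)) :=
  match k with
  | 0 => [:: (false, (3, [:: 5;3;0;1;2;4;6])); (true, (3, [:: 4;3;0;1;2;5;6]));
             (false, (4, [:: 3;0;1;2;4;5;6])); (true, (1, [:: 4;5;3;0;1;2;6]))]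
  | 1 => [:: (true, (2, [:: 5;0;1;2;3;4;6])); (true, (5, [:: 0;1;5;2;3;4;6]));
             (false, (1, [:: 0;1;5;2;3;4;6])); (true, (4, [:: 5;2;3;4;0;1;6]))]
  | 2 => [:: (true, (4, [:: 3;0;1;2;4;5;6])); (false, (4, [:: 2;0;1;3;4;5;6]));
             (true, (0, [:: 0;1;2;3;4;5;6])); (false, (0, [:: 2;3;0;1;4;5;6]))]
  | 3 => [:: (false, (3, [:: 5;3;0;1;2;4;6])); (true, (3, [:: 5;2;0;1;3;4;6]));
             (false, (2, [:: 5;0;1;2;3;4;6])); (true, (2, [:: 5;2;3;0;1;4;6]))]
  | _ => [:: (true, (1, [:: 5;6;3;0;1;2;4])); (false, (1, [:: 5;6;2;0;1;3;4]));
             (true, (0, [:: 5;6;0;1;2;3;4])); (false, (0, [:: 5;6;2;3;0;1;4]))]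
  end%N.

Section Alg.
Variables (K : numFieldType) (V : lmodType K) (o : V -> V -> V -> V).
Hypotheses (o_lin : trilinear o) (o_skew : skew_symmetric o).
Local Notation sg := (sign_of K).

Definition pick_args (pt : seq nat) (a : seq V) : seq V := [seq nth 0 a i | i <- pt].

Lemma oS x y z : o x y z = - o y x z.
Proof. by apply/eqP; rewrite -addr_eq0 o_skew. Qed.
Lemma o0 x y : [/\ o 0 x y = 0, o x 0 y = 0 & o x y 0 = 0].
Proof.
have [l1 l2 l3] := o_lin.
by split; [have := l1 x y (-1) 0 0|have := l2 x y (-1) 0 0|have := l3 x y (-1) 0 0];
  rewrite scaler0 addr0 scaleN1r addNr.
Qed.
Lemma oNl x y z : o (- x) y z = - o x y z.
Proof. by have [l1 _ _] := o_lin; have := l1 y z (-1) x 0; rewrite addr0 !scaleN1r (_ : o 0 y z = 0) ?addr0 //; case: (o0 y z). Qed.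
Lemma oNm x y z : o x (- y) z = - o x y z.
Proof. by rewrite oS oNl opprK oS. Qed.
Lemma oNr x y z : o x y (- z) = - o x y z.
Proof. by have [_ _ l1] := o_lin; have := l1 x y (-1) z 0; rewrite addr0 !scaleN1r (_ : o x y 0 = 0) ?addr0 //; case: (o0 x y). Qed.
Lemma oDl x x' y z : o (x + x') y z = o x y z + o x' y z.
Proof. by have [l1 _ _] := o_lin; have := l1 y z 1 x x'; rewrite !scale1r. Qed.
Lemma oDr x y z z' : o x y (z + z') = o x y z + o x y z'.
Proof. by have [_ _ l1] := o_lin; have := l1 x y 1 z z'; rewrite !scale1r. Qed.

Lemma shape_move j m a : m \in moves j -> size a = 7 ->
  shape o 0 j (pick_args m a) = - shape o 0 j a.
Proof.
case: a => [|x0 [|x1 [|x2 [|x3 [|x4 [|x5 [|x6 [|? ?]]]]]]]] // min _; move: min.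
case: j => [|[|[|[|[|[|j]]]]]]; rewrite ?inE //=.
- case/or3P=> /eqP-> /=; first exact: oS.
    by rewrite (oS x3) oNr.
  by rewrite (oS x5) !oNr.
- by case/orP=> /eqP-> /=; [exact: oS|rewrite (oS x4) oNm oNr].
- by case/orP=> /eqP-> /=; [rewrite (oS x2) oNm|rewrite (oS x4) oNr oNm].
- by move/eqP-> => /=; rewrite (oS x3) oNm oNm.
- by case/orP=> /eqP-> /=; [rewrite (oS x2) oNm|rewrite (oS x5) oNr].
by case/or4P=> [/eqP->|/eqP->|/eqP->|/or3P[] /eqP->] /=;
  [rewrite (oS x1) oNl|rewrite (oS x4) oNm|exact: oS|rewrite (oS x1) oNl|rewrite (oS x4) oNm|exact: oS].
Qed.

Hypothesis o_der : ternary_derivation o.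
Lemma rels_zero k a : size a = 7 ->
  \sum_(t <- rels k) sg t.1 *: shape o 0 t.2.1 (pick_args t.2.2 a) = 0.
Proof.
case: a => [|a [|b [|c [|d [|e [|f [|g [|? ?]]]]]]]] // _.
have H := o_der.
case: k => [|[|[|[|k]]]]; rewrite !big_cons big_nil /= /sign_of expr1 expr0 !scale1r !scaleN1r addr0.
- have := H (o a b c) d e f g; rewrite (oS f) (oS d) oNl opprK (oS e (o d _ _)) (oS d _ f) oNl opprK.
  by rewrite (oS d _ (o e f g)) (oS d _ g) oNr opprK !addrA.
- have := H a b (o c d e) f g; rewrite (oS f (o a b _)) (oS f _ g) oNr (oS f _ (o a b g)) !opprK.
  by rewrite !addrA.
- have := H a b c d (o e f g); rewrite (oS d (o a b c)) (oS c (o a b d)) !opprK.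
  by rewrite !addrA.
- have /(congr1 (fun z => o z f g)) := H a b c d e; rewrite !oDl !oNl (_ : o 0 f g = 0); last by case: (o0 f g).
  rewrite (oS f (o d _ _)) (oS d) oNl opprK (oS f (o c (o _ _ _) _)) (oS c (o a b d)) oNl opprK.
  by rewrite (oS f (o a b _)) (oS f (o c d _)) !opprK !addrA.
have /(congr1 (fun z => o f g z)) := H a b c d e; rewrite !oDr !oNr (_ : o f g 0 = 0); last by case: (o0 f g).
rewrite (oS d) (oS c (o a b d)) !oNr !opprK.
by rewrite !addrA.
Qed.
End Alg.

(** * Annihilators of the identities and of the consequences *)

Lemma wordI_pw w : okw w -> wordI (pw w) = [seq inord i | i <- w].
Proof.
move=> ok; apply: (inj_map val_inj); rewrite -word_wordI word_pw // -map_comp -[LHS]map_id.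
apply/eq_in_map => i; rewrite (perm_mem ok) mem_iota => lt.
by rewrite /= inordK.
Qed.

Lemma rels_ok k : all (fun t : bool * (nat * seq nat) => (t.2.1 < 6)%N && okw t.2.2) (rels k).
Proof. by case: k => [|[|[|[|[|k]]]]]. Qed.
Lemma moves_ok j : {in moves j, forall m, okw m}.
Proof. by apply/allP; case: j => [|[|[|[|[|[|j]]]]]]. Qed.

Lemma permw_map (V : Type) (x0 : V) (h : nat -> V) pt w : okw pt -> size w = 7 ->
  [seq nth x0 (map h w) i | i <- pt] = map h (permw pt w).
Proof.
move=> okp sw; rewrite /permw -map_comp; apply/eq_in_map => i.
by rewrite (perm_mem okp) mem_iota => lt /=; rewrite (nth_map 0%N) ?sw.
Qed.

(** A coordinate is also written as a single list, the shape followed by the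
    word. *)
Definition cidx (c : seq nat) : X := (inord (head 0%N c), pw (behead c)).

Section Functionals.
Variable K : numFieldType.
Local Notation N := #|{: X}|.
Local Notation A := (freeskew K 7).
Local Notation sg := (sign_of K).
Implicit Types (u v : 'rV[K]_N).

Definition colv u (c : seq nat) : K := at_ u (cidx c).
Definition dvec (c : seq nat) : 'rV[K]_N := delta_mx 0 (enum_rank (cidx c)).

Lemma dvecE u c : (u *m (dvec c)^T) 0 0 = colv u c.
Proof. by rewrite /dvec trmx_delta -colE mxE. Qed.

Lemma pair_sum u v : (u *m v^T) 0 0 = \sum_x at_ u x * at_ v x.
Proof.
rewrite mxE (reindex enum_rank) /=; last by apply: onW_bij; apply: enum_rank_bij.
by apply: eq_bigr => x _; rewrite mxE.
Qed.

Lemma tree_dvec c : (head 0%N c < 6)%N -> okw (behead c) ->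
  Phi (dvec c) = shape (@fop K 7) 0 (head 0%N c) (map (fun i => gen K (inord i : 'I_7)) (behead c)).
Proof.
move=> lj ok; rewrite Phi_delta /tree /cidx [_.1]/= [_.2]/= inordK // wordI_pw //.
exact: (congr1 (fun l => shape (@fop K 7) 0 (head 0%N c) l) (esym (map_comp _ _ _))).
Qed.

Section Relations.
Variables (V : lmodType K) (o : V -> V -> V -> V) (rho : 'I_7 -> V).
Hypotheses (o_lin : trilinear o) (o_skew : skew_symmetric o).

Lemma feval_dvec j w : (j < 6)%N -> okw w ->
  feval o rho (Phi (dvec (j :: w))) = shape o 0 j (map (fun i => rho (inord i)) w).
Proof.
move=> lj ok; rewrite tree_dvec // (map_comp (@gen K 7) (fun i => inord i)).
by rewrite (feval_shape o_lin o_skew) -map_comp.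
Qed.
End Relations.

Definition relvec k w : 'rV[K]_N :=
  \sum_(t <- rels k) sg t.1 *: dvec (t.2.1 :: permw t.2.2 w).
Definition movevec m j w : 'rV[K]_N := dvec (j :: permw m w) + dvec (j :: w).

Lemma relvec_conseq k w : okw w -> consequences7 (Phi (relvec k w)).
Proof.
move=> ok; split; first exact: Phi_multilinear.
move=> W o l s d rho; rewrite /relvec Phi_comb feval_comb.
rewrite -[RHS](rels_zero l s d k (a := map (fun i => rho (inord i)) w)) ?size_map ?okw_size //.
rewrite !big_seq; apply: eq_bigr => t tin; have /andP[lj okp] := allP (rels_ok k) _ tin.
rewrite (feval_dvec rho l s) ?okw_permw //.
by rewrite /pick_args permw_map ?okw_size.
Qed.

Lemma movevec_conseq m j w : (j < 6)%N -> m \in moves j -> okw w ->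
  consequences7 (Phi (movevec m j w)).
Proof.
move=> lj min ok; have okm := moves_ok min; split; first exact: Phi_multilinear.
move=> W o l s d rho; rewrite /movevec PhiD fevalD.
have e1 := feval_dvec rho l s lj (okw_permw okm ok).
have e2 := feval_dvec rho l s lj ok.
apply: etrans (congr2 (fun x y => x + y) e1 e2) _.
have sa : size (map (fun i => rho (inord i)) w) = 7 by rewrite size_map okw_size.
have := shape_move l s min sa; rewrite /pick_args permw_map ?okw_size // => ->.
exact: addNr.
Qed.

Section EvFunctional.
Variables (V : lmodType K) (o : V -> V -> V -> V) (l : {linear V -> K^o}).
Hypotheses (o_lin : trilinear o) (o_skew : skew_symmetric o).
(** A linear form on the value at a substitution, as a functional on the span of
    the shapes. *)
Definition evf (rho : 'I_7 -> V) : 'rV[K]_N :=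
  fn (fun x : X => (l (shape o 0 x.1 (map rho (wordI x.2))) : K)).
Lemma evf_pair rho v : (evf rho *m v^T) 0 0 = l (feval o rho (Phi v)).
Proof.
rewrite pair_sum (feval_Phi o_lin o_skew) linear_sum; apply: eq_bigr => x _.
by rewrite at_fn linearZ /= mulrC.
Qed.
Lemma evf_R rho g : evf rho *m R K g = evf (fun i => rho (g^-1%g i)).
Proof.
apply: at_ext => x; rewrite /at_ at_R -/(at_ _ _) at_fn -/(at_ _ _) at_fn.
rewrite [_.1]/= [_.2]/= wordIM -map_comp; exact.
Qed.
End EvFunctional.

Section Dual.
Variable P : A -> Prop.
Hypotheses (P0 : P 0) (Plin : forall a f g, P f -> P g -> P (a *: f + g)).
Hypothesis Pperm : forall g f, P f -> P (perm_vars g f).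

Lemma solutions_ex : exists M : 'M[K]_N, forall v : 'rV[K]_N, P (Phi v) <-> (v <= M)%MS.
Proof.
apply: (subspace_mx (P := fun v => P (Phi v))) => [|a u v pu pv]; first by rewrite linear0.
by rewrite Phi_linear; apply: Plin.
Qed.
(* The coordinate vectors of the polynomials that satisfy P. *)
Definition solutions : 'M[K]_N := sval (cid solutions_ex).
Lemma solutionsP v : P (Phi v) <-> (v <= solutions)%MS. Proof. exact: (svalP (cid solutions_ex)). Qed.
(** Functionals are more convenient than polynomials: they are easily produced
    by evaluation, and constrained by single relations. *)
Definition ann : 'M[K]_N := kermx solutions^T.
Lemma annP u : (u <= ann)%MS <-> forall v, P (Phi v) -> (u *m v^T) 0 0 = 0.
Proof.
split=> [/sub_kermxP us v /solutionsP/submxP[y ->]|h].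
  by rewrite trmx_mul mulmxA us mul0mx mxE.
apply/sub_kermxP/rowP => i; rewrite [RHS]mxE.
have := h (row i solutions); rewrite solutionsP row_sub => /(_ isT) <-.
by rewrite !mxE; apply: eq_bigr => k _; rewrite !mxE.
Qed.
Lemma ann_stable g : (ann *m R K g <= ann)%MS.
Proof.
apply/row_subP => i; rewrite row_mul; apply/annP => v pv.
have : (row i ann <= ann)%MS by apply: row_sub.
move/annP => /(_ (v *m R K g^-1%g)); rewrite Phi_R => /(_ (Pperm _ pv)) <-.
by rewrite trmx_mul RT invgK mulmxA.
Qed.
Lemma rank_ann : \rank ann = (N - \rank solutions)%N.
Proof. by rewrite mxrank_ker mxrank_tr. Qed.
End Dual.

Lemma identities0 : identities7 (0 : A).
Proof. by split; [exact: lv0|move=> rho; rewrite /feval linear0]. Qed.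
Lemma consequences0 : consequences7 (0 : A).
Proof. by split; [exact: lv0|move=> W o _ _ _ rho; rewrite /feval linear0]. Qed.

Definition AI := solutions identities0 (@identities_lin K).
Definition AC := solutions consequences0 (@consequences_lin K).
Definition DI := ann identities0 (@identities_lin K).
Definition DC := ann consequences0 (@consequences_lin K).

Lemma AIP v : identities7 (Phi v) <-> (v <= AI)%MS. Proof. exact: solutionsP. Qed.
Lemma ACP v : consequences7 (Phi v) <-> (v <= AC)%MS. Proof. exact: solutionsP. Qed.
Lemma DIP u : (u <= DI)%MS <-> forall v, identities7 (Phi v) -> (u *m v^T) 0 0 = 0.
Proof. exact: annP. Qed.
Lemma DCP u : (u <= DC)%MS <-> forall v, consequences7 (Phi v) -> (u *m v^T) 0 0 = 0.
Proof. exact: annP. Qed.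
Lemma DI_stable g : (DI *m R K g <= DI)%MS. Proof. exact/ann_stable/identities_perm. Qed.
Lemma DC_stable g : (DC *m R K g <= DC)%MS. Proof. exact/ann_stable/consequences_perm. Qed.
Lemma AC_AI : (AC <= AI)%MS.
Proof. by apply/row_subP => i; apply/AIP/consequences_identities/ACP/row_sub. Qed.
Lemma DI_DC : (DI <= DC)%MS.
Proof.
apply/row_subP => i; apply/DCP => v cv; have : (row i DI <= DI)%MS := row_sub _ _.
by move/DIP; apply; apply: consequences_identities.
Qed.

Lemma DC_rel u k w : (u <= DC)%MS -> okw w ->
  \sum_(t <- rels k) sg t.1 * colv u (t.2.1 :: permw t.2.2 w) = 0.
Proof.
move=> /DCP ud ok; rewrite -[RHS](ud _ (relvec_conseq k ok)) /relvec linear_sum mulmx_sumr summxE.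
by apply: eq_bigr => t _; rewrite linearZ -scalemxAr mxE dvecE.
Qed.
Lemma DC_move u j m w : (u <= DC)%MS -> (j < 6)%N -> m \in moves j -> okw w ->
  colv u (j :: permw m w) = - colv u (j :: w).
Proof.
move=> /DCP ud lj min ok; apply/eqP; rewrite -addr_eq0 -!dvecE.
have := ud _ (movevec_conseq lj min ok); rewrite /movevec linearD /= mulmxDr mxE => ->.
by rewrite eqxx.
Qed.

Lemma eB_stable (D : 'M[K]_N) bl : (forall g, (D *m R K g <= D)%MS) -> (D *m blocks_sym K bl <= D)%MS.
Proof.
move=> st; have stp x y : (D *m tp K x y <= D)%MS by apply: st.
have stS eps lab : (D *m block_sym K eps lab <= D)%MS.
  elim: lab => [|x rest IH] /=; first by rewrite mulmx1.
  rewrite mulmxA; apply: submx_trans (submxMr _ IH) _; rewrite mulmxDr mulmx1.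
  rewrite addmx_sub // -scalemxAr scalemx_sub // mulmx_sumr summx_sub // => y _.
elim: bl => [|[lab eps] bl IH] /=; first by rewrite mulmx1.
by rewrite mulmxA; apply: submx_trans (submxMr _ (stS _ _)) IH.
Qed.

Definition Sel (cs : seq (seq nat)) : 'M[K]_(N, size cs) :=
  \matrix_(i, k) (i == enum_rank (cidx (nth [::] cs k)))%:R.
Lemma SelE m (M : 'M[K]_(m, N)) cs i k : (M *m Sel cs) i k = colv (row i M) (nth [::] cs k).
Proof.
rewrite mxE (bigD1 (enum_rank (cidx (nth [::] cs k)))) //= mxE eqxx mulr1 big1 ?addr0.
  by rewrite /colv /at_ mxE.
by move=> l nl; rewrite mxE (negbTE nl) mulr0.
Qed.

(** A space of functionals embeds into the values at a set of coordinates as soon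
    as these values determine the functional. *)
Lemma rank_le_cols (Y : 'M[K]_N) cs :
  (forall u, (u <= Y)%MS -> {in cs, forall c, colv u c = 0} -> u = 0) -> (\rank Y <= size cs)%N.
Proof.
move=> h; rewrite -(mxrank_mul_ker Y (Sel cs)).
rewrite (_ : (Y :&: kermx (Sel cs))%MS = 0) ?mxrank0 ?addn0 ?rank_leq_col //.
apply/eqP/rowV0P => u; rewrite sub_capmx => /andP[uY /sub_kermxP uS]; apply: h => // c cin.
have lt : (index c cs < size cs)%N by rewrite index_mem.
have := congr1 (fun M : 'rV_ _ => M 0 (Ordinal lt)) uS; rewrite SelE mxE /= nth_index //.
by rewrite (_ : row 0 u = u) //; apply/rowP => k; rewrite mxE.
Qed.

Lemma rank_ge_cols (Y : 'M[K]_N) n (ps : seq 'rV[K]_N) cs (M : 'M[K]_(size ps, n)) :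
  {in ps, forall p, (p <= Y)%MS} -> n = size cs ->
  (forall i k, M i k = colv (nth 0 ps i) (nth [::] cs k)) -> (\rank M <= \rank Y)%N.
Proof.
move=> py en; rewrite en in M * => hM.
have -> : M = (\matrix_i nth 0 ps i) *m Sel cs.
  by apply/matrixP => i k; rewrite SelE rowK.
apply: leq_trans (mxrankM_maxl _ _) _; apply/mxrankS/row_subP => i; rewrite rowK.
by apply: py; rewrite mem_nth.
Qed.
End Functionals.

(** * Symmetrizers and functionals from weight vectors *)

Section Symmetry.
Variable K : numFieldType.
Local Notation N := #|{: X}|.
Local Notation sg := (sign_of K).

Definition fact_bl (bl : bseq) : nat := foldr (fun b acc => (size b.1)`! * acc)%N 1%N bl.

Lemma eS_absorb (E : 'M[K]_N) eps lab : uniq lab ->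
  (forall x y, x \in lab -> y \in lab -> x != y -> E *m tp K x y = sg eps *: E) ->
  E *m block_sym K eps lab = (size lab)`!%:R *: E /\ E *m (block_sym K eps lab)^T = (size lab)`!%:R *: E.
Proof.
elim: lab => [|x rest IH] /=; first by rewrite trmx1 mulmx1 scale1r.
case/andP=> xr ur h.
have [h1 h2] : E *m block_sym K eps rest = (size rest)`!%:R *: E /\ E *m (block_sym K eps rest)^T = (size rest)`!%:R *: E.
  by apply: IH => // y z yr zr; apply: h; rewrite inE ?yr ?zr orbT.
have hF : E *m (1%:M + sg eps *: \sum_(y <- rest) tp K x y) = (size rest).+1%:R *: E.
  rewrite mulmxDr mulmx1 -scalemxAr mulmx_sumr big_seq (eq_bigr (fun=> sg eps *: E)).
    rewrite -big_seq -scaler_sumr scalerA sgK scale1r big_const_seq count_predT iter_addr_0 -scaler_nat.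
    by rewrite -[X in X + _]scale1r -scalerDl nat1r.
  move=> y yr; apply: h; rewrite ?mem_head ?inE ?yr ?orbT //.
  by apply: contraNneq xr => ->.
rewrite mulmxA h1 -scalemxAl hF scalerA -natrM mulnC -factS; split=> //.
rewrite trmx_mul linearD /= trmx1 linearZ /= raddf_sum /=.
have -> : \sum_(y <- rest) (tp K x y)^T = \sum_(y <- rest) tp K x y.
  by apply: eq_bigr => y _; rewrite tpT.
by rewrite mulmxA hF -scalemxAl h2 scalerA -natrM -factS.
Qed.

(** Both the square of the symmetrizer and its product with its transpose are
    the same multiple of it, because it absorbs every transposition inside a
    block up to sign; hence it is symmetric. *)
Lemma eB_absorb (E : 'M[K]_N) bl : all (fun b : seq nat * bool => uniq b.1) bl ->
  (forall lab eps x y, (lab, eps) \in bl -> x \in lab -> y \in lab -> x != y ->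
     E *m tp K x y = sg eps *: E) ->
  E *m blocks_sym K bl = (fact_bl bl)%:R *: E /\ E *m (blocks_sym K bl)^T = (fact_bl bl)%:R *: E.
Proof.
elim: bl => [|[lab eps] bl IH] /=; first by rewrite trmx1 mulmx1 scale1r.
case/andP=> ul ub h.
have [h1 h2] : E *m blocks_sym K bl = (fact_bl bl)%:R *: E /\ E *m (blocks_sym K bl)^T = (fact_bl bl)%:R *: E.
  by apply: IH => // l e x y lin; apply: h; rewrite inE lin orbT.
have [g1 g2] := eS_absorb ul (fun x y => h lab eps x y (mem_head _ _)).
rewrite trmx_mul !mulmxA g1 h2 -!scalemxAl g2 h1 !scalerA -!natrM; split=> //.
by rewrite mulnC.
Qed.

Lemma fact_bl_gt0 bl : (0 < fact_bl bl)%N.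
Proof. by elim: bl => //= b bl IH; rewrite muln_gt0 fact_gt0. Qed.

Lemma okbl_uniq bl : okbl bl -> all (fun b : seq nat * bool => uniq b.1) bl.
Proof.
rewrite /okbl => /andP[u _]; elim: bl u => //= b bl IH.
by rewrite cat_uniq => /and3P[-> _ /IH].
Qed.

Lemma eB_abs bl : okbl bl ->
  blocks_sym K bl *m blocks_sym K bl = (fact_bl bl)%:R *: blocks_sym K bl /\ (blocks_sym K bl)^T = blocks_sym K bl.
Proof.
move=> ok; have [h1 h2] := eB_absorb (okbl_uniq ok) (fun lab eps x y => @eB_tp K bl lab eps x y ok).
split=> //; have nz : (fact_bl bl)%:R != 0 :> K by rewrite pnatr_eq0 -lt0n fact_bl_gt0.
apply: (scalerI nz); rewrite -h2 -[in LHS]linearZ /= -h2.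
by rewrite trmx_mul trmxK.
Qed.
End Symmetry.

Definition okp (n : nat) (w : seq nat) : bool := (size w == 7) && all (fun i => i <= n)%N w.
Definition okcol (c : seq nat) : bool := (head 0%N c < 6)%N && okw (behead c).

Definition zev (m : model) (j : nat) (a : seq nat) : option (Z * nat) :=
  shape (zop m) None j (map (fun i => Some (1%ZZ, i)) a).

Definition fval (m : model) (exl : seq (Z * seq nat)) (c : seq nat) : Z :=
  if c is j :: word then
    foldr (fun (cw : Z * seq nat) acc =>
      if zev m j (permw word cw.2) is Some (v, _) then Z.add acc (Z.mul cw.1 v) else acc) 0%ZZ exl
  else 0%ZZ.

Lemma okp_swp n x y w : okp n w -> okp n (swp x y w).
Proof.
case/andP=> _ /allP h; rewrite /okp size_swp; apply/allP => z /mapP[i _ ->].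
have [lt|ge] := ltnP i (size w); last by rewrite nth_default.
by apply: h; apply: mem_nth.
Qed.

Lemma expand_stable (Q : seq nat -> Prop) bl w : okbl bl ->
  (forall x y w, (x < 7)%N -> (y < 7)%N -> Q w -> Q (swp x y w)) -> Q w ->
  {in expand bl w, forall cw, Q cw.2}.
Proof.
move=> ok st.
have stS eps lab w' : {in lab, forall x, (x < 7)%N} -> Q w' -> {in expand_block eps lab w', forall cw, Q cw.2}.
  elim: lab => [|x rest IH] lt7 qw /=; first by move=> cw; rewrite inE => /eqP->.
  have ltr : {in rest, forall x, (x < 7)%N} by move=> u ur; apply: lt7; rewrite inE ur orbT.
  have lx : (x < 7)%N by apply: lt7; rewrite mem_head.
  move=> cw /flattenP[s /mapP[[c w1] cin ->]] /=; have q1 : Q w1 by apply: (IH ltr qw _ cin).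
  have main : cw \in pmap (fun y => if Nat.eqb (nth 0%N w1 y) (nth 0%N w1 x) then None
       else Some (if eps then Z.opp c else c, swp x y w1)) rest -> Q cw.2.
    rewrite mem_pmap => /mapP[y yr]; case: ifP => // _ [->] /=.
    by apply: st => //; apply: ltr.
  by case: ifP => _ //; rewrite inE => /orP[/eqP-> /=|].
elim: bl w ok => [|[lab eps] bl IH] w /=; first by move=> _ qw cw; rewrite inE => /eqP->.
rewrite /okbl /= cat_uniq all_cat => /andP[/and3P[u1 dis u2] /andP[/allP a1 a2]] qw.
move=> cw /flattenP[s /mapP[[c w'] cin ->]] /mapP[dv din ->] /=.
by apply: (IH w') => //; [rewrite /okbl u2|apply: (stS _ _ _ a1 qw _ cin)].
Qed.

Section Points.
Local Arguments zop : simpl never.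
Variables (K : numFieldType) (m : model).
Local Notation N := #|{: X}|.
Local Notation n := (mn m).

(** The product of weight vectors is a weight vector, so the sum of its
    coordinates is its only nonzero coordinate. *)
Definition ell (v : 'rV[K]_n.+1) : K^o := \sum_k v 0 k.
Lemma ell_linear : linear ell.
Proof.
move=> a u v; rewrite /ell scaler_sumr -big_split; apply: eq_bigr => k _.
by rewrite !mxE.
Qed.
HB.instance Definition _ := GRing.isLinear.Build K 'rV[K]_n.+1 K^o _ ell ell_linear.

Definition pt (w : seq nat) (i : 'I_7) : 'rV[K]_n.+1 := bv K m (nth 0%N w i).
(** The functional that evaluates at basis vectors; the word w lists the indices
    of the vectors substituted for the variables. *)
Definition wform (w : seq nat) : 'rV[K]_N := evf (@gop K m) ell (pt w).

Lemma ell_zval t : zok m t -> ell (zval K m t) = zR K (if t is Some (v, _) then v else 0%ZZ).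
Proof.
case: t => [[a i]|] /= ok; last by rewrite rmorph0 (linear0 ell).
rewrite /ell (bigD1 (Ordinal (ok : (i < n.+1)%N))) //= !mxE eqxx mulr1 big1 ?addr0 //.
move=> k nk; rewrite !mxE; case: eqP => [e|]; last by rewrite mulr0.
by case/eqP: nk; apply: val_inj.
Qed.

Lemma zevP j a : all (fun i => i <= n)%N a ->
  zval K m (zev m j a) = shape (@gop K m) 0 j (map (bv K m) a) /\ zok m (zev m j a).
Proof.
rewrite /zev; case: a => [|x0 [|x1 [|x2 [|x3 [|x4 [|x5 [|x6 [|? ?]]]]]]]] //=.
case/and5P=> h0 h1 h2 h3 /and4P[h4 h5 h6 _].
pose z i : option (Z * nat) := Some (1%ZZ, i).
have bz i : bv K m i = zval K m (z i) by rewrite /= rmorph1 scale1r.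
have P (x y w : option (Z * nat)) := @zopP K m x y w; rewrite !bz.
have Q (x y w : option (Z * nat)) : zok m x -> zok m y -> zok m w -> zok m (zop m x y w).
  by move=> a b c; case: (P x y w a b c).
have E (x y w : option (Z * nat)) : zok m x -> zok m y -> zok m w ->
   gop (zval K m x) (zval K m y) (zval K m w) = zval K m (zop m x y w).
  by move=> a b c; case: (P x y w a b c).
have k0 : zok m (z x0) by []. have k1 : zok m (z x1) by []. have k2 : zok m (z x2) by [].
have k3 : zok m (z x3) by []. have k4 : zok m (z x4) by []. have k5 : zok m (z x5) by [].
have k6 : zok m (z x6) by [].
by case: j => [|[|[|[|[|j]]]]]; rewrite !E ?Q.
Qed.

Lemma famP x y w : size w = 7 -> (x < 7)%N -> (y < 7)%N -> wform (swp x y w) = wform w *m tp K x y.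
Proof.
move=> sw lx ly; rewrite /wform /tp evf_R tpermV; congr evf; apply: funext => i.
rewrite /pt -swlE // /swp /permw -map_comp (nth_map 0%N) ?size_iota // nth_iota //.
Qed.

Lemma colv_fam j word w : (j < 6)%N -> okw word -> okp n w ->
  colv (wform w) (j :: word) = zR K (if zev m j (permw word w) is Some (v, _) then v else 0%ZZ).
Proof.
move=> lj okword /andP[/eqP sw /allP wn].
have aw : all (fun i => i <= n)%N (permw word w).
  apply/allP => z /mapP[i iw ->]; apply: wn; apply: mem_nth; rewrite sw.
  by move: iw; rewrite (perm_mem okword) mem_iota.
have [e ok] := zevP j aw.
rewrite -(ell_zval ok) e /colv /wform at_fn /cidx [_.1]/= [_.2]/= inordK // wordI_pw //.
suff -> : map (pt w) [seq inord i | i <- word] = map (bv K m) (permw word w) by [].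
rewrite /permw -!map_comp; apply/eq_in_map => i; rewrite (perm_mem okword) mem_iota => lt.
by rewrite /pt /= inordK.
Qed.

Lemma colvZD (a : K) (u v : 'rV[K]_N) c : colv (a *: u + v) c = a * colv u c + colv v c.
Proof. by rewrite /colv /at_ !mxE. Qed.
Lemma colv0 c : colv (0 : 'rV[K]_N) c = 0. Proof. by rewrite /colv /at_ mxE. Qed.

Lemma fvalP bl w c : okbl bl -> okp n w -> okcol c ->
  zR K (fval m (expand bl w) c) = colv (wform w *m blocks_sym K bl) c.
Proof.
move=> okb okw'; case: c => [|j word] /andP[] //= lj okword.
rewrite -(expand_sum famP) //; last by case/andP: okw' => /eqP.
have : {in expand bl w, forall cw, okp n cw.2} by apply: (@expand_stable (fun w => okp n w)) => // x y w' _ _; apply: okp_swp.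
elim: (expand bl w) => [|[c w'] s IH] h /=; first by rewrite big_nil colv0 rmorph0.
rewrite big_cons colvZD -IH; last by move=> z zs; apply: h; rewrite inE zs orbT.
rewrite colv_fam ?(h _ (mem_head _ _)) //=.
case: (zev _ _ _) => [[v k]|]; last by rewrite rmorph0 mulr0 add0r.
by rewrite addrC -zRM -rmorphD.
Qed.
End Points.

Lemma fam_DI (K : numFieldType) w : (wform K v6 w <= DI K)%MS.
Proof.
apply/DIP => v [_ iv].
rewrite evf_pair; [|exact: gop_trilinear|exact: gop_skew v6_ok].
rewrite -(@feval_ext _ _ (@V6_op K)); last by move=> *; apply: V6_gop.
by rewrite iv (linear0 (@ell K v6)).
Qed.
Lemma fam_DC (K : numFieldType) m w : model_ok m -> (wform K m w <= DC K)%MS.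
Proof.
move=> mok; apply/DCP => v [_ iv].
rewrite evf_pair; [|exact: gop_trilinear|exact: gop_skew mok].
rewrite iv; [exact: (linear0 (@ell K m))|exact: gop_trilinear|exact: gop_skew mok|exact: gop_derivation mok].
Qed.

(** * Certificates for the rank of a symmetrized annihilator *)

(* Columns, relations and substitutions are written as decimal literals, read
   digit by digit; leading zeros count. *)
Fixpoint ddigits (u : Decimal.uint) : seq nat :=
  match u with
  | Decimal.Nil => [::]
  | Decimal.D0 u => 0 :: ddigits u | Decimal.D1 u => 1 :: ddigits u
  | Decimal.D2 u => 2 :: ddigits u | Decimal.D3 u => 3 :: ddigits u
  | Decimal.D4 u => 4 :: ddigits u | Decimal.D5 u => 5 :: ddigits u
  | Decimal.D6 u => 6 :: ddigits u | Decimal.D7 u => 7 :: ddigits u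
  | Decimal.D8 u => 8 :: ddigits u | Decimal.D9 u => 9 :: ddigits u
  end%N.
Definition digits (u : Number.uint) : seq nat := if u is Number.UIntDecimal d then ddigits d else [::].

(** A relation, its key being the number of the relation and the word of its
    variables, rewritten in normal forms. *)
Definition relterms (bl : bseq) (c : seq nat) : seq (bool * seq nat) :=
  if c is k :: w then
    pmap (fun t : bool * (nat * seq nat) => let: (s, (j, pt)) := t in
      if canonw bl (moves j) (permw pt w) is Some (s', w') then Some (s (+) s', j :: w') else None)
      (rels k)
  else [::].

Definition b2Z (s : bool) : Z := if s then (-1)%ZZ else 1%ZZ.
Definition entry (ts : seq (bool * seq nat)) (c : seq nat) : Z :=
  foldr (fun (t : bool * seq nat) acc => if eqw t.2 c then Z.add (b2Z t.1) acc else acc) 0%ZZ ts.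
Definition memw (c : seq nat) (cs : seq (seq nat)) : bool := has (eqw c) cs.
Lemma memwE c cs : memw c cs = (c \in cs).
Proof. by rewrite /memw; elim: cs => //= x s IH; rewrite inE eqwE IH. Qed.

(** For a Young subgroup with blocks c_bl (size, and true if antisymmetrized):
    c_S lists coordinates that determine a symmetrized functional killing the
    consequences, the other ones being eliminated by the relations c_piv, each
    with the coordinate it eliminates; c_Ep lists substitutions in V(6) whose
    values at the first coordinates of c_S are independent; c_B lists
    polynomials whose symmetrizations are identities of V(6); and c_W lists
    substitutions in V(10) at which these have independent values. *)
Record cert := Cert {
  c_bl : seq (nat * bool);
  c_piv : seq (Number.uint * Number.uint);
  c_S : seq Number.uint;
  c_Ep : seq Number.uint;
  c_B : seq (seq (Z * Number.uint));
  c_W : seq Number.uint }.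

Fixpoint mkblocks (st : nat) (l : seq (nat * bool)) : bseq :=
  if l is (k, eps) :: l' then (iota st k, eps) :: mkblocks (st + k)%N l' else [::].
Definition c_Ec (c : cert) : seq Number.uint := take (size (c_S c) - size (c_B c)) (c_S c).
Definition blocks (c : cert) : bseq := mkblocks 0 (c_bl c).

Definition check_cols (c : cert) : bool :=
  let bl := blocks c in
  let cols := map digits (c_S c) ++ map (fun x => digits x.2) (c_piv c) in
  [&& okbl bl, perm_eq (flatten (map fst bl)) (iota 0 7) &
  all (fun w => okw w && all (fun j => if canonw bl (moves j) w is Some (_, w') then memw (j :: w') cols else true) (iota 0 6))
      (genw 7 (map fst bl))].

Definition check_rel (c : cert) : bool :=
  let bl := blocks c in
  let S := map digits (c_S c) in
  let ec := map (fun x => digits x.2) (c_piv c) in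
  let rl := map (fun x => digits x.1) (c_piv c) in
  let tss := map (relterms bl) rl in
  [&& uniq ec, all (fun r => okw (behead r)) rl,
      all (all (fun t => memw t.2 S || memw t.2 ec)) tss &
      elim (size ec) (map (fun ts => map (fun k => modp (entry ts k)) ec) tss)].

Definition check_E (c : cert) : bool :=
  let bl := blocks c in
  let ec := map digits (c_Ec c) in
  let ps := map digits (c_Ep c) in
  [&& all okcol ec, all (okp 6) ps &
  elim (size ec) (map (fun w => let exl := expand bl w in map (fun k => modp (fval v6 exl k)) ec) ps)].

Definition bval (m : model) (exl : seq (Z * seq nat)) (b : seq (Z * Number.uint)) : Z :=
  foldr (fun (t : Z * Number.uint) acc => Z.add (Z.mul t.1 (fval m exl (digits t.2))) acc) 0%ZZ b.

Definition check_W (c : cert) : bool :=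
  let bl := blocks c in
  let ps := map digits (c_W c) in
  [&& all (all (fun t => okcol (digits t.2))) (c_B c), all (okp 10) ps,
      size (c_S c) == (size (c_Ec c) + size (c_B c))%N &
  elim (size (c_B c)) (map (fun w => let exl := expand bl w in map (fun b => modp (bval v10 exl b)) (c_B c)) ps)].

Section Soundness.
Variables (K : numFieldType).
Local Notation N := #|{: X}|.
Local Notation sg := (sign_of K).
Implicit Type c : cert.

Definition bvec (b : seq (Z * Number.uint)) : 'rV[K]_N := \sum_(t <- b) zR K t.1 *: dvec K (digits t.2).

Lemma bvalP m bl w b : okbl bl -> okp (mn m) w -> all (fun t => okcol (digits t.2)) b ->
  zR K (bval m (expand bl w) b) = (wform K m w *m blocks_sym K bl *m (bvec b)^T) 0 0.
Proof.
move=> okb okpw; rewrite /bvec; elim: b => [|t b IH] /=.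
  by rewrite big_nil trmx0 mulmx0 mxE rmorph0.
case/andP=> okt /IH e; rewrite big_cons linearD linearZ /= mulmxDr -scalemxAr mxE.
rewrite -e mxE dvecE -(fvalP K okb okpw okt).
by rewrite -zRM -rmorphD.
Qed.

Lemma elim_inj n (rows : seq (seq Z)) (x : 'cV[K]_n) :
  elim n (map (map modp) rows) -> all (fun r => size r == n) rows ->
  (forall r, r \in rows -> \sum_(j < n) zR K (nth 0%ZZ r j) * x j 0 = 0) -> x = 0.
Proof.
move=> el sz h; have := elim_rank K el sz; set M := \matrix_(i, j) _ => rM.
have Mx : M *m x = 0.
  apply/matrixP => i k; rewrite !mxE (ord1 k).
  rewrite -[RHS](h (nth [::] rows i)) ?mem_nth //; apply: eq_bigr => j _.
  by rewrite mxE.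
have rf : row_free M^T by rewrite /row_free mxrank_tr rM.
apply: trmx_inj; apply/eqP; rewrite trmx0 -(mulmx_free_eq0 _ rf) -trmx_mul Mx trmx0.
by [].
Qed.

Section OneBlockSystem.
Variable c : cert.
Local Notation bl := (blocks c).
Local Notation e := (blocks_sym K bl).

Lemma eB_block (u : 'rV[K]_N) (D : 'M[K]_N) lab eps x y j w : okbl bl -> (u <= D *m e)%MS ->
  (lab, eps) \in bl -> x \in lab -> y \in lab -> x != y -> okw w ->
  colv u (j :: map (swl x y) w) = sg eps * colv u (j :: w).
Proof.
move=> okb /submxP[v ->] bin xl yl xy ok.
have lx : (x < 7)%N := okbl_lt okb bin xl. have ly : (y < 7)%N := okbl_lt okb bin yl.
have := eB_tp K okb bin xl yl xy; set D' := v *m _ => h.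
have e1 : D' *m tp K x y = sg eps *: D' by rewrite /D' !mulmxA -!mulmxA h -!scalemxAr.
rewrite /colv /cidx [head _ _]/= [behead _]/= pw_swl //.
have := congr1 (fun M : 'rV[K]_N => at_ M (inord j : 'I_6, (pw w * tperm (inord x) (inord y))%g)) e1.
rewrite /at_ at_R [_.1]/= [_.2]/= tpermV -mulgA tperm2 mulg1 mxE => ->.
by rewrite [in RHS]mxE mulrA sgK mul1r.
Qed.

Lemma entry_sum (u : 'rV[K]_N) (S ec : seq (seq nat)) ts : uniq ec ->
  {in S, forall k, colv u k = 0} -> all (fun t => memw t.2 S || memw t.2 ec) ts ->
  \sum_(k <- ec) zR K (entry ts k) * colv u k = \sum_(t <- ts) sg t.1 * colv u t.2.
Proof.
move=> uec uS; elim: ts => [|t ts IH] /=.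
  by rewrite big_nil big1 // => k _; rewrite rmorph0 mul0r.
case/andP; rewrite !memwE => tin /IH{}IH; rewrite big_cons -IH.
transitivity (\sum_(k <- ec) ((if t.2 == k then sg t.1 * colv u t.2 else 0) + zR K (entry ts k) * colv u k)).
  apply: eq_bigr => k _; rewrite eqwE; case: eqP => [<-|_]; last by rewrite add0r.
  rewrite -[Z.add _ _]/(b2Z t.1 + entry ts t.2) rmorphD mulrDl; congr (_ * _ + _).
  by rewrite /sign_of /b2Z; case: t.1.
rewrite big_split; congr (_ + _) => /=.
have [kin|kn] := boolP (t.2 \in ec).
  rewrite (bigD1_seq t.2) //= eqxx big1 ?addr0 // => k nk.
  by rewrite eq_sym (negbTE nk).
move: tin; rewrite (negbTE kn) orbF => /uS->; by rewrite mulr0 big1 // => k _; rewrite if_same.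
Qed.

(** A functional in the symmetrized annihilator takes the same values, up to
    sign, on all words with the same normal form, so the coordinates of cols
    determine it. The relations express those of c_piv by those of c_S. *)
Lemma upper_rank : check_cols c -> check_rel c -> (\rank (DC K *m e) <= size (c_S c))%N.
Proof.
case/and3P=> okb pfl /allP cols /and4P[uec /allP rlok /allP tok el].
rewrite -(size_map digits); apply: rank_le_cols => u uY uS.
have uD : (u <= DC K)%MS by apply: submx_trans uY (eB_stable _ (@DC_stable K)).
have fsw := fun j lab eps x y w => @eB_block u (DC K) lab eps x y j w okb uY.
have mv j : (j < 6)%N -> {in moves j, forall m, okw m /\
    forall w, okw w -> colv u (j :: permw m w) = - colv u (j :: w)}.
  by move=> lj m min; split=> [|w]; [exact: moves_ok min|exact: DC_move].
have cw j w (lj : (j < 6)%N) := @canonwP K (fun w => colv u (j :: w)) bl okb (fsw j) (moves j) w (mv j lj).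
set ec := map (fun x => digits x.2) (c_piv c) in uec tok el cols.
have ec0 : {in ec, forall k, colv u k = 0}.
  pose x := \col_(i < size ec) colv u (nth [::] ec i).
  suff x0 : x = 0.
    move=> k kin; have lt : (index k ec < size ec)%N by rewrite index_mem.
    by have := congr1 (fun M : 'cV_ _ => M (Ordinal lt) 0) x0; rewrite !mxE /= nth_index.
  pose rows := map (fun r => map (entry (relterms bl r)) ec) (map (fun x => digits x.1) (c_piv c)).
  apply: (@elim_inj _ rows); last 1 first.
  - move=> _ /mapP[r rin ->]; have tr := tok _ (map_f (relterms bl) rin).
    have okr := rlok _ rin.
    have sum0 : \sum_(t <- relterms bl r) sg t.1 * colv u t.2 = 0.
      case: r {rin tr} okr => [|k w]; first by rewrite big_nil.
      move=> okr; rewrite -[RHS](DC_rel k uD okr) /relterms.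
      have := rels_ok k; elim: (rels k) => [|[s [j pt0]] ts IH]; first by rewrite !big_nil.
      move=> /andP[/andP[lj okpt] /IH{}IH]; rewrite [pmap _ _]/=.
      have := cw j (permw pt0 w) lj (okw_permw okpt okr).
      case: (canonw _ _ _) => [[s' w']|] h; rewrite !big_cons -IH /=.
        by case: h => _ ->; rewrite mulrA -signr_addb.
      by rewrite h mulr0 add0r.
    transitivity (\sum_(k <- ec) zR K (entry (relterms bl r) k) * colv u k); last by rewrite (entry_sum uec uS tr).
    rewrite [RHS](big_nth ([::] : seq nat)) big_mkord; apply: eq_bigr => j _.
    by rewrite mxE (nth_map ([::] : seq nat)).
  - suff -> : map (map modp) rows = map (fun ts => map (fun k => modp (entry ts k)) ec)
        (map (relterms bl) (map (fun x => digits x.1) (c_piv c))) by [].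
    by rewrite /rows -!map_comp; apply: eq_map => z /=; rewrite -map_comp.
  - by apply/allP => _ /mapP[r _ ->]; rewrite size_map.
apply: at_ext => -[j s]; rewrite /at_ mxE.
have cv w : okw w -> w \in genw 7 (map fst bl) -> forall j, (j < 6)%N -> colv u (j :: w) = 0.
  move=> okw' win k lk; have /andP[_ /allP] := cols _ win; move=> /(_ k); rewrite mem_iota => /(_ lk).
  have := cw k w lk okw'; case: (canonw _ _ _) => [[s' w']|//] [_ ->].
  rewrite memwE mem_cat => /orP[/uS->|/ec0->]; by rewrite mulr0.
have -> : u 0 (enum_rank (j, s)) = colv u (val j :: [::] ++ word s).
  rewrite /colv /at_ /cidx /= pw_word; congr (u 0 (enum_rank (_, _))).
  by apply: val_inj; rewrite /= inordK.
apply: (@genwP K (fun w => colv u (val j :: w)) bl okb (fsw j) 7 (map fst bl) [::]).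
- move=> l /mapP[[lab eps] bin ->]; by exists lab, eps; split.
- exact: okw_word.
- by rewrite (perm_trans (okw_word s)) // perm_sym.
- by rewrite okw_size // okw_word.
- by move=> w win; have /andP[okww _] := cols _ win; exact: (cv w okww win j (ltn_ord j)).
Qed.

Lemma lower_rank_I : okbl bl -> check_E c -> (size (c_Ec c) <= \rank (DI K *m e))%N.
Proof.
move=> okb /and3P[/allP okc /allP okps el].
set ec := map digits (c_Ec c) in okc el; set ps := map digits (c_Ep c) in okps el.
pose rows := map (fun w => map (fval v6 (expand bl w)) ec) ps.
have er : map (map modp) rows = map (fun w => let exl := expand bl w in map (fun k => modp (fval v6 exl k)) ec) ps.
  by rewrite /rows -map_comp; apply: eq_map => z /=; rewrite -map_comp.
rewrite -er in el; have := elim_rank K el; rewrite size_map => <-; last first.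
  by apply/allP => _ /mapP[r _ ->]; rewrite !size_map.
have sz : size rows = size (map (fun w => wform K v6 w *m e) ps) by rewrite !size_map.
move: (el) => _; rewrite sz.
apply: (@rank_ge_cols _ _ _ _ ec); last 1 first.
- move=> i k; rewrite mxE; have li : (i < size ps)%N by rewrite -(size_map (fun w => wform K v6 w *m e)) ltn_ord.
  have lk : (k < size ec)%N by rewrite size_map ltn_ord.
  rewrite (nth_map [::]) // (nth_map [::]) // (nth_map [::]) //.
  by apply: fvalP => //; [apply: okps|apply: okc]; rewrite mem_nth.
- by move=> _ /mapP[w _ ->]; apply: submxMr; apply: fam_DI.
- by rewrite size_map.
Qed.

(** The coordinates in c_S bound the rank for consequences from above. The values
    in V(6) bound the rank for identities from below. The identities in c_B are
    killed by the functionals of the second kind but, by the values in V(10),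
    are independent on those of the first kind. As the numbers add up, all these
    bounds are equalities. *)
Lemma cert_rank : check_cols c -> check_rel c -> check_E c -> check_W c ->
  (forall k, (k < size (c_B c))%N -> identities7 (Phi (bvec (nth [::] (c_B c) k) *m e))) ->
  \rank (DC K *m e) = (\rank (DI K *m e) + size (c_B c))%N.
Proof.
move=> h1 h2 h3 /and4P[/(all_nthP [::]) okB /allP okW /eqP sz el] idB.
have okb : okbl bl by case/and3P: h1.
have le1 := upper_rank h1 h2; have le2 := lower_rank_I okb h3.
apply/eqP; rewrite eqn_leq; apply/andP; split.
  by rewrite (leq_trans le1) // sz leq_add2r.
pose B := c_B c; pose Bm : 'M[K]_(N, size B) := (\matrix_(k < size B) bvec (nth [::] B k))^T.
rewrite -(mxrank_mul_ker (DC K *m e) Bm) addnC leq_add //; last first.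
  apply: mxrankS; rewrite sub_capmx submxMr ?DI_DC //; apply/sub_kermxP.
  apply/matrixP => i k; rewrite [RHS]mxE.
    have /DIP/(_ _ (idB _ (ltn_ord k))) : (row i (DI K) <= DI K)%MS by apply: row_sub.
  have [_ es] := eB_abs K okb; rewrite trmx_mul es mulmxA -row_mul => <-.
  by rewrite !mxE; apply: eq_bigr => l _; rewrite !mxE.
set ps := map digits (c_W c) in okW el.
pose rows := map (fun w => map (bval v10 (expand bl w)) B) ps.
have er : map (map modp) rows = map (fun w => let exl := expand bl w in map (fun b => modp (bval v10 exl b)) (c_B c)) ps.
  by rewrite /rows -map_comp; apply: eq_map => z /=; rewrite -map_comp.
rewrite -er in el; have al : all (fun r => size r == size (c_B c)) rows.
  by apply/allP => _ /mapP[r _ ->]; rewrite size_map.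
apply: leq_trans (eq_leq (esym (elim_rank K el al))) _.
rewrite [X in (\rank X <= _)%N](_ : _ = (\matrix_(i < size rows) (wform K v10 (nth [::] ps i) *m e)) *m Bm).
  apply: mxrankS; apply: submxMr; apply/row_subP => i; rewrite rowK.
  by apply: submxMr; apply: fam_DC; exact: v10_ok.
apply/matrixP => i k; rewrite mxE; have li : (i < size ps)%N by rewrite -(size_map (fun w => map (bval v10 (expand bl w)) B)) ltn_ord.
rewrite (nth_map [::]) // (nth_map [::]) //.
rewrite (@bvalP v10) //; [|by apply: okW; rewrite mem_nth|by apply: okB].
by rewrite !mxE; apply: eq_bigr => l _; rewrite !mxE.
Qed.
End OneBlockSystem.
End Soundness.

(** * Derivations of multilinear polynomials, and sorted substitutions *)

Section Upd.
Variables (n : nat) (V : Type).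
Definition upd (rho : 'I_n -> V) i v := fun j => if j == i then v else rho j.
Lemma upd_same rho i : upd rho i (rho i) = rho.
Proof. by apply: funext => j; rewrite /upd; case: eqP => [->|]. Qed.
Lemma upd_upd rho i u v : upd (upd rho i u) i v = upd rho i v.
Proof. by apply: funext => j; rewrite /upd; case: eqP. Qed.
End Upd.

Section TreeDerivation.
Variables (K : numFieldType) (V : lmodType K) (o : V -> V -> V -> V) (n : nat).
Hypotheses (o_lin : trilinear o) (o_skew : skew_symmetric o).
Implicit Types (t : mon n) (rho : 'I_n -> V).

Lemma meval_notin rho i v t : i \notin leaves t -> meval o (upd rho i v) t = meval o rho t.
Proof.
elim: t => [j|a IHa b IHb c IHc] /=; first by rewrite inE /upd eq_sym => /negbTE->.
by rewrite !mem_cat !negb_or => /and3P[/IHa-> /IHb-> /IHc->].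
Qed.

Lemma meval_lin rho i k u v t : uniq (leaves t) -> i \in leaves t ->
  meval o (upd rho i (k *: u + v)) t = k *: meval o (upd rho i u) t + meval o (upd rho i v) t.
Proof.
have [l1 l2 l3] := o_lin.
elim: t => [j|a IHa b IHb c IHc] /=; first by rewrite inE /upd eq_sym => _ ->.
rewrite !cat_uniq has_cat negb_or => /and3P[ua /andP[ab ac] /and3P[ub bc uc]].
have nin (s1 s2 : seq 'I_n) x : ~~ has [in s1] s2 -> x \in s2 -> x \notin s1.
  by move=> h xs; apply: contra h => xs1; apply/hasP; exists x.
have nin' (s1 s2 : seq 'I_n) x : ~~ has [in s1] s2 -> x \in s1 -> x \notin s2.
  by move=> h xs; apply: contra h => xs1; apply/hasP; exists x.
rewrite !mem_cat => /or3P[ia|ib|ic].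
- have nb := nin' _ _ _ ab ia; have nc := nin' _ _ _ ac ia.
  by rewrite IHa // !(meval_notin _ _ nb) !(meval_notin _ _ nc) l1.
- have na := nin _ _ _ ab ib; have nc := nin' _ _ _ bc ib.
  by rewrite IHb // !(meval_notin _ _ na) !(meval_notin _ _ nc) l2.
- have na := nin _ _ _ ac ic; have nb := nin _ _ _ bc ic.
  by rewrite IHc // !(meval_notin _ _ na) !(meval_notin _ _ nb) l3.
Qed.

Lemma o_suml (I : eqType) (r : seq I) F y z : o (\sum_(i <- r) F i) y z = \sum_(i <- r) o (F i) y z.
Proof.
elim: r => [|i r IH]; first by rewrite !big_nil; case: (o0 o_lin y z).
by rewrite !big_cons (oDl o_lin) IH.
Qed.
Lemma o_sumr (I : eqType) (r : seq I) F y z : o y z (\sum_(i <- r) F i) = \sum_(i <- r) o y z (F i).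
Proof.
elim: r => [|i r IH]; first by rewrite !big_nil; case: (o0 o_lin y z).
by rewrite !big_cons (oDr o_lin) IH.
Qed.
Lemma o_summ (I : eqType) (r : seq I) F y z : o y (\sum_(i <- r) F i) z = \sum_(i <- r) o y (F i) z.
Proof.
rewrite (oS o_skew) o_suml -sumrN; apply: eq_bigr => i _.
by rewrite (oS o_skew y).
Qed.

Variable D : V -> V.
Hypothesis D_der : forall x y z, D (o x y z) = o (D x) y z + o x (D y) z + o x y (D z).

(** An operator that is a derivation of the product acts on the value of a tree
    by the Leibniz rule over its leaves. *)
Lemma meval_der rho t : uniq (leaves t) ->
  D (meval o rho t) = \sum_(i <- leaves t) meval o (upd rho i (D (rho i))) t.
Proof.
elim: t => [j|a IHa b IHb c IHc] /=; first by rewrite big_seq1 /upd eqxx.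
rewrite !cat_uniq has_cat negb_or => /and3P[ua /andP[ab ac] /and3P[ub bc uc]].
have nin (s1 s2 : seq 'I_n) x : ~~ has [in s1] s2 -> x \in s2 -> x \notin s1.
  by move=> h xs; apply: contra h => xs1; apply/hasP; exists x.
have nin' (s1 s2 : seq 'I_n) x : ~~ has [in s1] s2 -> x \in s1 -> x \notin s2.
  by move=> h xs; apply: contra h => xs1; apply/hasP; exists x.
rewrite D_der IHa // IHb // IHc // o_suml o_summ o_sumr !big_cat /= addrA.
congr (_ + _ + _); rewrite !big_seq; apply: eq_bigr => i ii.
- by rewrite (meval_notin _ _ (nin' _ _ _ ab ii)) (meval_notin _ _ (nin' _ _ _ ac ii)).
- by rewrite (meval_notin _ _ (nin _ _ _ ab ii)) (meval_notin _ _ (nin' _ _ _ bc ii)).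
- by rewrite (meval_notin _ _ (nin _ _ _ ac ii)) (meval_notin _ _ (nin _ _ _ bc ii)).
Qed.
End TreeDerivation.

Section FevalDer.
Variables (K : numFieldType) (V : lmodType K) (o : V -> V -> V -> V).
Hypotheses (o_lin : trilinear o) (o_skew : skew_symmetric o).
Variable f : freeskew K 7.
Hypothesis ml : multilinear f.
Local Notation G rho := (feval o rho f).

Lemma ml_supp (t : nmon 7) : t \in msupp f -> uniq (leaves t) /\ forall i, i \in leaves t.
Proof.
move/(allP ml) => p; rewrite (perm_uniq p) enum_uniq; split=> // i.
by rewrite (perm_mem p) mem_enum.
Qed.

Lemma feval_upd rho i k u v :
  G (upd rho i (k *: u + v)) = k *: G (upd rho i u) + G (upd rho i v).
Proof.
rewrite /feval /lext scaler_sumr -big_split !big_seq; apply: eq_bigr => t /ml_supp[ut it] /=.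
by rewrite (meval_lin o_lin) // scalerDr !scalerA mulrC.
Qed.

Lemma feval_der (D : {linear V -> V}) rho :
  (forall x y z, D (o x y z) = o (D x) y z + o x (D y) z + o x y (D z)) ->
  D (G rho) = \sum_i G (upd rho i (D (rho i))).
Proof.
move=> der; rewrite /feval /lext linear_sum exchange_big big_seq [RHS]big_seq.
apply: eq_bigr => t ts; have [ut it] := ml_supp ts.
rewrite linearZ /= (meval_der o_lin o_skew der) // -scaler_sumr; congr (_ *: _).
by rewrite (perm_big _ (allP ml _ ts)) big_enum.
Qed.
End FevalDer.

Lemma perm_swap_ind (T : eqType) (P : seq T -> Prop) :
  (forall s1 x y s2, P (s1 ++ x :: y :: s2) -> P (s1 ++ y :: x :: s2)) ->
  forall s t, perm_eq s t -> P s -> P t.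
Proof.
move=> sw s t p; suff main (pre : seq T) : P (pre ++ s) -> P (pre ++ t) by apply: (main [::]).
elim: s t p pre => [|x s IH] t p pre; first by move: p; rewrite perm_sym => /perm_nilP->.
have xt : x \in t by rewrite -(perm_mem p) mem_head.
case/splitPr: xt p => t1 t2; rewrite -(cat1s x t2) perm_sym perm_catCA /= perm_cons perm_sym => p.
rewrite -cat_rcons => /(IH _ p); rewrite cat_rcons.
elim: t1 {p} pre => [//|y t1 IH1] pre h.
by have := IH1 (rcons pre y); rewrite !cat_rcons; apply; apply: sw.
Qed.

Fixpoint ndec (k : nat) (strict : bool) (lo : nat) : seq (seq nat) :=
  if k is k'.+1 then
    flatten (map (fun x => map (cons x) (ndec k' strict (if strict then x.+1 else x)))
       (iota lo (7 - lo)))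
  else [:: [::]].
Fixpoint idp (l : seq (nat * bool)) : seq (seq nat) :=
  if l is (k, eps) :: l' then
    let tl := idp l' in
    flatten (map (fun a => map (fun b => a ++ b) tl) (ndec k eps 0))
  else [:: [::]].
(** The substitutions needed to test an identity with block symmetries: v_6 for
    the first variable, weights sorted in each block, and the value a multiple of
    v_6, since each of the three products lowers the sum of the indices by 6. *)
Definition idpoints (l : seq (nat * bool)) : seq (seq nat) :=
  filter (fun w => Nat.eqb (sumn w) 18)
    (if l is (k, eps) :: l' then map (cons 0%N) (idp ((k.-1, eps) :: l')) else [::]).

Definition ltb (strict : bool) : rel nat := fun x y => if strict then (x < y)%N else (x <= y)%N.
Lemma ndecP k (strict : bool) lo a : size a = k -> sorted (ltb strict) a ->
  all (fun i => (lo <= i) && (i <= 6))%N a -> a \in ndec k strict lo.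
Proof.
elim: k lo a => [|k IH] lo a; first by move/size0nil->.
case: a => // x a [sa] so /= /andP[/andP[l1 l2] al].
apply/flattenP; exists (map (cons x) (ndec k strict (if strict then x.+1 else x))).
  by apply/mapP; exists x => //; rewrite mem_iota l1 /=; lia.
rewrite map_f // IH //; first by apply: path_sorted so.
have tr : transitive (ltb strict) by rewrite /ltb; case: (strict) => x1 x2 x3; [apply: ltn_trans|apply: leq_trans].
have := order_path_min tr so => /allP h.
apply/allP => i ia; have := h i ia; have /andP[_ ->] := allP al i ia; rewrite andbT.
by rewrite /ltb; case: (strict).
Qed.

Lemma swp_adj s u v t : size (s ++ u :: v :: t) = 7 ->
  swp (size s) (size s).+1 (s ++ u :: v :: t) = s ++ v :: u :: t.
Proof.
move=> sz; apply: (@eq_from_nth _ 0%N); rewrite size_swp -?sz ?size_cat //= => i lt.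
rewrite size_cat /= in sz; rewrite /swp /permw -map_comp (nth_map 0%N) ?size_iota ?nth_iota //= ?add0n; try lia.
rewrite /swl !nth_cat.
case: Nat.eqb_spec => [->|n1]; first by rewrite ltnn subnn ltnNge leqnSn /= subSnn.
case: Nat.eqb_spec => [->|n2]; first by rewrite ltnn subnn ltnNge leqnSn /= subSnn.
case: ltnP => // le; have -> : (i - size s = (i - size s - 2).+2)%N by lia.
by [].
Qed.

Section Sorting.
Variables (K : numFieldType) (bl : bseq) (q : seq nat -> K).
Local Notation sg := (sign_of K).
Hypothesis okb : okbl bl.
Hypothesis qsw : forall lab eps x y w, (lab, eps) \in bl -> x \in lab -> y \in lab -> x != y ->
  size w = 7 -> q (swp x y w) = sg eps * q w.
(* The condition on the sum of the indices is preserved by sorting. *)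
Definition zq w := sumn w = 18 -> q w = 0.


(** Adjacent exchanges inside a block multiply q by a sign and sort the block; a
    repeated index in an antisymmetrized block makes q vanish. *)
Lemma sort_block lab (eps : bool) k pre a post : (lab, eps) \in bl ->
  {subset iota (size pre) k <= lab} -> size a = k -> size (pre ++ a ++ post) = 7 ->
  all (fun i => i <= 6)%N a ->
  (forall a', a' \in ndec k eps 0 -> all (fun i => i <= 6)%N a' -> size a' = k -> zq (pre ++ a' ++ post)) ->
  zq (pre ++ a ++ post).
Proof.
move=> bin sub sa s7 a6 h.
pose P a := size a = k -> zq (pre ++ a ++ post).
suff : P (sort leq a).
  move/(perm_swap_ind (P := P)) => /(_ _ a) /=; apply=> //; last by rewrite perm_sort.
  move=> s1 x y s2 IH ss; have {}IH : zq (pre ++ (s1 ++ x :: y :: s2) ++ post) by apply: IH; rewrite -ss !size_cat.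
  have szp : size ((pre ++ s1) ++ x :: y :: s2 ++ post) = 7.
    by move: s7; rewrite !size_cat sa -ss !size_cat /= !size_cat; lia.
  have e : pre ++ (s1 ++ y :: x :: s2) ++ post = swp (size (pre ++ s1)) (size (pre ++ s1)).+1 (pre ++ (s1 ++ x :: y :: s2) ++ post).
    have cc u v : pre ++ (s1 ++ u :: v :: s2) ++ post = (pre ++ s1) ++ u :: v :: (s2 ++ post) by rewrite -!catA.
    by rewrite !cc swp_adj.
  move=> sm; rewrite e (qsw bin) ?IH ?mulr0 //.
  - by move: sm; rewrite !sumn_cat /=; lia.
  - by apply: sub; rewrite mem_iota size_cat -ss !size_cat /=; lia.
  - by apply: sub; rewrite mem_iota size_cat -ss !size_cat /=; lia.
  - by rewrite neq_ltn ltnSn.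
  - by rewrite -szp -!catA.
move=> ss; have so : sorted leq (sort leq a) by apply: sort_sorted; apply: leq_total.
have s6 : all (fun i => i <= 6)%N (sort leq a) by rewrite all_sort.
case: (boolP (sorted (ltb eps) (sort leq a))) => [so'|nso].
  by apply: h => //; apply: ndecP => //.
case: eps nso h bin => [|/negP []//] nso _ bin.
have [i [lt e]] : exists i, (i.+1 < k)%N /\ nth 0%N (sort leq a) i = nth 0%N (sort leq a) i.+1.
  apply: contrapT => ne; move/negP: nso; apply; apply/(sortedP 0%N) => i; rewrite ss => lt.
  have /(sortedP 0%N) /(_ i) := so; rewrite ss => /(_ lt); rewrite leq_eqVlt => /orP[/eqP e|//].
  by case: ne; exists i.
move=> _; pose x := (size pre + i)%N.
have s7' : size (pre ++ sort leq a ++ post) = 7 by rewrite -s7 !size_cat size_sort.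
have nx j : (j < k)%N -> nth 0%N (pre ++ sort leq a ++ post) (size pre + j)%N = nth 0%N (sort leq a) j.
  by move=> lj; rewrite nth_cat ltnNge leq_addr /= addKn nth_cat ss lj.
have := qsw bin (x := x) (y := x.+1) (w := pre ++ sort leq a ++ post).
rewrite swp_id //; first last.
- by rewrite /x -addnS !nx // ltnW.
- by rewrite /x; move: s7'; rewrite !size_cat size_sort sa; lia.
- by rewrite /x; move: s7'; rewrite !size_cat size_sort sa; lia.
move=> H; have : q (pre ++ sort leq a ++ post) = sg true * q (pre ++ sort leq a ++ post).
  apply: H => //; last by rewrite neq_ltn ltnSn.
  - by apply: sub; rewrite mem_iota /x; lia.
  - by apply: sub; rewrite mem_iota /x; lia.
rewrite /sign_of expr1 mulN1r => /eqP; rewrite -addr_eq0 -mulr2n -mulr_natl mulf_eq0 pnatr_eq0 /=.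
by move/eqP.
Qed.

Lemma sort_all l pre v : {subset mkblocks (size pre) l <= bl} ->
  size (pre ++ v) = 7 -> size v = sumn (map fst l) -> all (fun i => i <= 6)%N v ->
  (forall b, b \in idp l -> zq (pre ++ b)) -> zq (pre ++ v).
Proof.
elim: l pre v => [|[k eps] l IH] pre v sub s7 sv v6 h /=.
  by move: sv => /= /size0nil->; apply: h; rewrite mem_head.
rewrite /= in sv sub.
rewrite -[v](cat_take_drop k) in s7 v6 *; move: v6; rewrite all_cat => /andP[t6 d6].
have st : size (take k v) = k by rewrite size_takel // sv leq_addr.
have sd : size (drop k v) = sumn (map fst l) by rewrite size_drop sv addKn.
apply: (@sort_block (iota (size pre) k) eps k) => //; first by apply: sub; rewrite mem_head.
move=> a' ain a6 sa'; rewrite catA; apply: IH => //.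
- by move=> b bin; apply: sub; rewrite inE; move: bin; rewrite size_cat sa' => ->; rewrite orbT.
- by rewrite -s7 !size_cat sa' st addnA.
- move=> b bin; rewrite -catA; apply: h => /=; apply/flattenP.
  by exists (map (fun b => a' ++ b) (idp l)); [apply/mapP; exists a'|apply: map_f].
Qed.

Lemma sort_idpoints l v : bl = mkblocks 0 l -> sumn (map fst l) = 7 -> (0 < (head (0%N, true) l).1)%N ->
  size v = 6 -> all (fun i => i <= 6)%N v ->
  (forall w, w \in idpoints l -> q w = 0) -> zq (0%N :: v).
Proof.
case: l => // [[[|k] eps] l] // ebl /= suml _ sv v6 h.
have {}h b : b \in idp ((k, eps) :: l) -> zq (0%N :: b).
  by move=> bin sm; apply: h; rewrite mem_filter map_f // andbT sm.
have bin : (iota 0 k.+1, eps) \in bl by rewrite ebl /= mem_head.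
rewrite -[v](cat_take_drop k) -[_ :: _]/([:: 0%N] ++ (take k v ++ drop k v)).
have st : size (take k v) = k by rewrite size_takel //; lia.
have sd : size (drop k v) = sumn (map fst l) by rewrite size_drop; lia.
move: v6; rewrite -{1}[v](cat_take_drop k) all_cat => /andP[t6 d6].
apply: (@sort_block (iota 0 k.+1) eps k) => //.
- by move=> i; rewrite !mem_iota /=; lia.
- by rewrite /= cat_take_drop sv.
move=> a' ain a6 sa'; rewrite catA; apply: sort_all => //.
- by move=> b bb; rewrite ebl inE; move: bb; rewrite size_cat sa' /= add1n add0n => ->; rewrite orbT.
- by rewrite !size_cat /= sa' sd; lia.
- exact: sd.
move=> b bb; apply: h => /=; apply/flattenP.
by exists (map (fun b => a' ++ b) (idp l)); [apply/mapP; exists a'|apply: map_f].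
Qed.
End Sorting.

(** * Reduction of an identity to highest weight values *)

Section Ident.
Variables (K : numFieldType) (l : seq (nat * bool)) (f : freeskew K 7).
Local Notation bl := (mkblocks 0 l).
Local Notation sg := (sign_of K).
Local Notation V := 'rV[K]_(mn v6).+1.
Local Notation o := (@gop K v6).
Local Notation G rho := (feval o rho f).
Local Notation z := (zR K).
Hypotheses (ml : multilinear f) (okb : okbl bl) (suml : sumn (map fst l) = 7)
  (pos : (0 < (head (0%N, true) l).1)%N).
Hypothesis fsw : forall lab eps x y, (lab, eps) \in bl -> x \in lab -> y \in lab -> x != y ->
  perm_vars (tperm (inord x) (inord y)) f = sg eps *: f.
Hypothesis base : forall w, w \in idpoints l -> ell (G (pt K v6 w)) = 0.
Let o_lin := gop_trilinear K v6.
Let o_skew := gop_skew (K := K) v6_ok.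

Implicit Type a : 'I_7 -> nat.
Definition bw a : 'I_7 -> V := fun i => bv K v6 (a i).
Definition updn a i k : 'I_7 -> nat := upd a i k.

Lemma upd_bw a i k : upd (bw a) i (bv K v6 k) = bw (updn a i k).
Proof. by apply: funext => j; rewrite /upd /bw /updn /upd; case: eqP. Qed.

Lemma GZ rho i c v : G (upd rho i (c *: v)) = c *: G (upd rho i v).
Proof.
have h := feval_upd o_lin ml rho i.
have g0 : G (upd rho i 0) = 0.
  by have := h (-1) 0 0; rewrite scaler0 addr0 scaleN1r addNr.
by have := h c v 0; rewrite g0 !addr0.
Qed.

Lemma G_der c s a : der_at (mxT K v6 c s) -> inrange v6 c s -> (forall i, (a i <= 6)%N) ->
  G (bw a) *m mxT K v6 c s = \sum_i z (c (a i)) *: G (bw (updn a i (s (a i)))).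
Proof.
move=> der rg a6.
have := feval_der o_lin o_skew ml (D := mulmxr (mxT K v6 c s)) (bw a) (fun x y w => gop_equiv x y w der).
rewrite /= => ->; apply: eq_bigr => i _.
have e : bw a i *m mxT K v6 c s = z (c (a i)) *: bv K v6 (s (a i)).
  by apply: bv_mxT; [apply: a6|apply: rg; apply: a6].
by rewrite e GZ upd_bw.
Qed.

Lemma inE6 : inrange v6 (cE v6) predn. Proof. by move=> i; apply: inE_. Qed.
Lemma inF6 : inrange v6 (cF v6) S. Proof. by move=> i; apply: inF_. Qed.
Lemma inH6 : inrange v6 (cH v6) id. Proof. by move=> i; apply: inH_. Qed.

(** Equivariance under H: the value has the sum of the weights of the
    arguments. *)
Lemma weight a : (forall i, (a i <= 6)%N) -> forall k : 'I_7, G (bw a) 0 k != 0 -> \sum_i a i = (18 + k)%N.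
Proof.
move=> a6 k nz.
have := G_der (der_H (K := K) v6_ok) inH6 a6.
have -> : \sum_i z (cH v6 (a i)) *: G (bw (updn a i (a i))) = (\sum_i z (cH v6 (a i))) *: G (bw a).
  rewrite scaler_suml; apply: eq_bigr => i _; congr (_ *: _).
  by rewrite -upd_bw upd_same.
move=> /(congr1 (fun M : 'rV_7 => M 0 k)); rewrite [RHS]mxE mxE (bigD1 k) //= big1 => [|j nj].
  rewrite mxE eqxx addr0 mulrC => /(mulIf nz).
  rewrite -(rmorph_sum z) => /zR_inj.
  have -> : \sum_i cH v6 (a i) = Z.sub 42 (Z.mul 2 (Z.of_nat (\sum_i a i))).
    rewrite !big_ord_recl !big_ord0 /cH [mn v6]/=.
    lia.
  by rewrite /cH -[mn v6]/6%N; move: (\sum_i a i) (nat_of_ord k) => s k1; lia.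
by rewrite mxE val_eqE eq_sym (negbTE nj) mulr0n mulr0.
Qed.

Definition pos0 : 'I_7 := inord 0.

(* The basic case: the value is a multiple of v_6, and the tested substitutions
   are representatives under the symmetries of f. *)
Lemma top_zero a : (forall i, (a i <= 6)%N) -> a pos0 = 0%N -> \sum_i a i = 18 -> G (bw a) = 0.
Proof.
move=> a6 a0 s18.
pose w := [seq a i | i <- enum 'I_7].
have nw (i : 'I_7) : nth 0%N w i = a i by rewrite (nth_map i) ?size_enum_ord // nth_ord_enum.
have epw : bw a = pt K v6 w by apply: funext => i; rewrite /bw /pt nw.
have sw : size w = 7 by rewrite size_map size_enum_ord.
have ell0 : ell (G (pt K v6 w)) = 0.
  have w0 : w = 0%N :: behead w.
    apply: (@eq_from_nth _ 0%N); first by rewrite /= size_behead sw.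
    case=> [|i] lt; last by rewrite /= nth_behead.
    by have := nw pos0; rewrite a0 /pos0 inordK.
  have w6 : all (fun i => i <= 6)%N w by apply/allP => _ /mapP[i _ ->]; apply: a6.
  rewrite w0; apply: (@sort_idpoints K bl (fun w => ell (G (pt K v6 w))) okb _ l) => //.
  - move=> lab eps x y w1 bin xl yl xy s1.
    have lx := okbl_lt okb bin xl; have ly := okbl_lt okb bin yl.
    have <- : G (fun i => pt K v6 w1 (tperm (inord x) (inord y) i)) = G (pt K v6 (swp x y w1)).
      congr (feval _ _ _); apply: funext => i; rewrite /pt -swlE // /swp /permw -map_comp.
      by rewrite (nth_map 0%N) ?size_iota // nth_iota.
    rewrite -(feval_perm o_lin o_skew) (fsw bin xl yl xy).
    rewrite -[_ *: f]addr0 (feval_linear o) /= [feval _ _ 0](linear0 (feval o _)) addr0.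
    by rewrite -[sg eps *: _]addr0 ell_linear [ell 0](linear0 (@ell K v6)) addr0.
  - by rewrite size_behead sw.
  - by move: w6; rewrite w0 => /andP[].
  - rewrite -w0 -s18 sumnE big_map big_enum /=; exact.
rewrite -epw in ell0; apply/rowP => k; rewrite [RHS]mxE; apply/eqP; apply: contraT => nz.
have := weight a6 nz; rewrite s18 => e18.
have k0 : k = ord0 by apply: val_inj => /=; lia.
move: ell0; rewrite /ell (bigD1 k) //= big1 ?addr0; first by move=> e; rewrite e eqxx in nz.
move=> j nj; apply/eqP; apply: contraT => nzj; have := weight a6 nzj; rewrite s18 => ej.
by case/eqP: nj; apply: val_inj => /=; lia.
Qed.

(** With v_6 for the first variable: the image of the value under E is a sum of
    values with a smaller sum of indices, zero by induction, and E is injective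
    on multiples of v_k for k > 0. *)
Lemma highest_zero a : (forall i, (a i <= 6)%N) -> a pos0 = 0%N -> G (bw a) = 0.
Proof.
move: {2}(\sum_i a i).+1 (ltnSn (\sum_i a i)) => n; elim: n a => [//|n IH] a lts a6 a0.
apply/rowP => k; rewrite [RHS]mxE; apply/eqP; apply: contraT => nz.
have sk := weight a6 nz.
have [k0|k0] := posnP k.
  by move: nz; rewrite top_zero ?mxE ?eqxx // sk k0.
have lk : (k.-1 < 7)%N by apply: leq_ltn_trans (leq_pred _) (ltn_ord k).
have := G_der (der_E (K := K) v6_ok) inE6 a6; rewrite big1 => [|i _].
  move=> /(congr1 (fun M : 'rV_7 => M 0 (Ordinal lk))); rewrite [RHS]mxE mxE (bigD1 k) //= big1 => [|j nj].
    rewrite mxE /= eqxx mulr1n addr0 => /eqP; rewrite mulf_eq0 (negbTE nz) /= -(rmorph0 z) (inj_eq (@zR_inj K)).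
    have ltk := ltn_ord k; case: (nat_of_ord k) k0 ltk => // m _ ltm.
    case: eqP => // e _; exfalso; move: e ltm; rewrite cES -[mn v6]/6%N; lia.
  rewrite mxE /=; case: eqP => [e|]; last by rewrite mulr0n mulr0.
  case: (posnP j) => [j0|j0]; first by rewrite j0 /= rmorph0 mul0rn mulr0.
  by case/eqP: nj; apply: val_inj; rewrite -[val j]/(nat_of_ord j) -[val k]/(nat_of_ord k) -(prednK j0) -(prednK k0) e.
case: (posnP (a i)) => [ai0|aip]; first by rewrite ai0 /= rmorph0 scale0r.
rewrite IH ?scaler0 //.
- have -> : \sum_j updn a i (a i).-1 j = (\sum_j a j).-1; last by rewrite sk; rewrite sk in lts; lia.
  rewrite (bigD1 i) //= [in RHS](bigD1 i) //= {1}/updn /upd eqxx.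
  rewrite (eq_bigr a); first by case: (a i) aip.
  by move=> j nj; rewrite /updn /upd (negbTE nj).
- by move=> j; rewrite /updn /upd; case: eqP => // _; apply: leq_trans (leq_pred _) (a6 _).
- rewrite /updn /upd; case: eqP => // e; by rewrite -e a0 in aip.
Qed.

(** Applying F to a vanishing value raises the index of the first variable, all
    other terms of the Leibniz rule vanishing by induction. *)
Lemma basis_zero a : (forall i, (a i <= 6)%N) -> G (bw a) = 0.
Proof.
move: {2}(a pos0) (erefl (a pos0)) => n; elim: n a => [|n IH] a e a6; first exact: highest_zero.
have ln : (n < 6)%N by have := a6 pos0; rewrite e.
pose a' := updn a pos0 n.
have a'0 : a' pos0 = n by rewrite /a' /updn /upd eqxx.
have a'6 i : (a' i <= 6)%N by rewrite /a' /updn /upd; case: eqP => // _; exact: ltnW.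
have := G_der (der_F (K := K) v6_ok) inF6 a'6; rewrite (IH a') // mul0mx (bigD1 pos0) //= big1 => [|i ni].
  rewrite addr0 a'0; have -> : updn a' pos0 n.+1 = a by rewrite /a' /updn upd_upd -e upd_same.
  move/esym/eqP; rewrite scaler_eq0 => /orP[|/eqP//].
  rewrite -(rmorph0 z) (inj_eq (@zR_inj K)) /cF [mn v6]/=.
  by case: Nat.eqb_spec => [e6|_]; [rewrite e6 in ln|].
have [e6|n6] := eqVneq (a' i) 6%N; first by rewrite e6 /= rmorph0 scale0r.
rewrite IH ?scaler0 //.
  by rewrite /updn /upd eq_sym (negbTE ni).
move=> j; rewrite {1}/updn /upd; case: eqP => // _.
by rewrite ltn_neqAle n6 a'6.
Qed.

Lemma all_zero rho : G rho = 0.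
Proof.
suff main (k : nat) : forall rho, (forall i : 'I_7, (k <= i)%N -> exists2 n, (n <= 6)%N & rho i = bv K v6 n) -> G rho = 0.
  by apply: (main 7) => i; rewrite leqNgt ltn_ord.
elim: k => [|k IH] {}rho h.
  pose a i := s2val (cid2 (h i (leq0n _))).
  have ha i : (a i <= 6)%N /\ rho i = bv K v6 (a i) by split; [apply: (s2valP (cid2 (h i _)))|apply: (s2valP' (cid2 (h i _)))].
  have -> : rho = bw a by apply: funext => i; case: (ha i).
  by apply: basis_zero => i; case: (ha i).
have [lt|ge] := ltnP k 7; last first.
  by apply: IH => i; rewrite leqNgt (leq_trans (ltn_ord i)).
pose i0 : 'I_7 := Ordinal lt.
have -> : rho = upd rho i0 (\sum_(n < 7) rho i0 0 n *: bv K v6 n).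
  rewrite -{1}(upd_same rho i0); congr upd; apply/rowP => j; rewrite summxE (bigD1 j) //= big1.
    by rewrite !mxE eqxx mulr1 addr0.
  by move=> n nj; rewrite !mxE val_eqE eq_sym (negbTE nj) mulr0.
elim/big_ind: _ => [|u v hu hv|n _].
- by have := GZ rho i0 0 0; rewrite !scale0r.
- by have := feval_upd o_lin ml rho i0 1 u v; rewrite !scale1r hu hv addr0.
rewrite GZ IH ?scaler0 // => i le; rewrite /upd; case: eqP => [e|ne].
  by exists n => //; rewrite -ltnS ltn_ord.
apply: h; rewrite ltn_neqAle le andbT; apply/eqP => e; apply: ne; exact: val_inj.
Qed.

Lemma ident_of_points : identities7 f.
Proof.
split=> // rho; rewrite (@feval_ext _ _ _ o) ?all_zero //.
by move=> *; apply: V6_gop.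
Qed.
End Ident.

(** * A trace formula for ranks *)

(** Such an e is m times a projector. *)
Lemma trace_quasi_idem (K : numFieldType) r (e : 'M[K]_r) (m : K) : m != 0 ->
  e *m e = m *: e -> \tr e = m * (\rank e)%:R.
Proof.
move=> nz ee; rewrite -{1}(mulmx_base e) mxtrace_mulC.
have cf : row_free (row_base e) by apply: row_base_free.
have cl : row_full (col_base e) by apply: col_base_full.
have h : row_base e *m col_base e = m%:M.
  apply: (row_full_inj cl); apply: (row_free_inj cf).
  by rewrite mulmxA mulmx_base -mulmxA mulmx_base ee mul_mx_scalar -scalemxAl mulmx_base.
by rewrite h mxtrace_scalar mulr_natr.
Qed.

Fixpoint cycle_from (fuel : nat) (w : seq nat) (start x : nat) : seq nat :=
  if fuel is n.+1 then
    x :: (let y := nth 0%N w x in if Nat.eqb y start then [::] else cycle_from n w start y)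
  else [::].
Fixpoint ins (c : seq nat) (cs : seq (seq nat)) : seq (seq nat) :=
  if cs is d :: cs' then if Nat.ltb (size c) (size d) then d :: ins c cs' else c :: cs else [:: c].
Definition cycles (w : seq nat) : seq (seq nat) :=
  foldr (fun x cs => if has (meml x) cs then cs else ins (cycle_from 7 w x x) cs) [::] (iota 0 7).
Fixpoint repw (s : nat) (cs : seq (seq nat)) : seq nat :=
  if cs is c :: cs' then rcons (iota s.+1 (size c).-1) s ++ repw (s + size c)%N cs' else [::].

(** The cycles of w, listed one after the other by decreasing length, form a
    permutation h that conjugates w to a standard representative r of its cycle
    type; the boolean records that this is so, which makes a proof of the
    correctness of the computation of cycles unnecessary. *)
Definition class_rep (w : seq nat) : seq nat * bool :=
  let cs := cycles w in
  let h := flatten cs in let r := repw 0 cs in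
  (r, [&& okw h, okw r & eqw (permw h w) (permw r h)]).

Section Trace.
Variables (K : numFieldType).
Local Notation N := #|{: X}|.
Variable Z : 'M[K]_N.
Hypothesis Zst : forall g, (Z *m R K g <= Z)%MS.
Local Notation r := (\rank Z).
Let U : 'M[K]_(r, N) := row_base Z.
Let Uf : row_free U. Proof. exact: row_base_free. Qed.

Definition rho g : 'M[K]_r := U *m R K g *m pinvmx U.
Lemma rhoE g : rho g *m U = U *m R K g.
Proof.
apply: mulmxKpV; apply: submx_trans (submxMr _ _) _; first by rewrite eq_row_base.
by apply: submx_trans (Zst g) _; rewrite eq_row_base.
Qed.
Lemma rhoM g h : rho (g * h)%g = rho g *m rho h.
Proof.
apply: (row_free_inj Uf); apply: etrans (rhoE _) _.
by rewrite RM mulmxA -(rhoE g) -[LHS]mulmxA -(rhoE h) mulmxA.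
Qed.
Lemma rho1 : rho 1%g = 1%:M.
Proof. by apply: (row_free_inj Uf); rewrite rhoE R1 mulmx1 mul1mx. Qed.

(* The character of the action on the row space. *)
Definition chr (w : seq nat) : K := \tr (rho (pw w)^-1%g).

Lemma chr_class w : okw w -> (class_rep w).2 -> chr w = chr (class_rep w).1.
Proof.
move=> ok; rewrite /class_rep /=; set h := flatten _; set r0 := repw _ _.
case/and3P=> okh okr; rewrite eqwE => /eqP e.
have eg : (pw h * pw w = pw r0 * pw h)%g by rewrite -(pw_permw okh ok) -(pw_permw okr okh) e.
have -> : chr w = \tr (rho ((pw h)^-1 * (pw r0)^-1 * pw h)%g).
  rewrite /chr; congr (\tr (rho _)).
  have -> : pw w = ((pw h)^-1 * pw r0 * pw h)%g by rewrite -mulgA -eg mulKg.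
  by rewrite !invMg invgK mulgA.
by rewrite rhoM mxtrace_mulC -rhoM !mulgA mulgV mul1g.
Qed.

Lemma pw_iota : pw (iota 0 7) = 1%g.
Proof.
apply/permP => i; apply: val_inj; rewrite perm1 [LHS]pwE ?nth_iota //; exact: ltn_ord.
Qed.

Lemma okw_swp x y w : (x < 7)%N -> (y < 7)%N -> okw (swp x y w) -> okw w ->
  pw (swp x y w) = (tperm (inord x) (inord y) * pw w)%g.
Proof.
move=> lx ly ok' ok; have oki : okw (map (swl x y) (iota 0 7)) by apply: okw_swl.
by rewrite /swp pw_permw // pw_swl // pw_iota mul1g.
Qed.

Lemma swpK x y w : size w = 7 -> (x < 7)%N -> (y < 7)%N -> swp x y (swp x y w) = w.
Proof.
move=> sw lx ly; apply: (@eq_from_nth _ 0%N); rewrite size_swp // => i lt.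
rewrite {1}/swp /permw -map_comp (nth_map 0%N) ?size_iota // nth_iota //= add0n.
rewrite /swp /permw -map_comp (nth_map 0%N) ?size_iota ?swl_lt // nth_iota ?swl_lt //= add0n.
by rewrite swlK.
Qed.
Lemma okw_swpE x y w : (x < 7)%N -> (y < 7)%N -> size w = 7 -> okw (swp x y w) = okw w.
Proof.
move=> lx ly sw; have h w' : okw w' -> okw (swp x y w').
  by move=> ok; apply: okw_permw => //; apply: okw_swl.
by apply/idP/idP => /h //; rewrite swpK.
Qed.

Definition gform (w : seq nat) : 'M[K]_N := if okw w then R K (pw w)^-1%g else 0.
Lemma gfamP x y w : size w = 7 -> (x < 7)%N -> (y < 7)%N -> gform (swp x y w) = gform w *m tp K x y.
Proof.
move=> sw lx ly; rewrite /gform okw_swpE //; case: ifP => ok; last by rewrite mul0mx.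
by rewrite okw_swp ?okw_swpE // invMg tpermV RM.
Qed.

Lemma expand_okw bl : okbl bl -> {in expand bl (iota 0 7), forall cw, okw cw.2}.
Proof.
move=> ok; apply: (@expand_stable (fun w => okw w)) => // x y w lx ly okx.
by rewrite okw_swpE ?okw_size.
Qed.

(** The symmetrizer acts on the stable space as a multiple of a projector, whose
    trace is its rank; expanding it gives a sum of values of the character. *)
Lemma trace_formula bl : okbl bl ->
  \sum_(cw <- expand bl (iota 0 7)) zR K cw.1 * chr cw.2 = (fact_bl bl)%:R * (\rank (Z *m blocks_sym K bl))%:R.
Proof.
move=> ok; have [ee _] := eB_abs K ok.
pose e' := \sum_(cw <- expand bl (iota 0 7)) zR K cw.1 *: rho (pw cw.2)^-1%g.
have eU : e' *m U = U *m blocks_sym K bl.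
  have := expand_sum gfamP (erefl : size (iota 0 7) = 7) ok.
  rewrite {2}/gform pw_iota invg1 R1 mul1mx => <-.
  rewrite mulmx_sumr mulmx_suml !big_seq; apply: eq_bigr => cw cin.
  by rewrite /gform (expand_okw ok cin) -scalemxAl rhoE -scalemxAr.
have nz : (fact_bl bl)%:R != 0 :> K by rewrite pnatr_eq0 -lt0n fact_bl_gt0.
have ee' : e' *m e' = (fact_bl bl)%:R *: e'.
  by apply: (row_free_inj Uf); rewrite -mulmxA eU mulmxA eU -mulmxA ee -scalemxAr -eU scalemxAl.
have -> : \rank (Z *m blocks_sym K bl) = \rank e'.
  by rewrite -(mxrankMfree e' Uf) eU /U (eqmxMr _ (eq_row_base Z)).
rewrite -(trace_quasi_idem nz ee') /e' raddf_sum; apply: eq_bigr => cw _.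
by rewrite /= mxtraceZ.
Qed.
End Trace.

Definition class_table (reps : seq (seq nat)) (bl : bseq) : seq Z :=
  let L := map (fun cw : Z * seq nat => (cw.1, (class_rep cw.2).1)) (expand bl (iota 0 7)) in
  map (fun r => foldr (fun cw acc => if eqw cw.2 r then Z.add cw.1 acc else acc) 0%ZZ L) reps.
Definition class_ok (reps : seq (seq nat)) (bl : bseq) : bool :=
  [&& okbl bl, (fact_bl bl %| 7`!)%N &
   all (fun cw : Z * seq nat => let: (r, b) := class_rep cw.2 in b && has (eqw r) reps) (expand bl (iota 0 7))].
Definition table_sum (reps : seq (seq nat)) (l : seq (Z * bseq)) : seq Z :=
  foldr (fun cb acc => map (fun xy : Z * Z => Z.add (Z.mul (Z.mul cb.1 (Z.of_nat (7`! %/ fact_bl cb.2))) xy.1) xy.2)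
      (zip (class_table reps cb.2) acc)) (map (fun=> 0%ZZ) reps) l.
(** The combination of the normalized characters of symmetrizers given by l is
    the indicator of the identity: its value on each conjugacy class, multiplied
    by the order 5040 of the group, is 5040 or 0. *)
Definition check_table (reps : seq (seq nat)) (l : seq (Z * bseq)) : bool :=
  [&& uniq reps, all (fun cb : Z * bseq => class_ok reps cb.2) l &
      table_sum reps l == map (fun r => if eqw r (iota 0 7) then 5040%ZZ else 0%ZZ) reps] && has (eqw (iota 0 7)) reps.

Opaque class_rep.
Section Table.
Variables (K : numFieldType).
Local Notation N := #|{: X}|.
Variable Y : 'M[K]_N.
Hypothesis Zst : forall g, (Y *m R K g <= Y)%MS.

Lemma class_tableP reps bl : uniq reps -> class_ok reps bl ->
  \sum_(i < size reps) zR K (nth 0%ZZ (class_table reps bl) i) * chr Y (nth [::] reps i)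
  = (fact_bl bl)%:R * (\rank (Y *m blocks_sym K bl))%:R.
Proof.
move=> ur /and3P[ok _ /allP cok]; rewrite -trace_formula //.
transitivity (\sum_(r <- reps) zR K (foldr (fun cw acc => if eqw cw.2 r then Z.add cw.1 acc else acc) 0%ZZ
   (map (fun cw : Z * seq nat => (cw.1, (class_rep cw.2).1)) (expand bl (iota 0 7)))) * chr Y r).
  rewrite [RHS](big_nth ([::] : seq nat)) big_mkord; apply: eq_bigr => i _.
  by rewrite /class_table (nth_map ([::] : seq nat)).
have := expand_okw ok; elim: (expand bl (iota 0 7)) cok => [|cw s IH] cok okc /=.
  by rewrite big_nil big1 // => r _; rewrite rmorph0 mul0r.
rewrite big_cons -IH; [|by move=> z zs; apply: cok; rewrite inE zs orbT|by move=> z zs; apply: okc; rewrite inE zs orbT].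
have okw' := okc _ (mem_head _ _).
have := cok _ (mem_head _ _); case e: (class_rep cw.2) => [r b] /andP[bt /hasP[r' r'in]].
rewrite eqwE => /eqP er; rewrite -er {r' er} in r'in.
rewrite (@chr_class _ _ Zst) ?e // -![(r, b).1]/r.
rewrite (bigD1_seq r) //= [X in _ = _ + X](bigD1_seq r) //= eqwE eqxx.
rewrite -[Z.add _ _]/(cw.1 + _) rmorphD mulrDl -addrA; congr (_ + (_ + _)).
by apply: eq_bigr => r1 nr; rewrite eqwE eq_sym (negbTE nr).
Qed.

(** The rank of any stable space is a fixed combination of the ranks of its
    images under the symmetrizers, because the value at the identity of a class
    function is that combination of its averages. *)
Lemma rank_from_table reps l : check_table reps l ->
  (\rank Y)%:R = \sum_(cb <- l) zR K cb.1 * (\rank (Y *m blocks_sym K cb.2))%:R :> K.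
Proof.
case/andP=> /and3P[ur cok /eqP te] idin.
have nz : 7`!%:R != 0 :> K by rewrite pnatr_eq0 -lt0n fact_gt0.
apply: (mulfI nz); rewrite mulr_sumr.
have tab : \sum_(i < size reps) zR K (nth 0%ZZ (table_sum reps l) i) * chr Y (nth [::] reps i)
  = \sum_(cb <- l) 7`!%:R * (zR K cb.1 * (\rank (Y *m blocks_sym K cb.2))%:R).
  elim: l cok {te} => [|[c b] l IH] /=.
    move=> _; rewrite big_nil big1 // => i _; rewrite (nth_map ([::] : seq nat)) //.
    by rewrite rmorph0 mul0r.
  case/andP=> okb /IH{}IH; rewrite big_cons -IH.
  have /and3P[_ dv _] := okb.
  have -> : 7`!%:R * (zR K c * (\rank (Y *m blocks_sym K b))%:R) =
     zR K (Z.mul c (Z.of_nat (7`! %/ fact_bl b))) *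
     \sum_(i < size reps) zR K (nth 0%ZZ (class_table reps b) i) * chr Y (nth [::] reps i) :> K.
    rewrite class_tableP // zRM zR_nat mulrCA -!mulrA; congr (_ * _).
    by rewrite mulrA -natrM divnK.
  rewrite mulr_sumr -big_split; apply: eq_bigr => i _ /=.
  have st : size (table_sum reps l) = size reps.
    by clear; elim: l => [|cb l IH] /=; rewrite ?size_map // size_zip size_map IH minnn.
  have sc : size (class_table reps b) = size reps by rewrite size_map.
  rewrite (nth_map (0%ZZ, 0%ZZ)); last by rewrite size_zip st sc minnn.
  rewrite nth_zip ?st ?sc // -[Z.add _ _]/(Z.mul _ _ + _) rmorphD !zRM mulrDl /=.
  by rewrite !zRM -!mulrA.
rewrite -tab te.
have lt : (index (iota 0 7) reps < size reps)%N.
  by rewrite index_mem; case/hasP: idin => x xin; rewrite eqwE => /eqP->.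
rewrite (bigD1 (Ordinal lt)) //= big1 ?addr0.
  rewrite (nth_map ([::] : seq nat)) // nth_index -?index_mem // eqwE eqxx.
  rewrite /chr pw_iota invg1 rho1 // mxtrace1; congr (_ * _).
move=> i ni; rewrite (nth_map ([::] : seq nat)) // eqwE; case: eqP => [e|_]; last by rewrite rmorph0 mul0r.
by case/eqP: ni; apply: val_inj; rewrite /= -e index_uniq.
Qed.
End Table.
Transparent class_rep.
(** * Certificate data *)

Local Open Scope dec_uint_scope.
Definition c_h7 := Cert [:: (7%N, false)]
  [::]
  [::]
  [::]
  [::]
  [::].

Definition c_h61 := Cert [:: (1%N, false); (6%N, false)]
  [::]
  [:: 31203456]
  [:: 2250555]
  [::]
  [::].

Definition c_h52 := Cert [:: (2%N, false); (5%N, false)]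
  [:: (10213456, 22031456); (30213456, 32013456); (00234156, 30213456)]
  [:: 10231456; 32304156; 32304516; 32304561; 42034156]
  [:: 1233633; 1245444; 0063355; 0343444; 5050333]
  [::]
  [::].

Definition c_h5e2 := Cert [:: (2%N, true); (5%N, false)]
  [:: (10213456, 50231456); (30213456, 32013456); (00234156, 30213456)]
  [:: 10231456; 22031456; 32301456; 32304156; 32304516; 32304561; 42034156]
  [:: 2025444; 6112333; 2612444; 0213666; 6156000; 2440333; 6062333]
  [::]
  [::].

Definition c_h43 := Cert [:: (3%N, false); (4%N, false)]
  [:: (10314256, 23041526); (10314526, 50312456); (10314562, 23041562); (30314562, 33014562); (00345162, 33405612); (20314256, 40134256); (30314256, 33405126); (30314526, 30314256); (40314526, 10341526); (00314256, 30123456)]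
  [:: 00314256; 10312456; 10341562; 20132456; 30314526; 30314562; 33014256; 33014526; 33405162; 43041256; 43045162]
  [:: 2225444; 3334131; 6661005; 3660022; 2224360; 1111564; 4304333; 3332152; 3235055; 2465222; 5441222]
  [::]
  [::].

Definition c_h421 := Cert [:: (1%N, false); (2%N, false); (4%N, false)]
  [:: (30123456, 33401256); (00134256, 31302456); (30314562, 33405162); (00345162, 31304562); (11302456, 43014256); (10123456, 50132456); (31302456, 23140256); (11304562, 11340562); (10314562, 50341562); (31304562, 33415062); (11324056, 23142506); (11324506, 20132456); (11324560, 23142560); (31324560, 33124560); (01345026, 31324506); (01345062, 10341562); (01345260, 31324560); (31324056, 33124506); (31324506, 30123456); (21324056, 41234056); (41324506, 10312456); (00314256, 33405126); (10314256, 50341526); (20314256, 00314256); (10314526, 50312456); (30314526, 31203456); (40314526, 01324056); (01304256, 31324056); (21304256, 40134256); (31304256, 33014526); (41304526, 11302456); (01324056, 30314256); (30314256, 33104526); (11304256, 10341526); (31304526, 31023456); (00341256, 23140526)]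
  [:: 01304256; 10132456; 11320456; 11340256; 11340526; 11342506; 11342560; 21032456; 21230456; 23012456; 23041526; 23041562; 23140562; 30314526; 30314562; 31304256; 31304526; 33014256; 33014562; 33102456; 33104256; 33104562; 33124056; 33401526; 33401562; 33405612; 33415026; 33415206; 33415260; 33415602; 33415620; 41034256; 43041256; 43045162; 43140256; 43142056; 43145026; 43145062; 43145260; 51302456]
  [:: 5104444; 2140555; 4412444; 6113332; 4365000; 5442202; 3251333; 0442622; 5662202; 6120333; 6556000; 0504544; 2221644; 1451333; 1140444; 3005565; 0563233; 1144333; 2156222; 3004544; 5226111; 5524222; 4323233; 4115252; 2214444; 1413555; 2442225; 6223303; 2504344; 2332355; 0666006; 3556211; 4333122; 0333433; 6005252; 6345111; 6005144; 6442211; 2335551; 0332555]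
  [::]
  [::].

Definition c_h4e3 := Cert [:: (3%N, true); (4%N, false)]
  [:: (30123456, 33401256); (00134256, 33401526); (10312456, 10341256); (10123456, 50132456); (30312456, 23041256); (10314562, 50341562); (30314562, 33405162); (00345126, 43045126); (00345162, 43045162); (20314256, 00314256); (30314256, 23041526); (30314526, 20132456); (00314256, 30314256); (00341256, 30123456); (40314526, 10312456); (10314256, 10341526)]
  [:: 10132456; 10341562; 23012456; 23041562; 30312456; 30314526; 30314562; 33012456; 33014256; 33014526; 33014562; 33401562; 33405126; 33405612; 40134256; 43014256; 43041256; 50312456]
  [:: 4203444; 5034222; 6321115; 5342333; 1054434; 3055333; 0520555; 6023344; 3104445; 5024344; 5434044; 1562224; 5010444; 5232233; 5631131; 0414441; 3560060; 2514422]
  [::]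
  [::].

Definition c_h322 := Cert [:: (2%N, false); (2%N, false); (3%N, false)]
  [:: (10213456, 24021356); (30213456, 34203156); (30214563, 34012563); (30234561, 34502361); (00245136, 10241356); (00245163, 30412563); (00245361, 34502631); (10412563, 10451263); (10214563, 50241563); (30412563, 34205163); (10415236, 22041536); (30415236, 32405136); (10415263, 24051623); (10415623, 50421563); (00423156, 34205316); (00456123, 44056123); (02401356, 32034156); (12403561, 44025361); (10234561, 50243561); (32403561, 34025361); (12435016, 12403516); (32435016, 30425316); (12435061, 24253601); (12435601, 20243561); (02456031, 44256031); (30415263, 34015623); (30415623, 32014563); (32435061, 34235601); (32435601, 30425361); (40415236, 12401563); (20415263, 44051263); (42435016, 10452631); (22435061, 42345061); (00214356, 32403156); (10214356, 50241536); (30214356, 34012536); (10214536, 50231456); (00234156, 30412356); (10234156, 50243516); (30234156, 34203516); (10234516, 50213456); (00412356, 32304156); (30412356, 34015236); (00415263, 32405163); (00425136, 32405316); (10425136, 50423516); (40425136, 02435061); (00425163, 30415263); (10425163, 50452613); (20425163, 44052163); (30425163, 34506213); (10425316, 50412536); (30425316, 30415236); (40425316, 00415263); (00425361, 34506231); (10425361, 50452631); (20425361, 00425361); (10425613, 50412563); (10425631, 50423561); (30425631, 32405361); (00452136, 32304516); (00452163, 10421563); (00452361, 34205631); (02403156, 34235016); (32403516, 30124356); (02405136, 32435016); (42405136, 12403561); (02405163, 30425163); (22405163, 00425163); (32405163, 34025613); (32405316, 30124536); (02405361, 34526031); (22405361, 40245361); (32405631, 32034561); (02435061, 30234561); (30214536,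 32013456); (30234516, 30213456); (30412536, 32014356); (32403156, 34025316); (32405136, 32034516); (12405163, 12450613); (42405316, 10451623); (12405361, 44253061); (32405361, 12453601); (32405613, 30124563); (20214356, 44021356); (12403516, 40124356); (40214536, 12401356); (20234156, 42034156); (10412356, 44023156); (40234516, 10421356); (20412356, 40142356); (12405136, 42041356); (40412536, 12430516); (20425136, 42045136); (40425613, 10231456); (22403156, 42340156); (42403516, 10423516); (22405136, 40245136); (42405613, 10213456); (00241356, 24051236); (00243156, 00412356); (30425136, 02405136); (30425361, 42045361); (30425613, 10412563)]
  [:: 00214356; 00234156; 00425136; 02403156; 02405163; 02405361; 10241536; 10241563; 10243516; 10243561; 10412536; 10421536; 10423561; 10451236; 10452613; 12401536; 12430561; 12450316; 12450361; 12450631; 20123456; 20142536; 20142563; 20241356; 20241536; 20241563; 20243516; 22031456; 22041356; 22041563; 22043516; 22043561; 22340516; 22340561; 24021536; 24021563; 24023516; 24023561; 24051263; 24052613; 24052631; 24250316; 24250361; 24250613; 24250631; 30214356; 30214536; 30214563; 30234156; 30234516; 30412536; 30415623; 30425136; 30425613; 30425631; 32014536; 32304561; 32403516; 32403561; 32405613; 32405631; 32435061; 32435601; 34012356; 34015263; 34025136; 34025163; 34025631; 34203561; 34205136; 34205361; 34205613; 34235061; 34502136; 34502163; 34502316; 34502613; 34506123; 34526013; 34526301; 40145263; 40241356; 40243156; 40245163; 42043156; 42045163; 44025136; 44025163; 44052136; 44052361; 44250136; 44250163; 44250361; 52403561]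
  [:: 6611433; 1544222; 6454000; 0552222; 3423333; 1610555; 1621444; 5126222; 5222444; 4401555; 0055265; 6622233; 0066551; 0055255; 5562222; 2115444; 1106544; 6501333; 0455211; 6422133; 5233311; 2611533; 2266250; 4322533; 0033555; 6311611; 0034366; 0255622; 4254333; 6122433; 4306333; 4413322; 3351044; 2611622; 6500333; 5300533; 0433622; 0533544; 1133615; 2203166; 4422422; 1122546; 6133433; 4434522; 4422325; 1524222; 1326444; 1166122; 6611163; 5300644; 3610333; 5502144; 6333111; 2166111; 6100155; 5135222; 0046455; 1402555; 2333322; 2005555; 5522500; 1463222; 4461111; 5312444; 5522040; 5511144; 4144311; 5611144; 3300426; 6651033; 3322425; 2344622; 4431333; 0066231; 5322222; 2511155; 5355000; 2246522; 4444313; 3055144; 5511245; 4411553; 4466022; 5533402; 5500216; 5522163; 4455411; 4413433; 4123333; 1563222; 5522341; 0456333; 3313055; 4455321]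
  [::]
  [::].

Definition c_e7 := Cert [:: (7%N, true)]
  [:: (10123456, 20123456); (20123456, 40123456); (30123456, 30123456); (00123456, 10123456)]
  [:: 00123456; 50123456]
  [::]
  [:: [:: (1%ZZ, 00123456)]; [:: (1%ZZ, 20123456)]]
  [:: 8405367; 8069457].

Definition c_e61 := Cert [:: (1%N, false); (6%N, true)]
  [:: (11234056, 21234506); (21234056, 41234056); (31234056, 31234506); (41234056, 11234560); (11234506, 20123456); (31234506, 30123456); (01234056, 10123456); (11234560, 21234560); (21234560, 41234560); (01234560, 31234560); (10123456, 50123456); (00123456, 31203456); (20123456, 00123456); (40123456, 01234056); (01203456, 11234506); (21203456, 40123456); (31203456, 31234056); (01230456, 11203456); (30123456, 11230456)]
  [:: 01203456; 01234560; 21023456; 21230456; 31023456; 41023456; 41230456; 51203456; 51234560]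
  [:: 1256304]
  [:: [:: (1%ZZ, 21234560)]; [:: (1%ZZ, 00123456); ((-1)%ZZ, 20123456)]; [:: (1%ZZ, 01203456); (1%ZZ, 51203456)]; [:: (1%ZZ, 01203456); ((-2)%ZZ, 21023456)]; [:: (1%ZZ, 11230456); ((-2)%ZZ, 11234506)]; [:: (1%ZZ, 11234506); ((-2)%ZZ, 41023456)]; [:: (1%ZZ, 20123456); (2%ZZ, 40123456)]; [:: (1%ZZ, 01234560); (5%ZZ, 20123456)]]
  [:: 5196027; 6392618; 4953741; 7690743; 3087529; 5873162; 5219357; 8517092].

Definition c_e43 := Cert [:: (3%N, true); (4%N, true)]
  [:: (10314256, 23041526); (10314526, 50312456); (10314562, 50341562); (13456012, 53405612); (23456012, 43456012); (33456012, 30345612); (03456012, 10134562); (10134562, 50134562); (20314256, 40134256); (30314256, 33014526); (30314526, 30123456); (40314526, 10341526); (30314562, 33405162); (00123456, 33401256); (00132456, 33012456); (30134256, 33401526); (40134256, 03456012); (43401256, 13405612); (30134526, 30312456); (00134562, 33401562); (20134562, 00134562); (23401562, 40341562); (00312456, 33014256); (40314256, 13450612); (00314562, 33014562); (20314562, 43041562); (00345126, 30314526); (40345126, 00314562); (20345162, 00345162); (30345162, 33405612); (30345612, 30314562); (33401256, 33045126); (33401526, 30134256); (03401562, 33045162); (03405126, 30345126); (43405126, 10341562); (23405162, 43045162); (03450126, 30134526); (10123456, 50132456); (10134256, 50134526); (10134526, 50123456); (00314256, 33405126); (10345126, 50314526); (10345162, 50345612); (10345612, 50314562); (03405162, 30345162);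 (33405162, 33045612); (20134256, 43014256); (40134526, 10341256); (20312456, 40132456); (40312456, 13401526); (20345126, 43045126); (40345612, 10132456); (23401256, 40341256); (43401526, 10314526); (13405162, 40134562); (33405612, 30134562); (20123456, 40123456); (13401256, 43012456); (40123456, 13401256); (30134562, 13450162); (23405126, 40345126); (43405612, 10123456); (30123456, 23012456); (30345126, 20341526); (00134256, 00345126); (00345162, 20341562)]
  [:: 00123456; 00134256; 00312456; 00314256; 03401256; 03401562; 03405126; 03405162; 10134526; 10312456; 10314562; 13401562; 20123456; 20132456; 20134526; 30314256; 10345612; 13450126; 20134562; 20341256; 20345612; 23014526; 23014562; 23041256; 23041562; 23045612; 23450126; 23450162; 23450612; 33456012; 40345162; 43014562; 43041256; 43450126; 43450162]
  [:: 3124513; 6130351; 6250416; 0156035; 3415041; 3053504; 1244156; 0256254; 5431302; 4106315; 1263016; 0542364; 3626520; 0155326; 3610463; 0352614]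
  [:: [:: (1%ZZ, 03401562); ((-2)%ZZ, 23450162); ((-1)%ZZ, 53405612)]; [:: (1%ZZ, 20134526); ((-10)%ZZ, 23041256); ((-9)%ZZ, 50132456)]; [:: (1%ZZ, 00345162); ((-1)%ZZ, 23041256); (1%ZZ, 50314526); ((-1)%ZZ, 50341562)]; [:: (3%ZZ, 03401562); ((-88)%ZZ, 23041562); ((-76)%ZZ, 33401562); (76%ZZ, 50341562)]; [:: (1%ZZ, 00312456); (1%ZZ, 03401256); ((-4)%ZZ, 30314526); (4%ZZ, 50132456); ((-4)%ZZ, 50312456)]; [:: (1%ZZ, 03401562); (4%ZZ, 20341562); (2%ZZ, 20345612); ((-4)%ZZ, 23450612); ((-4)%ZZ, 50341562)]; [:: (1%ZZ, 20123456); ((-2)%ZZ, 20341526); ((-1)%ZZ, 23014526); ((-2)%ZZ, 23041256); ((-4)%ZZ, 50312456)]; [:: (3%ZZ, 20134562); ((-1)%ZZ, 23045612); (4%ZZ, 23450612); ((-2)%ZZ, 30314562); ((-5)%ZZ, 33045162)]; [:: (2%ZZ, 00314256); (1%ZZ, 00345162); (2%ZZ, 23041562); ((-20)%ZZ, 30314526); (10%ZZ, 33401562)]; [:: (19%ZZ, 20123456); ((-22)%ZZ, 20134526); ((-19)%ZZ, 23014526); (19%ZZ, 23450162); (4%ZZ, 53405612)]; [:: (8%ZZ, 20134526); ((-38)%ZZ, 30312456); (38%ZZ, 30345126); (19%ZZ, 43014562); (2%ZZ, 53405612)]; [:: (38%ZZ, 13405612); ((-4)%ZZ, 20134526); ((-76)%ZZ,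 30134526); (76%ZZ, 33401526); ((-1)%ZZ, 53405612)]; [:: (1%ZZ, 20123456); ((-2)%ZZ, 20132456); ((-1)%ZZ, 20341526); (1%ZZ, 23041256); (1%ZZ, 33045126); (2%ZZ, 50132456)]; [:: (2%ZZ, 10132456); ((-1)%ZZ, 20123456); ((-1)%ZZ, 23450126); ((-2)%ZZ, 30345162); (2%ZZ, 33045612); (2%ZZ, 40132456)]; [:: (1%ZZ, 13405612); (4%ZZ, 30314526); ((-8)%ZZ, 33014256); (6%ZZ, 40132456); ((-4)%ZZ, 40341562); (6%ZZ, 43014256)]; [:: (2%ZZ, 10341562); ((-2)%ZZ, 30314526); ((-2)%ZZ, 33014256); (3%ZZ, 40132456); (3%ZZ, 43045126); ((-8)%ZZ, 43045162)]; [:: (12%ZZ, 20134526); (76%ZZ, 30123456); (38%ZZ, 30345162); ((-38)%ZZ, 40134562); (38%ZZ, 43450162); (3%ZZ, 53405612)]; [:: (4%ZZ, 10312456); ((-2)%ZZ, 13401562); (8%ZZ, 30314256); (24%ZZ, 30314526); ((-8)%ZZ, 33014562); (12%ZZ, 33045162); (4%ZZ, 33405612); (4%ZZ, 33456012); (1%ZZ, 40123456); ((-2)%ZZ, 40132456); (2%ZZ, 40345162); (1%ZZ, 43450126)]; [:: (6%ZZ, 10345612); (3%ZZ, 13401256); ((-3)%ZZ, 13405612); (9%ZZ, 20134562); ((-82)%ZZ, 23012456); (62%ZZ, 23041256); (3%ZZ, 33401526); (97%ZZ, 33401562); ((-3)%ZZ, 40134562); (6%ZZ, 43041256); (3%ZZ,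 43045126); ((-29)%ZZ, 50132456)]]
  [:: 1489512; 0599640; 9428405; 3297183; 0567519; 9821623; 8135481; 3684765; 9485017; 5809746; 6585407; 9524185; 2878534; 8451409; 5923716; 3627482; 6288307; 6141765; 4309761].

Definition c_h3e4 := Cert [:: (3%N, false); (4%N, true)]
  [:: (00312456, 33014256); (30345126, 30314526); (03401256, 33045126); (10345126, 10314526); (03401562, 33045162); (13405126, 50314526); (33405126, 30345126); (13456012, 40341562); (33456012, 30345612); (20314256, 00314256); (30314256, 23041526); (30314526, 20132456); (00314562, 33405162); (10314562, 23041562); (00341562, 33014562); (30345162, 33405612); (30345612, 30314562); (00314256, 33405126); (40314526, 10341526); (00341256, 30123456); (10345162, 50345612); (10345612, 50314562); (03405162, 33456012); (33405612, 30134562); (10314256, 33014526); (40314256, 03405162); (20314562, 43041562); (40345126, 10341562); (33405162, 33045612); (13405612, 40134562); (30314562, 43045162); (43405126, 00345162); (00345162, 20134562); (13405162, 10314562)]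
  [:: 00314562; 10312456; 10345612; 13401526; 13401562; 13405612; 13450612; 20134526; 20341526; 20341562; 20345612; 30134256; 30134526; 30314256; 30345162; 40132456; 40134256; 40341256; 40345162; 43041256; 23045612; 23450612; 43450162; 50312456]
  [:: 4445240; 3334135; 2223064; 4443540; 3331524; 3334206; 5222346; 1223156; 6441062; 2330246; 6224613; 6336320; 0442146; 1445032; 5113026; 1445342; 2225143; 4114506; 5220612; 1552056]
  [:: [:: (1%ZZ, 20341562); ((-18)%ZZ, 23041562); (1%ZZ, 23450612)]; [:: (1%ZZ, 20341562); ((-4)%ZZ, 23041562); ((-1)%ZZ, 23045612); ((-1)%ZZ, 33045162)]; [:: (2%ZZ, 03405162); (2%ZZ, 10341562); (1%ZZ, 20341526); ((-2)%ZZ, 23041526); (1%ZZ, 23450612); (2%ZZ, 50312456); (1%ZZ, 50314526); ((-1)%ZZ, 50345612)]; [:: (2%ZZ, 00314256); ((-1)%ZZ, 00314562); ((-1)%ZZ, 20134526); ((-2)%ZZ, 20341562); (2%ZZ, 23041526); ((-3)%ZZ, 23450612); ((-1)%ZZ, 30134526); (1%ZZ, 33045126); ((-2)%ZZ, 33405126); ((-1)%ZZ, 33456012); (2%ZZ, 40132456); ((-2)%ZZ, 40134562); (3%ZZ, 40341256); (3%ZZ, 40345162); ((-2)%ZZ, 43041256)]]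
  [:: 9668614; 9229468; 2448409; 3119368].

Definition c_h3e3h1 := Cert [:: (1%N, false); (3%N, false); (3%N, true)]
  [:: (00123456, 34102356); (30145236, 31402536); (00412356, 31204356); (00412563, 34105263); (30415236, 31405236); (30456123, 31405623); (11405236, 11420536); (10415236, 50412536); (31405236, 31425036); (01423056, 41243056); (01423560, 34125360); (31456230, 31425630); (14501236, 14510236); (10145236, 50124536); (34501236, 21450236); (14506123, 41042563); (10456123, 50415623); (34506123, 21450623); (04512036, 41452036); (04512063, 10415623); (04512360, 34156230); (11456230, 41452360); (14516230, 14512630); (34516230, 21452630); (00124563, 34501263); (00142563, 34102563); (30145263, 34501623); (30145623, 31402563); (01402563, 34125063); (01420563, 34015263); (31425036, 31425306); (41425036, 01425360); (31425063, 34516203); (31425306, 30415236); (31425360, 34516230); (31425603, 30415263); (31425630, 21243560); (31456023, 31425603); (31456203, 30415623); (00124356, 31402356); (10124356, 50142536); (30124356, 34102536); (10124536, 50123456); (10124563, 50142563); (10145263, 50145623); (10145623, 50124563); (00415263, 31405263); (10415263, 50451623); (30415263, 34105623); (10415623, 50412563); (01402356, 34125036); (31402536, 31234056); (01405263, 31425063); (31405263, 34015623); (01420356, 34015236); (11425036, 51402536); (11425063, 51402563); (11425360, 51423560); (01452036, 31234506); (01452063, 34125603); (01452360, 31234560); (21425360, 11423560); (11456023, 51425603); (11456203, 51405623); (04501263, 31245063); (34501263, 34056123); (04516023, 30456123); (34516023, 31456203); (04561023, 31245603); (40145236, 11450263); (20145263, 44015263); (21425036, 41245036); (01425036, 21243506);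 (21425063, 44152063); (01425063, 24152603); (41425306, 10412563); (01425360, 11452630); (41425603, 10142536); (21456023, 44156023); (41456203, 10142563); (30124536, 31203456); (30415623, 31204563); (31405623, 31024563); (34501623, 31045263); (20124356, 44012356); (40124356, 14560123); (14501623, 14510263); (40124536, 11450236); (21402356, 01402356); (20124563, 41024563); (40415236, 11450623); (20415263, 44051263); (41405236, 01405263); (41402356, 14501623); (14516023, 14512603); (11402536, 44152036); (21402563, 41240563); (11405623, 41245063); (44501236, 11425603); (24501263, 40451263); (24516023, 44561023); (44516203, 10145623); (30124563, 24150263); (00142356, 24150236); (00451263, 24051623); (31402356, 40142356); (21405263, 11452603); (00145263, 24560123); (01456023, 00145263)]
  [:: 00124356; 00124563; 00415263; 01402563; 01425036; 01425063; 01456023; 04501263; 04516023; 10123456; 10124536; 10124563; 10412536; 10451623; 11402536; 11402563; 11405623; 11420356; 11420563; 11423506; 11425630; 14510623; 20142536; 20142563; 20145623; 20451623; 21023456; 21024536; 21024563; 21042536; 21042563; 21045623; 21240356; 21240536; 21240563; 21245603; 21245630; 21450263; 21452603; 24012536; 24012563; 24152630; 30124356; 30124536; 30124563; 30145236; 30145263; 30145623; 31024356; 31024536; 31045236; 31045623; 31204536; 31245036; 31245306; 31245360; 31245630; 31425360; 31456230; 34105236; 34125306; 34125630; 34156023; 34156203; 34501236; 34506123; 34516023; 40142563; 40145263; 41023456; 41024356; 41042356; 41045263; 41240356; 41243560; 41245360; 41450263; 41452063; 44012563; 24015623; 24150623; 31456023; 41456023; 44150263; 44152360; 51425630]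
  [:: 3555104; 1555134; 2555320; 2555601; 5122026; 1433413; 0055614; 5122354; 3166130; 0066253; 0455260; 6300450; 0355124; 2300625; 3622320; 3600635; 0555305; 6633042; 2355402; 6022543; 3055650; 3533521; 5033065; 3222645; 1033645; 3066320; 4255251; 5311650; 2333520; 0066205; 3444620; 6500342; 6211153; 2433105; 0233563; 6411435; 1244053; 3100653; 4344410; 0255026; 0522461; 3044216; 5011356; 4411526; 4033360; 5333415; 6344230; 2522153; 5600315; 6155502; 5033503; 0066062; 5400514; 6411216; 5500615; 4233261; 6144530; 3433420; 0122643; 3166104; 5611251; 3500643; 6511312; 6344401; 6611105; 6511043; 6244023; 0311652; 0600462; 3044416; 0555512; 1522026; 1411425; 0533642; 0266143; 3211462; 0422163; 4622213; 1622316]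
  [:: [:: (1%ZZ, 00145263); ((-9)%ZZ, 01402563); (10%ZZ, 01456023); ((-9)%ZZ, 21023456); ((-1)%ZZ, 21450263); ((-9)%ZZ, 24012536); (1%ZZ, 24560123); (18%ZZ, 44015263); ((-11)%ZZ, 50123456); ((-11)%ZZ, 50142536)]; [:: (18%ZZ, 00415263); ((-18)%ZZ, 01425063); (10%ZZ, 20451623); (2%ZZ, 21042563); ((-1)%ZZ, 21450263); ((-10)%ZZ, 21452603); ((-2)%ZZ, 24051623); (1%ZZ, 24560123); (9%ZZ, 51405623); ((-9)%ZZ, 51425603)]; [:: (3%ZZ, 00124563); ((-2)%ZZ, 01456023); (6%ZZ, 21240356); (5%ZZ, 21450236); (1%ZZ, 24150236); (5%ZZ, 34102356); ((-5)%ZZ, 34501263); (1%ZZ, 44156023); (5%ZZ, 50123456); ((-2)%ZZ, 50124563); ((-3)%ZZ, 50145623)]; [:: (6%ZZ, 20145623); ((-1)%ZZ, 21024563); ((-10)%ZZ, 21042563); ((-2)%ZZ, 21240563); (5%ZZ, 21450263); ((-10)%ZZ, 21450623); (4%ZZ, 21452603); (6%ZZ, 24015623); (12%ZZ, 24150623); (10%ZZ, 31405623); (2%ZZ, 31425603)]; [:: (14%ZZ, 00415263); ((-1)%ZZ, 01402563); (2%ZZ, 01405263); ((-16)%ZZ, 01425063); ((-1)%ZZ, 01456023); ((-14)%ZZ, 20142536); ((-2)%ZZ, 21023456); ((-2)%ZZ, 21042536); (2%ZZ, 21042563); (16%ZZ, 21243506); ((-2)%ZZ, 21243560); ((-2)%ZZ,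 21452603); (2%ZZ, 21452630); ((-14)%ZZ, 24012563); (2%ZZ, 34125063); ((-2)%ZZ, 34125360); (2%ZZ, 50123456); ((-14)%ZZ, 50142563); (2%ZZ, 50412536); ((-2)%ZZ, 50412563); ((-2)%ZZ, 51402536); (2%ZZ, 51423560)]; [:: (36%ZZ, 00415263); (2%ZZ, 01402356); ((-38)%ZZ, 01425063); ((-2)%ZZ, 01425360); (2%ZZ, 11402536); (2%ZZ, 11450236); (2%ZZ, 11452630); (17%ZZ, 14501623); ((-2)%ZZ, 20142536); ((-2)%ZZ, 21042536); (2%ZZ, 21243560); (1%ZZ, 21450236); ((-17)%ZZ, 21452603); (1%ZZ, 21452630); (2%ZZ, 24051623); (2%ZZ, 30124536); (1%ZZ, 30145236); ((-1)%ZZ, 31045236); ((-2)%ZZ, 31234056); ((-2)%ZZ, 31234560); (1%ZZ, 31245063); ((-1)%ZZ, 31245603); ((-2)%ZZ, 31402356); (2%ZZ, 31405236); (1%ZZ, 31456230); ((-2)%ZZ, 34105236); ((-1)%ZZ, 34156230); ((-2)%ZZ, 34506123); ((-20)%ZZ, 40142563); ((-2)%ZZ, 41023456); (6%ZZ, 41042356); (6%ZZ, 41045263); (5%ZZ, 41240563); ((-4)%ZZ, 41243056); ((-2)%ZZ, 41243560); ((-2)%ZZ, 41245036); ((-4)%ZZ, 41245063); (3%ZZ, 41450263); ((-3)%ZZ, 41452036); ((-3)%ZZ, 41452360); (3%ZZ, 41456023); (2%ZZ, 44012563); (1%ZZ, 50145623); (18%ZZ, 51405623)]; [:: (5%ZZ,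 00145263); ((-62)%ZZ, 00415263); (2%ZZ, 01425360); ((-6)%ZZ, 10142563); ((-2)%ZZ, 11425603); (3%ZZ, 11425630); (2%ZZ, 11450623); ((-2)%ZZ, 11452603); (1%ZZ, 14510623); (2%ZZ, 14512630); ((-34)%ZZ, 14560123); ((-4)%ZZ, 20451623); (2%ZZ, 21042536); ((-12)%ZZ, 21042563); ((-5)%ZZ, 21045623); (2%ZZ, 21243506); (2%ZZ, 21245603); (1%ZZ, 21452630); (2%ZZ, 24152603); (2%ZZ, 24152630); ((-1)%ZZ, 24560123); ((-3)%ZZ, 30456123); ((-6)%ZZ, 31024536); (2%ZZ, 31024563); ((-2)%ZZ, 31045263); (2%ZZ, 31203456); (4%ZZ, 31234506); ((-2)%ZZ, 31234560); ((-2)%ZZ, 31405236); (2%ZZ, 31456023); (1%ZZ, 31456230); ((-6)%ZZ, 34015236); (72%ZZ, 34102563); (2%ZZ, 34105236); (4%ZZ, 34105623); (4%ZZ, 34125306); (3%ZZ, 34156203); ((-1)%ZZ, 34156230); (6%ZZ, 34506123); ((-2)%ZZ, 34516203); ((-3)%ZZ, 41240563); (30%ZZ, 41245063); ((-1)%ZZ, 41452063); (1%ZZ, 41456023); (33%ZZ, 44012563); (32%ZZ, 44152063); ((-2)%ZZ, 44152360); ((-4)%ZZ, 50123456); ((-6)%ZZ, 50142536)]]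
  [:: 3222957; 8555124; 3449148; 6994740; 9255980; 9660935; 5227793].
Close Scope dec_uint_scope.

(** * The ranks of the symmetrized annihilators *)

Definition check_ident (c : cert) : bool :=
  if c_B c is [::] then true else
  [&& sumn (map fst (c_bl c)) == 7, (0 < (head (0%N, true) (c_bl c)).1)%N,
    all (okp 6) (idpoints (c_bl c)) &
    all (fun w => let exl := expand (blocks c) w in all (fun b => Z.eqb (bval v6 exl b) 0) (c_B c)) (idpoints (c_bl c))].

Definition check (c : cert) : bool :=
  [&& check_cols c, check_rel c, check_E c, check_W c & check_ident c].

Section Final.
Variable K : numFieldType.

Lemma PhiZ a (v : 'rV[K]_#|{: X}|) : Phi (a *: v) = a *: Phi v.
Proof. by have := Phi_linear a v 0; rewrite addr0 (linear0 (@Phi K)) addr0. Qed.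

Lemma check_identP c b : okbl (blocks c) -> check_ident c -> all (fun t => okcol (digits t.2)) b ->
  (exists2 k, (k < size (c_B c))%N & b = nth [::] (c_B c) k) ->
  identities7 (Phi (bvec K b *m blocks_sym K (blocks c))).
Proof.
move=> okb ci okcb [k lk eb]; have [_ es] := eB_abs K okb.
have /and4P[/eqP suml pos /allP okpts /allP pts] : [&& sumn (map fst (c_bl c)) == 7, (0 < (head (0%N, true) (c_bl c)).1)%N,
    all (okp 6) (idpoints (c_bl c)) &
    all (fun w => let exl := expand (blocks c) w in all (fun b => Z.eqb (bval v6 exl b) 0) (c_B c)) (idpoints (c_bl c))].
  by move: ci lk; rewrite /check_ident; case: (c_B c).
apply: (@ident_of_points K (c_bl c)) => //.
- exact: Phi_multilinear.
- move=> lab eps x y bin xl yl xy; rewrite -Phi_R -mulmxA.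
  have := eB_tp K okb bin xl yl xy; rewrite /tp => ->.
  by rewrite -scalemxAr PhiZ.
- move=> w win; have /(all_nthP [::])/(_ _ lk) /= := pts w win; rewrite -eb => /Z.eqb_spec e0.
  have := @bvalP K v6 _ _ _ okb (okpts w win) okcb; rewrite e0 rmorph0 => e1.
  transitivity ((wform K v6 w *m (bvec K b *m blocks_sym K (blocks c))^T) 0 0).
    by rewrite evf_pair //; [exact: gop_trilinear|exact: gop_skew v6_ok].
  by rewrite trmx_mul es mulmxA -e1.
Qed.

Lemma check_rank c : check c ->
  \rank (DC K *m blocks_sym K (blocks c)) = (\rank (DI K *m blocks_sym K (blocks c)) + size (c_B c))%N.
Proof.
case/and5P=> h1 h2 h3 h4 h5; apply: cert_rank => // k lk; have okb : okbl (blocks c) by case/and3P: h1.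
apply: check_identP => //; last by exists k.
by case/and4P: h4 => /(all_nthP [::])/(_ k lk).
Qed.
End Final.

(** The coefficients solve the linear system that expresses the indicator of the
    identity by characters of symmetrizers; thirteen of these suffice. *)
Definition all_certs : seq (Z * cert) := [:: (5, c_h7); (-18, c_h61); (21, c_h52); (31, c_h5e2); (14, c_h43);
  (-42, c_h421); (-30, c_h4e3); (21, c_h322); (-5, c_e7); (-8, c_e61); (14, c_e43); (-20, c_h3e4); (35, c_h3e3h1)]%ZZ.
(* One permutation for each of the 15 cycle types. *)
Definition reps : seq (seq nat) :=
  map (fun l => repw 0 (map (fun k => nseq k 0%N) l))
  [:: [::7]; [::6;1]; [::5;2]; [::5;1;1]; [::4;3]; [::4;2;1]; [::4;1;1;1]; [::3;3;1]; [::3;2;2]; [::3;2;1;1];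
      [::3;1;1;1;1]; [::2;2;2;1]; [::2;2;1;1;1]; [::2;1;1;1;1;1]; [::1;1;1;1;1;1;1]]%N.
Lemma all_checked : all (fun c : Z * cert => check c.2) all_certs. Proof. vm_cast_no_check (erefl true). Qed.
Lemma table_checked : check_table reps (map (fun c : Z * cert => (c.1, blocks c.2)) all_certs). Proof. vm_cast_no_check (erefl true). Qed.

(** * The 141-term identity: data *)

Local Open Scope dec_uint_scope.
(** The ten groups of the polynomial with their coefficients. A term is written
    as 3 for (((xyz)uv)ws) or 2 for ((xy(zuv))ws) followed by its variables. *)
Definition p_groups : seq (Z * seq Number.uint) := [::
  ((1)%ZZ, [:: 31243056; 31324056; 31423056])
;
  ((-1)%ZZ, [:: 31234056; 31342056; 31432056])
;
  ((2)%ZZ, [:: 20123456; 20134256; 20214356; 20312456; 20324156; 20413256; 21234056; 22314056])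
;
  ((-2)%ZZ, [:: 20124356; 20213456; 20234156; 20314256; 20412356; 20423156; 21324056])
;
  ((3)%ZZ, [:: 30123456; 30134256; 30142356; 30214356; 30231456; 30243156; 30312456; 30324156; 30341256; 30413256; 30421356; 30432156])
;
  ((-3)%ZZ, [:: 30124356; 30132456; 30143256; 30213456; 30234156; 30241356; 30314256; 30321456; 30342156; 30412356; 30423156; 30431256])
;
  ((4)%ZZ, [:: 30124536; 30132546; 30143526; 30213546; 30234516; 30241536; 30314526; 30321546; 30342516; 30412536; 30423516; 30431526; 30512346; 30513426; 30514236; 30521436; 30523146; 30524316; 30531246; 30532416; 30534126; 30541326; 30542136; 30543216])
;
  ((-4)%ZZ, [:: 30123546; 30134526; 30142536; 30214536; 30231546; 30243516; 30312546; 30324516; 30341526; 30413526; 30421536; 30432516; 30512436; 30513246; 30514326; 30521346; 30523416; 30524136; 30531426; 30532146; 30534216; 30541236; 30542316; 30543126])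
;
  ((8)%ZZ, [:: 30125436; 30135246; 30145326; 30152346; 30153426; 30154236; 30215346; 30235416; 30245136; 30251436; 30253146; 30254316; 30315426; 30325146; 30345216; 30351246; 30352416; 30354126; 30415236; 30425316; 30435126; 30451326; 30452136; 30453216])
;
  ((-8)%ZZ, [:: 30125346; 30135426; 30145236; 30152436; 30153246; 30154326; 30215436; 30235146; 30245316; 30251346; 30253416; 30254136; 30315246; 30325416; 30345126; 30351426; 30352146; 30354216; 30415326; 30425136; 30435216; 30451236; 30452316; 30453126])
].
(** Found by linear algebra: with these multiples of relations, the polynomial is
    congruent to the antisymmetrization in a, b, c, d, e of a quarter of
    p_alt. *)
Definition p_rels : seq (Z * seq Number.uint) :=
  [:: ((-8)%ZZ, [:: 30125346; 30145236; 00153246; 12401536; 30215436; 30235146; 30245316; 30315246; 30325416; 30345126; 30425136; 30435216; 00451236; 12304516; 02315046; 10423156; 32315406; 02435016; 10124356; 32435106]);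
      ((-5)%ZZ, [:: 32503416]);
      ((-4)%ZZ, [:: 00132456; 14501326; 00143256; 12501436; 00213456; 14502136; 00234156; 11502346; 00241356; 13502416; 00321456; 14503216; 00342156; 11503426; 00412356; 13504126; 00431256; 12504316; 31502436; 31503246; 31523406; 01524036; 10315246; 01540236; 12315406; 01543026; 10215436; 02304156; 11523046; 32304516; 02401356; 13524016; 32401536; 32501346; 32504136; 02513046; 10425136; 02534016; 10125346; 33502146; 33504216; 03510246; 12435106; 03514026; 10235146; 03521046; 10435216; 33524106; 34501236; 34502316; 34503126; 04512036; 10345126; 04523016; 10145236; 04531026; 10245316]);
      ((-3)%ZZ, [:: 30124356; 00314256; 12503146; 30423156; 02541036; 10325416]);
      ((-1)%ZZ, [:: 30123456; 30134256; 30214356; 30312456; 30324156; 30413256; 31234056; 31403256; 01430256; 12514306; 02503146; 11425036; 32514306]);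
      ((1)%ZZ, [:: 30213456; 30234156; 30314526; 30412356; 31324056; 01403256; 12514036; 31403526; 31423056; 32514036; 02530146; 11425306]);
      ((3)%ZZ, [:: 00341256; 12503416; 02514036; 10325146]);
      ((4)%ZZ, [:: 00123456; 14501236; 30124536; 00134256; 12501346; 00214356; 13502146; 00231456; 14502316; 00243156; 11502436; 00312456; 14503126; 00324156; 11503246; 00413256; 12504136; 00421356; 13504216; 30423516; 31502346; 31503426; 01504236; 12315046; 31523046; 01534026; 10215346; 01542036; 10315426; 32304156; 02340156; 11523406; 32401356; 02410356; 13524106; 32501436; 32504316; 02531046; 10425316; 02543016; 10125436; 03501246; 12435016; 33502416; 33504126; 03512046; 10435126; 33524016; 03541026; 10235416; 34501326; 34502136; 34503216; 04513026; 10245136; 04521036; 10345216; 04532016; 10145326]);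
      ((5)%ZZ, [:: 32503146]);
      ((8)%ZZ, [:: 30125436; 00135246; 12401356; 30145326; 30215346; 30235416; 30245136; 30315426; 30325146; 30345216; 00415236; 12304156; 30425316; 30435126; 32315046; 02351046; 10423516; 32435016; 02453016; 10124536])].
Definition p_alt : seq (Z * Number.uint) := [:: ((-1)%ZZ, 25341206); (16%ZZ, 34325106)].
(* Substitutions in V(10) that separate the 42 translates below. *)
Definition p_points : seq Number.uint :=
  [:: 9283262; 8622742; 5623866; 8453336; 2878408; 5329228; 7563646; 9953149; 6995290; 4447268; 2757079; 4294374; 6066937; 4169447; 8127588; 9148349; 9082626; 2980921; 2706927; 3616494; 3237697; 9507447; 7384308; 4904508; 6106918; 7755136; 9644980; 4319591; 1577663; 8219039; 4531189; 1596864; 1594186; 6486519; 3656087; 6595248; 9981706; 3167269; 8756352; 3904853; 1488972; 8372495].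
Local Close Scope dec_uint_scope.

Definition bl5 : bseq := mkblocks 0 [:: (5, true); (1, false); (1, false)]%N.
Definition cert5 : cert := Cert [:: (5, true); (1, false); (1, false)]%N [::] [::] [::] [:: p_alt] [::].

(* Two exchanges bring the first kind of term to a shape, and one the second. *)
Definition tcol (t : seq nat) : Z * seq nat :=
  if t is [:: k; x; y; z; u; v; w; s] then
    if Nat.eqb k 3 then (1%ZZ, [:: 3; w; u; x; y; z; v; s]) else ((-1)%ZZ, [:: 2; w; x; y; z; u; v; s])
  else (0%ZZ, [::]).
Definition p_cols : seq (Z * seq nat) :=
  flatten (map (fun g : Z * seq Number.uint => map (fun t => let: (s, c) := tcol (digits t) in (Z.mul g.1 s, c)) g.2) p_groups).
Definition rel_cols (c : Z) (r : seq nat) : seq (Z * seq nat) :=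
  map (fun t : bool * (nat * seq nat) => (Z.mul c (b2Z t.1), t.2.1 :: permw t.2.2 (behead r))) (rels (head 0%N r)).
Definition alt_cols (bl : bseq) (b : seq (Z * Number.uint)) : seq (Z * seq nat) :=
  flatten (map (fun t : Z * Number.uint => let c := digits t.2 in
     map (fun cw : Z * seq nat => (Z.mul t.1 cw.1, head 0%N c :: permw (behead c) cw.2)) (expand bl (iota 0 7))) b).
Definition p_relcols : seq (Z * seq nat) :=
  flatten (map (fun g : Z * seq Number.uint => flatten (map (fun r => rel_cols (Z.mul (-4) g.1) (digits r)) g.2)) p_rels).
Definition p_total : seq (Z * seq nat) :=
  map (fun t : Z * seq nat => (Z.mul 4 t.1, t.2)) p_cols ++ p_relcols
  ++ map (fun t : Z * seq nat => (Z.mul (-1) t.1, t.2)) (alt_cols bl5 p_alt).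

Fixpoint addc (c : seq nat) (x : Z) (l : seq (seq nat * Z)) : seq (seq nat * Z) :=
  if l is d :: l' then if eqw c d.1 then (d.1, Z.add x d.2) :: l' else d :: addc c x l' else [:: (c, x)].
Definition collect (l : seq (Z * seq nat)) : seq (seq nat * Z) :=
  foldr (fun (t : Z * seq nat) acc =>
    if canonw [::] (moves (head 0%N t.2)) (behead t.2) is Some (s, w') then
      addc (head 0%N t.2 :: w') (Z.mul (b2Z s) t.1) acc else acc) [::] l.
Definition check_zero (l : seq (Z * seq nat)) : bool :=
  all (fun t : Z * seq nat => okcol t.2) l && all (fun t : seq nat * Z => Z.eqb t.2 0) (collect l).


Definition tails : seq (seq nat) := [seq [:: x; y] | x <- iota 0 7, y <- [seq y <- iota 0 7 | ~~ Nat.eqb y x]].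
(** A class of permutations modulo those of the first five variables is given by
    the images of the last two. *)
Definition coset_word (t : seq nat) : seq nat := [seq z <- iota 0 7 | ~~ meml z t] ++ t.
Definition cosets : seq (seq nat) := map coset_word tails.
Definition p_matrix : seq (seq Z) :=
  map (fun w => map (fun s => bval v10 (expand bl5 (permw s w)) p_alt) cosets) (map digits p_points).
Definition check_independent : bool :=
  [&& size cosets == 42, all okw cosets, all (okp 10) (map digits p_points) & elim 42 (map (map modp) p_matrix)].

(** * The 141-term identity as a combination of shapes *)

Section Poly.
Variables (K : numFieldType) (V : lmodType K) (o : V -> V -> V -> V) (a : seq V).
Hypotheses (o_lin : trilinear o) (o_skew : skew_symmetric o).
Definition tterm (t : seq nat) : V :=
  let x i := nth 0 a i in
  if t is [:: k; i0; i1; i2; i3; i4; i5; i6] then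
    if Nat.eqb k 3 then o (o (o (x i0) (x i1) (x i2)) (x i3) (x i4)) (x i5) (x i6)
    else o (o (x i0) (x i1) (o (x i2) (x i3) (x i4))) (x i5) (x i6)
  else 0.
Definition gsum (g : seq (seq nat)) : V :=
  if g is t :: ts then foldl (fun acc t => acc + tterm t) (tterm t) ts else 0.
Lemma gsumE g : gsum g = \sum_(t <- g) tterm t.
Proof.
case: g => [|t ts]; first by rewrite big_nil.
rewrite big_cons /=; elim: ts (tterm t) => [|s ts IH] x /=; first by rewrite big_nil addr0.
by rewrite IH big_cons addrA.
Qed.
Lemma tterm_shape t : size t = 8%N ->
  tterm t = zR K (tcol t).1 *: shape o 0 (head 0%N (tcol t).2) (pick_args (behead (tcol t).2) a).
Proof.
case: t => [|k [|x [|y [|z [|u [|v [|w [|s [|? ?]]]]]]]]] // _; rewrite /tterm /tcol.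
case: Nat.eqb_spec => _ /=.
  by rewrite rmorph1 scale1r (oS o_skew (nth 0 a w)) (oS o_skew (nth 0 a u)) (oNl o_lin) opprK.
by rewrite -[zR K _]/(-1 : K) scaleN1r (oS o_skew (nth 0 a w)) opprK.
Qed.
End Poly.

Lemma poly_groups (K : numFieldType) (V : lmodType K) (o : V -> V -> V -> V) (x0 x1 x2 x3 x4 x5 x6 : V) :
  let g k := gsum o [:: x0; x1; x2; x3; x4; x5; x6] (map digits (nth (0%ZZ, [::]) p_groups k).2) in
  polynomial141 o x0 x1 x2 x3 x4 x5 x6 =
  g 0%N - g 1%N + g 2%N *+ 2 - g 3%N *+ 2 + g 4%N *+ 3 - g 5%N *+ 3 + g 6%N *+ 4 - g 7%N *+ 4 + g 8%N *+ 8 - g 9%N *+ 8.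
Proof. by []. Qed.

Section Cert.
Variable K : numFieldType.
Local Notation N := #|{: X}|.
Local Notation sg := (sign_of K).

(** A vector killed by the whole annihilator of a row space belongs to it. *)
Lemma AC_mem (v : 'rV[K]_N) : (forall u : 'rV[K]_N, (u <= DC K)%MS -> (u *m v^T) 0 0 = 0) -> (v <= AC K)%MS.
Proof.
move=> h; rewrite submxE; apply/eqP/rowP => j; rewrite [RHS]mxE.
have cd : (((cokermx (AC K))^T) <= DC K)%MS.
  by apply/sub_kermxP; rewrite -trmx_mul mulmx_coker trmx0.
rewrite -[RHS](h (row j (cokermx (AC K))^T)); last by apply: submx_trans cd; apply: row_sub.
by rewrite !mxE; apply: eq_bigr => l _; rewrite !mxE mulrC.
Qed.

Definition lvec (l : seq (Z * seq nat)) : 'rV[K]_N := \sum_(t <- l) zR K t.1 *: dvec K t.2.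
Lemma lvec_pair (u : 'rV[K]_N) l : (u *m (lvec l)^T) 0 0 = \sum_(t <- l) zR K t.1 * colv u t.2.
Proof.
rewrite /lvec; elim: l => [|t l IH]; first by rewrite !big_nil trmx0 mulmx0 mxE.
by rewrite !big_cons -IH linearD linearZ /= mulmxDr -scalemxAr mxE mxE dvecE.
Qed.

Section Collect.
Variable f : seq nat -> K.
Hypothesis fmv : forall j m w, (j < 6)%N -> m \in moves j -> okw w -> f (j :: permw m w) = - f (j :: w).
Lemma addcP c x l : \sum_(t <- addc c x l) zR K t.2 * f t.1 = zR K x * f c + \sum_(t <- l) zR K t.2 * f t.1.
Proof.
elim: l => [|d l IH] /=; first by rewrite big_cons !big_nil.
rewrite eqwE; case: eqP => [->|_]; rewrite !big_cons /=.
  by rewrite -[Z.add _ _]/(x + d.2) rmorphD mulrDl addrA.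
by rewrite IH addrCA.
Qed.
Lemma collectP l : all (fun t : Z * seq nat => okcol t.2) l ->
  \sum_(t <- l) zR K t.1 * f t.2 = \sum_(t <- collect l) zR K t.2 * f t.1.
Proof.
elim: l => [|[c col] l IH] /=; first by rewrite !big_nil.
case/andP=> okc /IH{}IH; rewrite big_cons IH.
case: col okc => [|j w] /andP[] //= lj okw'.
have := @canonwP K (fun w => f (j :: w)) [::] isT _ (moves j) w _ okw'.
case: (canonw _ _ _) => [[s w']|] h.
  rewrite addcP zRM /=; have [] := h _ _.
  - by [].
  - by move=> m min; split; [exact: moves_ok min|move=> w1 ok1; apply: fmv].
  move=> _ ->; congr (_ + _); rewrite mulrCA mulrA; congr (_ * _ * _).
  by rewrite /sign_of /b2Z; case: (s).
rewrite h ?mulr0 ?add0r //.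
by move=> m min; split; [exact: moves_ok min|move=> w1 ok1; apply: fmv].
Qed.
Lemma check_zeroP l : check_zero l -> \sum_(t <- l) zR K t.1 * f t.2 = 0.
Proof.
case/andP=> ok /allP h; rewrite collectP // big_seq big1 // => t /h /Z.eqb_spec->.
by rewrite rmorph0 mul0r.
Qed.
End Collect.

Lemma dvec_R j w g : (j < 6)%N -> dvec K (j :: w) *m R K g = dvec K (j :: word (pw w * g)%g).
Proof.
move=> lj; apply: at_ext => x; rewrite /at_ at_R /dvec !mxE !eqxx /=.
rewrite !(inj_eq enum_rank_inj) /cidx /= pw_word; congr (_%:R); congr (nat_of_bool _).
case: x => j' s; rewrite !xpair_eqE; congr (_ && _).
by apply/eqP/eqP => [<-|->]; rewrite ?mulgKV ?mulgK.
Qed.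

Lemma eB_expand bl : okbl bl -> blocks_sym K bl = \sum_(cw <- expand bl (iota 0 7)) zR K cw.1 *: R K (pw cw.2).
Proof.
move=> ok; have [_ es] := eB_abs K ok.
have := expand_sum (@gfamP K) (erefl : size (iota 0 7) = 7) ok.
rewrite {2}/gform pw_iota invg1 R1 mul1mx => e; rewrite -{}es -{}e raddf_sum !big_seq.
apply: eq_bigr => cw cin; rewrite /= linearZ /gform (expand_okw ok cin) /= RT invgK.
by [].
Qed.

(* The symmetrizer is symmetric, so that it may be expanded with the inverse
   permutations. *)
Lemma alt_colsP bl b : okbl bl -> all (fun t => okcol (digits t.2)) b ->
  bvec K b *m blocks_sym K bl = lvec (alt_cols bl b).
Proof.
move=> ok; rewrite /bvec /lvec /alt_cols big_flatten big_map mulmx_suml.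
elim: b => [|t b IH]; first by rewrite !big_nil.
case/andP=> okt /IH{}IH; rewrite !big_cons IH; congr (_ + _).
rewrite big_map -scalemxAl (eB_expand ok) mulmx_sumr scaler_sumr !big_seq; apply: eq_bigr => cw cin.
rewrite -scalemxAr scalerA /= zRM; congr (_ *: _).
case/andP: okt; case: (digits t.2) => [|j w] //= lj okw'.
by rewrite dvec_R // -pw_permw ?word_pw ?okw_permw // (expand_okw ok cin).
Qed.

Local Notation p := (new_identity K).
Definition pvec : 'rV[K]_N := lvec p_cols.

Lemma gen_args : [seq gen K (inord i : 'I_7) | i <- iota 0 7] =
  [:: gen K (@Ordinal 7 0 isT); gen K (@Ordinal 7 1 isT); gen K (@Ordinal 7 2 isT); gen K (@Ordinal 7 3 isT);
   gen K (@Ordinal 7 4 isT); gen K (@Ordinal 7 5 isT); gen K (@Ordinal 7 6 isT)].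
Proof.
have e i (lt : (i < 7)%N) : inord i = Ordinal lt by apply: val_inj; rewrite /= inordK.
by rewrite /= (e 0%N isT) (e 1%N isT) (e 2 isT) (e 3 isT) (e 4 isT) (e 5 isT) (e 6 isT).
Qed.

Lemma p_cols_ok : all (fun t : Z * seq nat => okcol t.2) p_cols. Proof. by vm_compute. Qed.
Lemma p_terms_ok : all (fun g : Z * seq Number.uint => all (fun t => size (digits t) == 8%N) g.2) p_groups.
Proof. by vm_compute. Qed.

Lemma group_terms (c : Z) (ts : seq Number.uint) (a := [seq gen K (inord i : 'I_7) | i <- iota 0 7]) :
  all (fun t => size (digits t) == 8%N) ts ->
  all (fun t : Z * seq nat => okcol t.2) (map (fun t => let: (s, cc) := tcol (digits t) in (Z.mul c s, cc)) ts) ->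
  \sum_(x <- map (fun t => let: (s, cc) := tcol (digits t) in (Z.mul c s, cc)) ts) zR K x.1 *: Phi (dvec K x.2)
  = zR K c *: gsum (@fop K 7) a (map digits ts).
Proof.
have tr := @fop_trilinear K 7. have sk := @fop_skew K 7.
rewrite gsumE !big_map; elim: ts => [|t ts IH]; first by rewrite !big_nil scaler0.
case/andP=> /eqP st al; rewrite map_cons => /andP[okt al2].
rewrite !big_cons scalerDr -(IH al al2).
suff -> : zR K c *: tterm (@fop K 7) a (digits t) =
  zR K (let: (s, cc) := tcol (digits t) in (Z.mul c s, cc)).1 *:
    Phi (dvec K (let: (s, cc) := tcol (digits t) in (Z.mul c s, cc)).2) by [].
rewrite (tterm_shape a tr sk st); case: (tcol _) okt => s cc /andP[lj okc].
have ea : pick_args (behead cc) a = [seq gen K (inord i) | i <- behead cc].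
  rewrite /pick_args permw_map //; congr map; rewrite /permw -[RHS]map_id; apply/eq_in_map => i.
  by rewrite (perm_mem okc) mem_iota => lt; rewrite nth_iota.
have et : Phi (dvec K cc) = shape (@fop K 7) 0 (head 0%N cc) (pick_args (behead cc) a).
  by apply: etrans (tree_dvec K lj okc) _; exact: (congr1 (fun l => shape (@fop K 7) 0 (head 0%N cc) l) (esym ea)).
apply: etrans (scalerA _ _ _) _; apply: etrans (congr1 (fun v => _ *: v) (esym et)) _.
exact: (congr1 (fun z => z *: Phi (dvec K cc)) (esym (zRM K c s))).
Qed.

Lemma right_sum (W : zmodType) (x0 x1 x2 x3 x4 x5 x6 x7 x8 x9 : W) :
  x0 - x1 + x2 *+ 2 - x3 *+ 2 + x4 *+ 3 - x5 *+ 3 + x6 *+ 4 - x7 *+ 4 + x8 *+ 8 - x9 *+ 8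
  = x0 *+ 1 + (- (x1 *+ 1) + (x2 *+ 2 + (- (x3 *+ 2) + (x4 *+ 3 + (- (x5 *+ 3)
    + (x6 *+ 4 + (- (x7 *+ 4) + (x8 *+ 8 + (- (x9 *+ 8) + 0))))))))).
Proof. by rewrite !mulr1n addr0 !addrA. Qed.

Lemma p_Phi : p = Phi pvec.
Proof.
pose a := [seq gen K (inord i : 'I_7) | i <- iota 0 7].
have tr := @fop_trilinear K 7. have sk := @fop_skew K 7.
have -> : Phi pvec = \sum_(g <- p_groups) zR K g.1 *: gsum (@fop K 7) a (map digits g.2).
  rewrite /pvec /lvec Phi_comb; have := p_cols_ok; have := p_terms_ok; rewrite /p_cols.
  elim: p_groups => [|g gs IH]; first by rewrite !big_nil.
  case/andP=> sz /IH{}IH; rewrite [map _ _]/= [flatten _]/= all_cat => /andP[ok /IH{}IH].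
  rewrite big_cat [RHS]big_cons {}IH; congr (_ + _).
  exact: group_terms.
have pos n (v : freeskew K 7) : zR K (Z.of_nat n) *: v = v *+ n by rewrite zR_nat scaler_nat.
have neg n (v : freeskew K 7) : zR K (Z.opp (Z.of_nat n)) *: v = - (v *+ n).
  by rewrite -[Z.opp _]/(- Z.of_nat n) rmorphN scaleNr pos.
pose d := (0%ZZ, [::] : seq Number.uint); pose g k := gsum (@fop K 7) a (map digits (nth d p_groups k).2).
have -> : \sum_(g <- p_groups) zR K g.1 *: gsum (@fop K 7) a (map digits g.2) =
    \sum_(k < 10) zR K (nth d p_groups k).1 *: g k by rewrite (big_nth d) big_mkord.
have e : p = g 0%N - g 1%N + g 2%N *+ 2 - g 3%N *+ 2 + g 4%N *+ 3 - g 5%N *+ 3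
    + g 6%N *+ 4 - g 7%N *+ 4 + g 8%N *+ 8 - g 9%N *+ 8.
  have := poly_groups (@fop K 7) (gen K (@Ordinal 7 0 isT)) (gen K (@Ordinal 7 1 isT)) (gen K (@Ordinal 7 2 isT))
    (gen K (@Ordinal 7 3 isT)) (gen K (@Ordinal 7 4 isT)) (gen K (@Ordinal 7 5 isT)) (gen K (@Ordinal 7 6 isT)).
  rewrite -gen_args; exact.
rewrite {}e; move: g => g; rewrite !big_ord_recl big_ord0 /=.
rewrite (pos 1%N) (neg 1%N) (pos 2%N) (neg 2%N) (pos 3%N) (neg 3%N) (pos 4%N) (neg 4%N) (pos 8%N) (neg 8%N).
exact: right_sum.
Qed.
End Cert.

(** * The 141-term identity modulo consequences *)

Lemma p_total_zero : check_zero p_total. Proof. vm_cast_no_check (erefl true). Qed.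
Lemma p_rels_ok : all (fun g : Z * seq Number.uint => all (fun r => okw (behead (digits r))) g.2) p_rels.
Proof. vm_cast_no_check (erefl true). Qed.
Lemma cert5_ident : check_ident cert5. Proof. vm_cast_no_check (erefl true). Qed.
Lemma independent : check_independent. Proof. vm_cast_no_check (erefl true). Qed.
Lemma okbl5 : okbl bl5. Proof. by []. Qed.
Lemma p_alt_ok : all (fun t : Z * Number.uint => okcol (digits t.2)) p_alt. Proof. by []. Qed.

Section NewIdentity.
Variable K : numFieldType.
Local Notation N := #|{: X}|.
Local Notation sg := (sign_of K).
Local Notation p := (new_identity K).
Local Notation A := (freeskew K 7).

(** An antisymmetrization in the first five variables, congruent to four times
    the polynomial. *)
Definition alt_vec : 'rV[K]_N := bvec K p_alt *m blocks_sym K bl5.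

Lemma sum_scale (c : Z) (f : seq nat -> K) (l : seq (Z * seq nat)) :
  \sum_(t <- map (fun t : Z * seq nat => (Z.mul c t.1, t.2)) l) zR K t.1 * f t.2 = zR K c * \sum_(t <- l) zR K t.1 * f t.2.
Proof. by rewrite big_map mulr_sumr; apply: eq_bigr => t _; rewrite /= zRM mulrA. Qed.

Lemma DC_relcols u : (u <= DC K)%MS -> \sum_(t <- p_relcols) zR K t.1 * colv u t.2 = 0.
Proof.
move=> uD; rewrite /p_relcols big_flatten big_map; have := p_rels_ok.
elim: p_rels => [|g gs IH]; first by rewrite big_nil.
case/andP=> og /IH{}IH; rewrite big_cons IH; apply: etrans (addr0 _) _; rewrite big_flatten big_map.
elim: (g.2) og => [|r rs IHr]; first by rewrite big_nil.
case/andP=> okr /IHr{}IHr; rewrite big_cons IHr; apply: etrans (addr0 _) _; rewrite /rel_cols big_map.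
transitivity (zR K (Z.mul (-4) g.1) * \sum_(t <- rels (head 0%N (digits r))) sg t.1 * colv u (t.2.1 :: permw t.2.2 (behead (digits r)))).
  rewrite mulr_sumr; apply: eq_bigr => t _; rewrite -[(_, _).1]/(Z.mul _ _) -[(_, _).2]/(_ :: _) zRM -mulrA.
  by congr (_ * (_ * _)); rewrite /sign_of /b2Z; case: t.1.
by rewrite DC_rel // mulr0.
Qed.

(** Every functional that kills the consequences takes the value 0 on the
    difference: after subtraction of the relations, all coefficients of normal
    forms cancel. *)
Lemma p_cong : consequences7 (4%:R *: p - Phi alt_vec).
Proof.
have -> : 4%:R *: p - Phi alt_vec = Phi (4%:R *: pvec K - alt_vec).
  rewrite p_Phi; have := Phi_linear (4%:R) (pvec K) (- alt_vec); move=> ->; congr (_ + _).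
  by rewrite -!scaleN1r PhiZ.
apply/ACP/AC_mem => u uD.
rewrite linearB linearZ /= mulmxBr -scalemxAr.
have -> : (4%:R *: (u *m (pvec K)^T) - u *m alt_vec^T) 0 0 = 4%:R * (u *m (pvec K)^T) 0 0 - (u *m alt_vec^T) 0 0.
  by rewrite !mxE.
rewrite /alt_vec (alt_colsP K okbl5 p_alt_ok) /pvec !lvec_pair.
have fmv j m w := @DC_move K u j m w uD.
have := check_zeroP fmv p_total_zero.
rewrite /p_total big_cat; move: (DC_relcols uD) (sum_scale 4 (colv u) p_cols) (sum_scale (-1) (colv u) (alt_cols bl5 p_alt)).
move: p_cols p_relcols (alt_cols bl5 p_alt) => l1 l2 l3 e2 e1 e3 e.
have {e} e : zR K 4 * (\sum_(t <- l1) zR K t.1 * colv u t.2) + (0 + zR K (-1) * \sum_(t <- l3) zR K t.1 * colv u t.2) = 0.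
  by rewrite -e1 -e3 -[X in _ + (X + _)]e2 -[RHS]e [in RHS]big_cat.
by move: e; rewrite -[zR K (-1)]/(-1 : K) mulN1r add0r -[zR K 4]/(zR K (Z.of_nat 4)) zR_nat.
Qed.

Lemma alt_vec_ident : identities7 (Phi alt_vec).
Proof. by apply: (@check_identP K cert5 p_alt okbl5 cert5_ident p_alt_ok); exists 0%N. Qed.

Lemma conseq0 : consequences7 (0 : A). Proof. exact: consequences0. Qed.
Lemma conseqZ a (f : A) : consequences7 f -> consequences7 (a *: f).
Proof. by move=> h; rewrite -[_ *: _]addr0; apply: consequences_lin => //; apply: consequences0. Qed.
Lemma conseqD (f g : A) : consequences7 f -> consequences7 g -> consequences7 (f + g).
Proof. by move=> h1 h2; rewrite -[f]scale1r; apply: consequences_lin. Qed.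
Lemma conseqB (f g : A) : consequences7 f -> consequences7 g -> consequences7 (f - g).
Proof. by move=> h1 h2; apply: conseqD => //; rewrite -scaleN1r; apply: conseqZ. Qed.
Lemma conseq_sum (I : Type) (r : seq I) (F : I -> A) : (forall i, consequences7 (F i)) -> consequences7 (\sum_(i <- r) F i).
Proof. by move=> h; elim/big_ind: _ => //; [exact: conseq0|exact: conseqD]. Qed.

Lemma nz4 : 4%:R != 0 :> K. Proof. by rewrite pnatr_eq0. Qed.

(** Up to consequences the polynomial is antisymmetric in five variables, so it
    is enough to test it on strictly increasing weights. *)
Lemma p_ident : identities7 p.
Proof.
have -> : p = 4%:R^-1 *: (1 *: (4%:R *: p - Phi alt_vec) + Phi alt_vec) + 0.
  by rewrite addr0 scale1r subrK scalerA mulVf ?nz4 // scale1r.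
apply: identities_lin; last exact: identities0.
apply: identities_lin; last exact: alt_vec_ident.
exact/consequences_identities/p_cong.
Qed.

Lemma perm_varsE s (f g : A) a : perm_vars s (a *: f - g) = a *: perm_vars s f - perm_vars s g.
Proof.
have e1 : perm_vars s (a *: f - g) = a *: perm_vars s f + perm_vars s (- g).
  exact: (feval_linear (@fop K 7) (fun i => gen K (s i)) a f (- g)).
have e2 : perm_vars s (- g) = - perm_vars s g.
  exact: (linearN (feval (@fop K 7) (fun i => gen K (s i))) g).
exact: etrans e1 (congr1 (fun x => a *: perm_vars s f + x) e2).
Qed.

Lemma p_image s : consequences7 (4%:R *: perm_vars s p - Phi (alt_vec *m R K s)).
Proof. by rewrite Phi_R -perm_varsE; apply: consequences_perm; apply: p_cong. Qed.

Lemma alt_vec_swap x y w : (x < 5)%N -> (y < 5)%N -> x != y -> okw w ->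
  alt_vec *m R K (pw (swp x y w)) = - (alt_vec *m R K (pw w)).
Proof.
move=> lx ly xy ok; have lx' : (x < 7)%N by apply: leq_trans lx _.
have ly' : (y < 7)%N by apply: leq_trans ly _.
rewrite okw_swp ?okw_swpE ?okw_size // RM mulmxA.
have bin : (iota 0 5, true) \in bl5 by [].
have h : blocks_sym K bl5 *m tp K x y = sg true *: blocks_sym K bl5.
  by apply: (eB_tp K okbl5 bin); rewrite ?mem_iota.
rewrite /alt_vec -[bvec K p_alt *m blocks_sym K bl5 *m R K (tperm _ _)]mulmxA -/(tp K x y) h.
by rewrite /sign_of expr1 scaleN1r mulmxN mulNmx.
Qed.

(** As alt_vec changes sign when two of the first five variables are exchanged,
    sorting their images changes its translate by a sign only. *)
Lemma coset_sort s : exists2 c, c \in cosets & exists a : K, alt_vec *m R K s = a *: (alt_vec *m R K (pw c)).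
Proof.
have ok := okw_word s; pose w := word s.
have sw : size w = 7 := okw_size ok.
pose t := drop 5 w; have sz5 : size (take 5 w) = 5 by rewrite size_takel ?sw.
exists (sort leq (take 5 w) ++ t).
  have -> : sort leq (take 5 w) = [seq z <- iota 0 7 | ~~ meml z t].
    have pe : perm_eq (take 5 w) [seq z <- iota 0 7 | ~~ meml z t].
      apply: uniq_perm; [by rewrite take_uniq // okw_uniq|by rewrite filter_uniq ?iota_uniq|].
      move=> z; rewrite mem_filter memlE -(perm_mem ok) -/w.
      have uw : uniq (take 5 w ++ t) by rewrite cat_take_drop okw_uniq.
      rewrite -[in RHS](cat_take_drop 5 w) mem_cat -/t.
      move: uw; rewrite cat_uniq => /and3P[_ /hasPn h _].
      by case zt: (z \in t) => /=; rewrite ?orbF // (negbTE (h z zt)).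
    apply: (sorted_eq leq_trans anti_leq); rewrite ?sort_sorted //; [exact: leq_total| |].
      by apply: sorted_filter; [exact: leq_trans|].
    by rewrite (perm_trans _ pe) // perm_sort.
  apply/mapP; exists t => //.
  have st : size t = 2 by rewrite size_drop sw.
  have ut : uniq t by rewrite drop_uniq // okw_uniq.
  have lt z : z \in t -> z \in iota 0 7 by move=> /mem_drop; rewrite (perm_mem ok).
  case: (t) st ut lt => [|x [|y [|? ?]]] // _ /andP[xy _] lt.
  apply/allpairsPdep; exists x, y; split=> //; first by apply: lt; rewrite mem_head.
  rewrite mem_filter lt ?inE ?eqxx ?orbT // andbT.
  by apply/negP => /Nat.eqb_spec e; rewrite e mem_head in xy.
pose P a := size a = 5 -> okw (a ++ t) -> exists c : K, alt_vec *m R K s = c *: (alt_vec *m R K (pw (a ++ t))).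
have Pw : P (take 5 w).
  by move=> _ _; exists 1; rewrite cat_take_drop pw_word scale1r.
have : P (sort leq (take 5 w)).
  apply: (perm_swap_ind (P := P) _ _ Pw); last by rewrite perm_sym perm_sort.
  move=> s1 x y s2 IH ss ok'.
  have szx : size (s1 ++ x :: y :: (s2 ++ t)) = 7.
    by move: (okw_size ok'); rewrite !size_cat /= !size_cat; lia.
  have e : (s1 ++ y :: x :: s2) ++ t = swp (size s1) (size s1).+1 (s1 ++ x :: y :: (s2 ++ t)).
    by rewrite swp_adj -?catA.
  have ok1 : okw (s1 ++ x :: y :: (s2 ++ t)).
    move: ok'; rewrite e okw_swpE //.
    - by move: ss; rewrite size_cat /=; lia.
    - by move: ss; rewrite size_cat /=; lia.
  have [||c ec] := IH; [by rewrite -ss !size_cat|by rewrite -catA|].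
  exists (- c); rewrite e alt_vec_swap //; last 1 first.
  - by rewrite neq_ltn ltnSn.
  - by rewrite ec -catA scaleNr scalerN opprK.
  - by move: ss; rewrite size_cat /=; lia.
  - by move: ss; rewrite size_cat /=; lia.
apply; first by rewrite size_sort.
apply: perm_trans ok; rewrite -[word s]/w -{2}(cat_take_drop 5 w) perm_cat2r perm_sort.
by [].
Qed.
End NewIdentity.

(** * The two dimensions *)

Section Dimensions.
Variable K : numFieldType.
Local Notation N := #|{: X}|.
Local Notation p := (new_identity K).
Local Notation A := (freeskew K 7).

Lemma deltas : foldr (fun c acc => Z.add (Z.mul c.1 (Z.of_nat (size (c_B c.2)))) acc) 0%ZZ all_certs = 357%ZZ.
Proof. by vm_compute. Qed.

(** The sizes of the lists c_B are the multiplicities of the quotient in the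
    characters induced from the Young subgroups; the combination of characters
    turns them into its dimension. *)
Lemma rank_difference : \rank (DC K) = (\rank (DI K) + 357)%N.
Proof.
have hC := rank_from_table (@DC_stable K) table_checked.
have hI := rank_from_table (@DI_stable K) table_checked.
apply/eqP; rewrite -(eqr_nat K) natrD hC hI -(zR_nat K 357) -[Z.of_nat 357]deltas.
have := all_checked; elim: all_certs => [|c l IH] /=; first by rewrite !big_nil rmorph0 addr0.
case/andP=> ck /IH{IH} /eqP IH; rewrite !big_cons /= IH (check_rank K ck) natrD mulrDr.
have zRD u v : zR K (Z.add u v) = zR K u + zR K v by exact: (rmorphD (zR K)).
rewrite zRD zRM zR_nat; apply/eqP.
by rewrite addrACA.
Qed.

Lemma rank_AI : \rank (AI K) = (\rank (AC K) + 357)%N.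
Proof.
have := rank_difference; rewrite /DC /DI !rank_ann -/(AC K) -/(AI K).
have := rank_leq_row (AC K); have := rank_leq_row (AI K); have := mxrankS (AC_AI K).
move: (\rank (AC K)) (\rank (AI K)) => a b; lia.
Qed.

(** A complement of the consequences in the identities, carried to polynomials
    by Phi. *)
Lemma quotient_dim357 : quotient_dim (@identities7 K) (@consequences7 K) 357.
Proof.
set Q := ((AI K) :\: (AC K))%MS.
have rQ : \rank Q = 357%N.
  have := mxrank_cap_compl (AI K) (AC K); rewrite -/Q rank_AI.
  have -> : \rank (AI K :&: AC K)%MS = \rank (AC K).
    by rewrite (capmx_idPr (AC_AI K)).
  by lia.
rewrite -rQ; set U := row_base Q.
have UQ : (U <= Q)%MS by rewrite eq_row_base.
have QI : (Q <= AI K)%MS by apply: diffmxSl.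
exists (fun i => Phi (row i U)); split.
  by move=> i; apply/AIP; apply: submx_trans (row_sub _ _) (submx_trans UQ QI).
have comb (c : 'rV[K]_(\rank Q)) : \sum_i c 0 i *: Phi (row i U) = Phi (c *m U).
  by rewrite mulmx_sum_row Phi_comb.
have cong x (c : 'rV[K]_(\rank Q)) : consequences7 (Phi x - \sum_i c 0 i *: Phi (row i U)) <-> (x - c *m U <= AC K)%MS.
  by rewrite comb -scaleN1r -PhiZ -PhiD scaleN1r ACP.
move=> f If; have [x ef] := Phi_onto If.1.
have xI : (x <= AI K)%MS by apply/AIP; rewrite -ef.
have : (x <= Q + AC K)%MS.
  apply: submx_trans xI _; rewrite -(addsmx_diff_cap_eq (AI K) (AC K)).
  by apply: addsmxS; [rewrite /Q|apply: capmxSr].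
case/sub_addsmxP=> -[u1 u2] /= ex.
have /submxP[c ec] : (u1 *m Q <= U)%MS by rewrite eq_row_base submxMl.
exists c; split.
  by rewrite ef; apply/cong; rewrite ex ec addrC addKr submxMl.
move=> c'; rewrite ef => /cong h'.
have h : (x - c *m U <= AC K)%MS by rewrite ex ec addrC addKr submxMl.
apply/eqP; rewrite -subr_eq0; apply/eqP.
have cap0 : (Q :&: AC K)%MS = 0 by exact: capmx_diff.
have : ((c - c') *m U <= Q :&: AC K)%MS.
  rewrite sub_capmx (submx_trans (submxMl _ _) UQ) /=.
  rewrite mulmxBl (_ : c *m U - c' *m U = (x - c' *m U) - (x - c *m U)); last first.
    by rewrite opprB addrC [RHS]addrC -addrA [c *m U + _]addrC; congr (_ + _); rewrite addrA addNr add0r.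
  by rewrite addmx_sub // eqmx_opp.
rewrite cap0 submx0 => /eqP e0; apply: (row_free_inj (row_base_free Q)).
by rewrite e0 mul0mx.
Qed.

Lemma fam_permw m s w : okw s -> wform K m w *m R K (pw s)^-1%g = wform K m (permw s w).
Proof.
move=> ok; rewrite /wform evf_R; congr evf; apply: funext => i.
by rewrite /pt invgK pwE // /permw (nth_map 0%N) ?okw_size.
Qed.

(** The value of a translate at a substitution is the value of b at the permuted
    substitution. *)
Lemma translates_independent n bl (b : seq (Z * Number.uint)) (cs ws : seq (seq nat)) (x : 'rV[K]_n) :
  okbl bl -> all (fun t => okcol (digits t.2)) b -> size cs = n -> all okw cs -> all (okp 10) ws ->
  elim n (map (map modp) (map (fun w => map (fun s => bval v10 (expand bl (permw s w)) b) cs) ws)) ->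
  consequences7 (Phi (\sum_i x 0 i *: (bvec K b *m blocks_sym K bl *m R K (pw (nth [::] cs i))))) -> x = 0.
Proof.
move=> okb okcb scs /allP cok /allP pok el cy.
apply: trmx_inj; rewrite trmx0.
apply: (elim_inj el); first by apply/allP => _ /mapP[w _ ->]; rewrite size_map scs.
move=> _ /mapP[w win ->].
have /DCP/(_ _ cy) : (wform K v10 w <= DC K)%MS := fam_DC K w v10_ok.
rewrite linear_sum mulmx_sumr summxE => e0; rewrite -[RHS]e0; apply: eq_bigr => i _.
have li : (i < size cs)%N by rewrite scs.
have okc : okw (nth [::] cs i) by apply: cok; rewrite mem_nth.
rewrite (nth_map [::]) // mxE.
have okpw : okp (mn v10) (permw (nth [::] cs i) w).
  have /andP[/eqP sw /allP w10] := pok w win.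
  rewrite /okp size_map okw_size //=; apply/allP => z /mapP[k kin ->]; apply: w10.
  by rewrite mem_nth // sw; move: kin; rewrite (perm_mem okc) mem_iota.
rewrite (bvalP K okb okpw okcb) -fam_permw //.
rewrite /= [trmx (_ *: _)]linearZ /= -scalemxAr [RHS]mxE mulrC; congr (_ * _).
by rewrite !trmx_mul RT (eB_abs K okb).2 !mulmxA.
Qed.

Let coset (i : 'I_42) : 'S_7 := pw (nth [::] cosets i).
Let b (i : 'I_42) : A := perm_vars (coset i) p.

Lemma size_cosets : size cosets = 42. Proof. by vm_compute. Qed.


Lemma images_independent (x : 'rV[K]_42) : consequences7 (\sum_i x 0 i *: b i) -> x = 0.
Proof.
move=> cx.
have cy : consequences7 (Phi (\sum_i x 0 i *: (alt_vec K *m R K (coset i)))).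
  rewrite Phi_comb.
  have -> : \sum_i x 0 i *: Phi (alt_vec K *m R K (coset i)) =
     4%:R *: (\sum_i x 0 i *: b i) - \sum_i x 0 i *: (4%:R *: b i - Phi (alt_vec K *m R K (coset i))).
    rewrite scaler_sumr -sumrB; apply: eq_bigr => i _.
    by rewrite scalerBr !scalerA mulrC opprB addrC subrK.
  apply: conseqB; first exact: conseqZ.
  by apply: conseq_sum => i; apply: conseqZ; apply: p_image.
by case/and4P: independent => /eqP scs cok pok el; apply: translates_independent okbl5 p_alt_ok scs cok pok el cy.
Qed.

Lemma combine4 (W : lmodType K) (P B F : W) a :
  P - a *: B = 4%:R^-1 *: ((4%:R *: P - a *: F) - a *: (4%:R *: B - F)).
Proof.
rewrite [a *: (_ - _)]scalerBr opprB addrA subrK [a *: (4%:R *: _)]scalerA mulrC -scalerA -scalerBr.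
by rewrite scalerA mulVf ?nz4 // scale1r.
Qed.

Lemma image_class s : exists i a, consequences7 (perm_vars s p - a *: b i).
Proof.
have [c cin [a ea]] := coset_sort K s.
have lt : (index c cosets < 42)%N.
  by apply: leq_trans (eq_leq size_cosets); rewrite index_mem.
exists (Ordinal lt), a; pose i := Ordinal lt.
have ec : coset i = pw c by rewrite /coset /= nth_index.
have -> : perm_vars s p - a *: b i = 4%:R^-1 *: ((4%:R *: perm_vars s p - Phi (alt_vec K *m R K s))
     - a *: (4%:R *: b i - Phi (alt_vec K *m R K (coset i)))).
  by rewrite ea ec PhiZ; apply: combine4.
apply: conseqZ; apply: conseqB; [exact: p_image|apply: conseqZ; exact: p_image].
Qed.

Lemma sum_regroup (W : lmodType K) (I : finType) n (c : I -> K) (idx : I -> 'I_n) (g : 'I_n -> W) :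
  \sum_i (\sum_s c s *: delta_mx 0 (idx s) : 'rV[K]_n) 0 i *: g i = \sum_s c s *: g (idx s).
Proof.
transitivity (\sum_i \sum_s (c s * (i == idx s)%:R) *: g i).
  apply: eq_bigr => i _; rewrite -scaler_suml; congr (_ *: _).
  by rewrite summxE; apply: eq_bigr => s _; rewrite !mxE eqxx.
rewrite exchange_big; apply: eq_bigr => s _; rewrite (bigD1 (idx s)) //= eqxx mulr1 big1 ?addr0 //.
by move=> i ni; rewrite (negbTE ni) mulr0 scale0r.
Qed.

Lemma diff_regroup (W : lmodType K) (I : finType) (f : W) (c co : I -> K) (P B : I -> W) :
  f - \sum_s (c s * co s) *: B s = (f - \sum_s c s *: P s) + \sum_s c s *: (P s - co s *: B s).
Proof.
have -> : \sum_s c s *: (P s - co s *: B s) = \sum_s c s *: P s - \sum_s (c s * co s) *: B s.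
  by rewrite -sumrB; apply: eq_bigr => s _; rewrite scalerBr scalerA.
by rewrite addrA subrK.
Qed.

Lemma sub_regroup (W : lmodType K) n (d d' : 'rV[K]_n) (g : 'I_n -> W) f :
  \sum_i (d - d') 0 i *: g i = (f - \sum_i d' 0 i *: g i) - (f - \sum_i d 0 i *: g i).
Proof.
rewrite opprB [RHS]addrC addrA subrK -sumrB.
by apply: eq_bigr => i _; rewrite !mxE scalerBl.
Qed.

(** The classes of the translates by representatives of the 42 cosets span the
    generated module, by sorting, and are independent. *)
Lemma quotient_dim42 : quotient_dim (generated_mod (@consequences7 K) p) (@consequences7 K) 42.
Proof.
exists b; split.
  move=> i; exists (fun s => (s == coset i)%:R).
  rewrite (bigD1 (coset i)) //= eqxx scale1r big1 ?addr0 ?subrr; first exact: conseq0.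
  by move=> s ns; rewrite (negbTE ns) scale0r.
move=> f [c cf].
pose idx s := sval (cid (image_class s)).
pose co s := sval (cid (svalP (cid (image_class s)))).
have ic s : consequences7 (perm_vars s p - co s *: b (idx s)) := svalP (cid (svalP (cid (image_class s)))).
pose d : 'rV[K]_42 := \sum_s (c s * co s) *: delta_mx 0 (idx s).
have ed : \sum_i d 0 i *: b i = \sum_s (c s * co s) *: b (idx s) := sum_regroup _ _ _.
have cd : consequences7 (f - \sum_i d 0 i *: b i).
  rewrite ed (diff_regroup f c co (fun s => perm_vars s p)).
  by apply: conseqD => //; apply: conseq_sum => s; apply: conseqZ; apply: ic.
exists d; split=> // d' cd'; apply/eqP; rewrite -subr_eq0; apply/eqP.
apply: images_independent.
exact: (eq_ind_r (fun z => consequences7 z) (conseqB cd' cd) (sub_regroup d d' b f)).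
Qed.

Lemma p_not_consequence : ~ consequences7 p.
Proof.
move=> cp; pose x : 'rV[K]_42 := delta_mx 0 ord0.
have : x = 0.
  apply: images_independent; rewrite (bigD1 ord0) //= big1 ?addr0 => [|i ni].
    by apply: conseqZ; apply: consequences_perm.
  by rewrite mxE (negbTE ni) andbF scale0r.
by move=> /matrixP /(_ 0 ord0) /eqP; rewrite !mxE !eqxx oner_eq0.
Qed.
End Dimensions.

Theorem theorem5p3 (R : realType) :
  [/\ (forall f : freeskew R[i] 7, consequences7 f -> identities7 f),
      quotient_dim (@identities7 R[i]) (@consequences7 R[i]) 357,
      identities7 (new_identity R[i]),
      ~ consequences7 (new_identity R[i]) &
      quotient_dim (generated_mod (@consequences7 R[i]) (new_identity R[i]))
        (@consequences7 R[i]) 42].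
Proof.
split; [exact: consequences_identities|exact: quotient_dim357|exact: p_ident
       |exact: p_not_consequence|exact: quotient_dim42].
Qed.
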